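(* Let $\Sigma_g$ be a closed, connected, orientable surface of genus $g\ge2$ with a simple curve system $\mathcal C=\{\gamma_j\}$, $j=1,\dots,3g-3$. Let $\rho:\pi_1(\Sigma_g)\to\mathrm{SU}(3,1)$ be a tame representation. Then $30g-30$ real parameters are needed to specify $\rho$ in the deformation space $\mathrm{Hom}(\pi_1(\Sigma_g),\mathrm{SU}(3,1))/\mathrm{SU}(3,1)$. Specifically, $\rho$ is determined up to conjugation in $\mathrm{SU}(3,1)$ by the following coordinates: $4g-4$ complex traces, $4g-4$ (real) $\sigma$-invariants, $2g-2$ points on the $5$ (real) dimensional cross-ratio variety, $2g-2$ (complex) $\alpha$-invariants, $2g-2$ (complex) $\beta$-invariants, and $3g-3$ twist-bend parameters (each with $3$ real parameters), subject to $3g-3$ constraints corresponding to the compatibility conditions (each amounting to $3$ real conditions).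
   Context: $\mathbb C^{3,1}$ is $\mathbb C^4$ with the Hermitian form $\langle z,w\rangle=z_1\bar w_4+z_2\bar w_2+z_3\bar w_3+z_4\bar w_1$ of signature $(3,1)$; $\mathrm{SU}(3,1)$ is the group of determinant-one matrices preserving it. A vector $v\ne0$ is positive, null or negative according to the sign of $\langle v,v\rangle$. $\mathbf H^3_{\mathbb C}$ is the projectivization of the negative vectors, $\partial\mathbf H^3_{\mathbb C}$ that of the null vectors. A $\mathbb C^2$-chain is the boundary of the projectivization of a copy of $\mathbb C^{2,1}$. The $\mathbb C^2$-chain polar to a positive vector $c$ is the set of points of $\partial\mathbf H^3_{\mathbb C}$ represented by null vectors in $c^\perp$. An element $A\in\mathrm{SU}(3,1)$ is loxodromic if it fixes no point of $\mathbf H^3_{\mathbb C}$ and exactly two points of $\partial\mathbf H^3_{\mathbb C}$. Its eigenvalues are $re^{i\theta},r^{-1}e^{i\theta},e^{i\phi},e^{-i(2\theta+\phi)}$, $r>1$. $\mathbf a_A,\mathbf r_A$ denote null eigenvectors for $re^{i\theta},r^{-1}e^{i\theta}$, and $\mathbf x_A,\mathbf y_A$ denote mutually orthogonal positive unit eigenvectors for $e^{i\phi},e^{-i(2\theta+\phi)}$ respectively. The labelling is a fixed convention depending only on the set of eigenvalues; if $e^{i\phi}=e^{-i(2\theta+\phi)}$, $\mathbf x_A,\mathbf y_A$ is a chosen orthonormal basis of the positive eigenspace. Every loxodromic $A$ is $A=QE(\lambda,\phi)Q^{-1}$ with $Q\in\mathrm{SU}(3,1)$ having columns proportional to $\mathbf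 a_A,\mathbf x_A,\mathbf y_A,\mathbf r_A$, where $E(\lambda,\psi)=\mathrm{diag}(e^{\lambda},e^{-i\psi+\frac{\bar\lambda-\lambda}{2}},e^{i\psi+\frac{\bar\lambda-\lambda}{2}},e^{-\bar\lambda})$, $\Re\lambda>0$, $\Im\lambda,\psi\in(-\pi,\pi]$. Invariants: $\mathrm{tr}(A)$ and $\sigma(A)=\frac12(\mathrm{tr}^2(A)-\mathrm{tr}(A^2))\in\mathbb R$; with $[z_1,z_2,z_3,z_4]=\frac{\langle z_3,z_1\rangle\langle z_4,z_2\rangle}{\langle z_4,z_1\rangle\langle z_3,z_2\rangle}$, $\mathbb X_1(A,B)=[\mathbf a_B,\mathbf a_A,\mathbf r_A,\mathbf r_B]$, $\mathbb X_2(A,B)=[\mathbf a_B,\mathbf r_A,\mathbf a_A,\mathbf r_B]$, $\mathbb X_3(A,B)=[\mathbf a_A,\mathbf r_A,\mathbf a_B,\mathbf r_B]$; $\alpha$-invariants $\alpha_1(A,B)=[\mathbf r_A,\mathbf a_A,\mathbf x_B,\mathbf a_B]$, $\alpha_2(A,B)=[\mathbf r_A,\mathbf a_A,\mathbf y_B,\mathbf a_B]$; $\beta$-invariants $\beta_1(A,B)=[\mathbf r_B,\mathbf a_B,\mathbf x_A,\mathbf a_A]$, $\beta_2(A,B)=[\mathbf r_B,\mathbf a_B,\mathbf y_A,\mathbf a_A]$. The cross-ratio variety is the set of all triples $(\mathbb X_1,\mathbb X_2,\mathbb X_3)(A,B)$ for pairs of loxodromic elements; its points have five real degrees of freedom.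 A pair $(A,B)$ of loxodromic elements (and the free subgroup $\langle A,B\rangle$ it generates) is non-singular if: (i) $A,B$ have no common fixed point; (ii) their fixed points in $\partial\mathbf H^3_{\mathbb C}$ do not lie on a common $\mathbb C^2$-chain; (iii) the fixed-point set of $A$ is disjoint from at least one of the $\mathbb C^2$-chains polar to $\mathbf x_B,\mathbf y_B$, and the fixed-point set of $B$ is disjoint from at least one of those polar to $\mathbf x_A,\mathbf y_A$. A non-singular pair has at least one (well-defined) non-zero $\alpha$-invariant and one non-zero $\beta$-invariant. A $(0,3)$ group is a group $\langle A,B\rangle$ with $A,B,AB$ loxodromic; $A$, $B$, $B^{-1}A^{-1}$ are its peripheral elements. Curve system: $\mathcal C=\{\gamma_j\}_{j=1}^{3g-3}$ is a maximal family of simple closed curves (geodesics in their homotopy classes, disjoint) on $\Sigma_g$, homotopically non-trivial and pairwise non-homotopic, so $\Sigma_g\setminus\bigcup\gamma_j$ is a union of $2g-2$ pairs of pants. It is simple if $g$ of the curves $\gamma_j$ each correspond to two boundary components of the same pair of pants. If $\rho(\gamma_j)$ is loxodromic for all $j$, each pair of pants gives a $(0,3)$ group $\langle A,B\rangle$ whose peripheral elements represent the three boundary curves. A discrete, faithful, totally loxodromic (all non-trivial elements map to loxodromics) representation $\rho$ is tame if each of these $(0,3)$ groups is non-singular. Coordinates: for each of the $2g-2$ $(0,3)$ groups $\langle A,B\rangle$ one records $\mathrm{tr}(A),\mathrm{tr}(B),\sigma(A),\sigma(B)$, $(\mathbb X_1,\mathbb X_2,\mathbb X_3)(A,B)$,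 one non-zero $\alpha$-invariant and one non-zero $\beta$-invariant. Compatibility: for each $\gamma_j$, of the two peripheral elements corresponding to the two sides of $\gamma_j$, one is conjugate to the inverse of the other (a condition on one complex trace and one real $\sigma$). For each $\gamma_j$ there is a twist-bend parameter $(\kappa,\psi)$ with $\Re\kappa\in\mathbb R$, $\Im\kappa,\psi\in(-\pi,\pi]$: if $A=QE(\lambda,\phi)Q^{-1}$ is the peripheral element for $\gamma_j$, then $K=QE(\kappa,\psi)Q^{-1}$ commutes with $A$. When $\gamma_j$ separates two different pieces with groups $\langle A,B\rangle$ and $\langle C,A^{-1}\rangle$, relative to a fixed reference group $\langle A,B,C\rangle$ the glued group is $\langle A,B,KCK^{-1}\rangle$. When $\gamma_j$ corresponds to two boundary components of the same pair of pants with peripheral elements $A$ and $BA^{-1}B^{-1}$ ($B$ a fixed reference conjugating element), the glued group is $\langle A,BK\rangle$ (closing a handle). Twist-bend parameters are always measured relative to such reference groups, fixed in advance (up to simultaneous conjugation) for given $(0,3)$ pieces.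
   Formalization: When ρ(γ_j) has a repeated eigenvalue a twist-bend parameter relative to a prescribed reference group may not exist; existence is stated for every reference when eigenvalues are distinct and otherwise for a suitable reference system. Determination by the coordinates is unrestricted. *)

(* Defs.v *)
(* MathComp-Analysis, over an arbitrary realType R; the complex numbers are
   the type R[i] of mathcomp-real-closed. *)
From HB Require Import structures.
From mathcomp Require Import all_boot all_order all_algebra.
From mathcomp Require Import complex.
From mathcomp Require Import all_classical all_reals all_analysis.

Set Implicit Arguments.
Unset Strict Implicit.
Unset Printing Implicit Defensive.

Import Order.TTheory GRing.Theory Num.Theory.
Import numFieldNormedType.Exports.

Local Open Scope classical_set_scope.
Local Open Scope complex_scope.
Local Open Scope ring_scope.

Section ComplexHyperbolic.
Variable R : realType.
Notation C := R[i].
Notation V := 'cV[C]_4.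
Notation M := 'M[C]_4.
Implicit Types (A B g K Q : M) (u v w z c : V).

Definition cis (t : R) : C := cos t +i* sin t.
Definition cexp (z : C) : C := (expR (complex.Re z))%:C * cis (complex.Im z).
Definition is_angle (t : R) : Prop := - pi < t /\ t <= pi.
Definition arg (z : C) : R :=
  xget 0 [set t | is_angle t /\ z = `|z| * cis t].

Definition ix1 : 'I_4 := inord 0.
Definition ix2 : 'I_4 := inord 1.
Definition ix3 : 'I_4 := inord 2.
Definition ix4 : 'I_4 := inord 3.

Definition herm z w : C :=
  z ix1 0 * (w ix4 0)^* + z ix2 0 * (w ix2 0)^*
  + z ix3 0 * (w ix3 0)^* + z ix4 0 * (w ix1 0)^*.

Definition SU31 A : Prop :=
  \det A = 1 /\ forall z w, herm (A *m z) (A *m w) = herm z w.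

(* Points of H^3_C and of its boundary are represented by negative and null
   vectors; [same_point] is equality in projective space. *)
Definition positive v : Prop := 0 < herm v v.
Definition negative v : Prop := herm v v < 0.
Definition null v : Prop := v != 0 /\ herm v v = 0.
Definition same_point u v : Prop := exists2 k : C, k != 0 & u = k *: v.
Definition fixes A v : Prop := exists k : C, A *m v = k *: v.
Definition fixpoints A : set V := [set v | null v /\ fixes A v].

Definition loxodromic A : Prop :=
  [/\ SU31 A,
      forall v, negative v -> ~ fixes A v &
      exists u w, [/\ fixpoints A u, fixpoints A w, ~ same_point u w &
        forall v, fixpoints A v -> same_point v u \/ same_point v w]].

Record frame := Frame { fr_a : V; fr_x : V; fr_y : V; fr_r : V }.

Definition eigenframe A (F : frame) : Prop :=
  [/\ null (fr_a F), null (fr_r F),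
      [/\ herm (fr_x F) (fr_x F) = 1, herm (fr_y F) (fr_y F) = 1 &
          herm (fr_x F) (fr_y F) = 0] &
      exists r theta phi : R, 1 < r /\
        [/\ A *m fr_a F = (r%:C * cis theta) *: fr_a F,
            A *m fr_r F = (r^-1%:C * cis theta) *: fr_r F,
            A *m fr_x F = cis phi *: fr_x F &
            A *m fr_y F = cis (- (2 * theta + phi)) *: fr_y F]].

(* A labelling convention selects, from the eigenvalues alone (that is, from
   the characteristic polynomial), the one belonging to x_A.  When the two
   eigenvalues of positive type coincide, a labelled frame still depends on
   the choice of an orthonormal basis x_A, y_A of the eigenspace. *)
Definition labelling (lab : {poly C} -> C) : Prop :=
  forall A, loxodromic A ->
    exists2 v, positive v & A *m v = lab (char_poly A) *: v.

Definition labelled (lab : {poly C} -> C) A (F : frame) : Prop :=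
  eigenframe A F /\ A *m fr_x F = lab (char_poly A) *: fr_x F.

Definition Emx (l : C) (psi : R) : M :=
  diag_mx (\row_(j < 4)
    [:: cexp l;
        cexp (- (0 +i* psi) + (l^* - l) / 2);
        cexp ((0 +i* psi) + (l^* - l) / 2);
        cexp (- l^*)]`_j).

Definition cj g A : M := g *m A *m invmx g.

Definition diagonalizes (lab : {poly C} -> C) A Q : Prop :=
  [/\ SU31 Q,
      exists2 F, labelled lab A F &
        [/\ same_point (col ix1 Q) (fr_a F), same_point (col ix2 Q) (fr_x F),
            same_point (col ix3 Q) (fr_y F) & same_point (col ix4 Q) (fr_r F)] &
      exists l phi, [/\ 0 < complex.Re l, is_angle (complex.Im l),
        is_angle phi & A = cj Q (Emx l phi)]].

Definition conj1 A B : Prop := exists2 g, SU31 g & B = cj g A.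
Definition conj2 (p q : M * M) : Prop :=
  exists2 g, SU31 g & q.1 = cj g p.1 /\ q.2 = cj g p.2.

Definition sigma A : C := (\tr A ^+ 2 - \tr (A *m A)) / 2.

Definition cross_ratio (z1 z2 z3 z4 : V) : C :=
  (herm z3 z1 * herm z4 z2) / (herm z4 z1 * herm z3 z2).

Definition X_inv (FA FB : frame) : C * C * C :=
  (cross_ratio (fr_a FB) (fr_a FA) (fr_r FA) (fr_r FB),
   cross_ratio (fr_a FB) (fr_r FA) (fr_a FA) (fr_r FB),
   cross_ratio (fr_a FA) (fr_r FA) (fr_a FB) (fr_r FB)).

(* [k = false] is the first alpha-invariant (through x_B), [k = true] the
   second one (through y_B). *)
Definition alpha_inv (k : bool) (FA FB : frame) : C :=
  cross_ratio (fr_r FA) (fr_a FA) (if k then fr_y FB else fr_x FB) (fr_a FB).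
Definition beta_inv (k : bool) (FA FB : frame) : C :=
  cross_ratio (fr_r FB) (fr_a FB) (if k then fr_y FA else fr_x FA) (fr_a FA).

Definition no_common_fixpoint A B : Prop :=
  forall v, v != 0 -> herm v v <= 0 -> ~ (fixes A v /\ fixes B v).

(* X_3 is a genuine quotient only when A and B have no common fixed point. *)
Definition cross_ratio_variety : set (C * C * C) :=
  [set t | exists A B FA FB,
     [/\ loxodromic A, loxodromic B, no_common_fixpoint A B,
         eigenframe A FA /\ eigenframe B FB & t = X_inv FA FB]].

(* On the cross-ratio variety |X_2| = |X_1| |X_3|. *)
Definition xr_coord (t : C * C * C) (k : 'I_5) : R :=
  [:: complex.Re t.1.1; complex.Im t.1.1; arg t.1.2;
      complex.Re t.2; complex.Im t.2]`_k.

Definition C2_chain (X : set V) : Prop :=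
  exists p q n : V,
    [/\ [/\ herm p p = 1, herm q q = 1 & herm n n = -1],
        [/\ herm p q = 0, herm p n = 0 & herm q n = 0] &
        X = [set v | null v /\
               exists a b c : C, v = a *: p + b *: q + c *: n]].

Definition polar_chain c : set V := [set v | null v /\ herm v c = 0].

Definition nonsingular A B : Prop :=
  [/\ loxodromic A /\ loxodromic B,
      no_common_fixpoint A B,
      ~ (exists2 X, C2_chain X & fixpoints A `<=` X /\ fixpoints B `<=` X) &
      exists FA FB, [/\ eigenframe A FA, eigenframe B FB,
        fixpoints A `&` polar_chain (fr_x FB) = set0 \/
        fixpoints A `&` polar_chain (fr_y FB) = set0 &
        fixpoints B `&` polar_chain (fr_x FA) = set0 \/
        fixpoints B `&` polar_chain (fr_y FA) = set0]].

(* Coordinates of a (0,3) group; the two booleans record which alpha- and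
   beta-invariant is used. *)
Record piece_coord := PieceCoord {
  pc_trA : C; pc_trB : C;
  pc_sigmaA : R; pc_sigmaB : R;
  pc_X : C * C * C;
  pc_akind : bool; pc_alpha : C;
  pc_bkind : bool; pc_beta : C }.

Definition piece_coord_of (lab : {poly C} -> C) (p : M * M)
    (c : piece_coord) : Prop :=
  [/\ \tr p.1 = pc_trA c /\ \tr p.2 = pc_trB c,
      sigma p.1 = (pc_sigmaA c)%:C /\ sigma p.2 = (pc_sigmaB c)%:C,
      pc_alpha c != 0 /\ pc_beta c != 0 &
      exists FA FB, [/\ labelled lab p.1 FA, labelled lab p.2 FB,
        X_inv FA FB = pc_X c,
        alpha_inv (pc_akind c) FA FB = pc_alpha c &
        beta_inv (pc_bkind c) FA FB = pc_beta c]].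

(* The peripheral elements A, B, B^-1 A^-1 of <A, B>. *)
Definition peripheral (p : M * M) (i : 'I_3) : M :=
  [:: p.1; p.2; invmx p.2 *m invmx p.1]`_i.

(* The three real quantities (one complex trace and one real sigma) that vanish
   when P' is conjugate to the inverse of P. *)
Definition mismatch (P P' : M) (k : 'I_3) : R :=
  [:: complex.Re (\tr P' - \tr (invmx P)); complex.Im (\tr P' - \tr (invmx P));
      complex.Re (sigma P' - sigma (invmx P))]`_k.

(* Reference groups, chosen once and for all for given pieces up to conjugation.
   - [sep_ref p q], for pieces p = <A, B> and q = <C, A^-1>: a group
     <A, B, C>, with a matrix Q diagonalizing A;
   - [handle_ref p], for a piece p with peripheral elements A, B A^-1 B^-1:
     a group <A, B>, with a matrix Q diagonalizing A. *)
Record sep_group := SepGroup { sA : M; sB : M; sC : M; sQ : M }.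
Record handle_group := HandleGroup { hA : M; hB : M; hQ : M }.

Record references (J : Type) := References {
  sep_ref : J -> M * M -> M * M -> sep_group;
  handle_ref : J -> M * M -> handle_group }.

Definition reference_system (lab : {poly C} -> C) (J : Type)
    (S : references J) : Prop :=
  [/\ forall j p p' q q', conj2 p p' -> conj2 q q' ->
        sep_ref S j p q = sep_ref S j p' q',
      forall j p p', conj2 p p' -> handle_ref S j p = handle_ref S j p',
      forall j p q, loxodromic p.1 -> SU31 p.2 -> SU31 q.1 ->
        conj1 (invmx p.1) q.2 ->
        let G := sep_ref S j p q in
        [/\ diagonalizes lab (sA G) (sQ G), conj2 p (sA G, sB G) &
            conj2 q (sC G, invmx (sA G))] &
      forall j p, loxodromic p.1 -> conj1 (invmx p.1) p.2 ->
        let G := handle_ref S j p in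
        [/\ diagonalizes lab (hA G) (hQ G), SU31 (hB G) &
            conj2 p (hA G, cj (hB G) (invmx (hA G)))]].

End ComplexHyperbolic.

Section Surfaces.
Variables (R : realType) (S : topologicalType).
Implicit Types (p q c d : R -> S).

(* A path is a function on R of which only the values on [0, 1] matter. *)
Definition I01 : set R := `[0, 1].
Definition square : set (R * R) := I01 `*` I01.

Definition is_path p : Prop := {within I01, continuous p}.
Definition pcat p q : R -> S :=
  fun t => if t <= 2^-1 then p (2 * t) else q (2 * t - 1).
Definition prev p : R -> S := fun t => p (1 - t).
Definition path_from_to (x y : S) p : Prop :=
  [/\ is_path p, p 0 = x & p 1 = y].
Definition loop_at (x : S) p : Prop := path_from_to x x p.

Definition path_homotopic p q : Prop :=
  exists H : R * R -> S, {within square, continuous H} /\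
    forall t, I01 t -> [/\ H (0, t) = p t, H (1, t) = q t,
                           H (t, 0) = p 0 & H (t, 1) = p 1].
Definition null_homotopic c : Prop := path_homotopic c (fun=> c 0).

Definition freely_homotopic c d : Prop :=
  exists H : R * R -> S, {within square, continuous H} /\
    forall t, I01 t -> [/\ H (0, t) = c t, H (1, t) = d t &
                           H (t, 0) = H (t, 1)].

(* Free homotopy of unoriented curves. *)
Definition same_homotopy_class c d : Prop :=
  freely_homotopic c d \/ freely_homotopic c (prev d).

Definition simple_closed c : Prop :=
  [/\ is_path c, c 0 = c 1 &
      forall s t, 0 <= s < 1 -> 0 <= t < 1 -> c s = c t -> s = t].
Definition support c : set S := c @` I01.
Definition disjoint_curves c d : Prop := support c `&` support d = set0.

Definition unit_disc : set (R * R) := [set z | z.1 ^+ 2 + z.2 ^+ 2 < 1].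

Definition chart (f : R * R -> S) : Prop :=
  [/\ {within unit_disc, continuous f},
      forall z w, unit_disc z -> unit_disc w -> f z = f w -> z = w &
      forall U : set (R * R), open U -> open (f @` (unit_disc `&` U))].

Definition closed_surface : Prop :=
  [/\ hausdorff_space S, compact [set: S], connected [set: S] &
      forall x : S, exists2 f, chart f & (f @` unit_disc) x].

(* (0, y) and (1, 1 - y) are the pairs identified in the Moebius band. *)
Definition moebius_pair (z w : R * R) : Prop :=
  [/\ z.1 = 0, w.1 = 1 & w.2 = 1 - z.2].
Definition moebius_band (f : R * R -> S) : Prop :=
  {within square, continuous f} /\
  forall z w, square z -> square w ->
    (f z = f w <-> [\/ z = w, moebius_pair z w | moebius_pair w z]).
Definition orientable : Prop := ~ exists f, moebius_band f.

Definition nonseparating_family (n : nat) : Prop :=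
  exists c : 'I_n -> R -> S,
    [/\ forall i, simple_closed (c i),
        forall i j, i != j -> disjoint_curves (c i) (c j) &
        connected (~` (\bigcup_i support (c i)))].
(* Riemann's definition: the genus is the largest number of disjoint simple
   closed curves that do not jointly disconnect the surface. *)
Definition has_genus (g : nat) : Prop :=
  forall n, nonseparating_family n <-> (n <= g)%N.

Definition curve_system (g : nat) (gam : 'I_(3 * g - 3) -> R -> S) : Prop :=
  [/\ forall j, simple_closed (gam j) /\ ~ null_homotopic (gam j),
      forall i j, i != j -> disjoint_curves (gam i) (gam j),
      forall i j, i != j -> ~ same_homotopy_class (gam i) (gam j) &
      forall d, simple_closed d -> ~ null_homotopic d ->
        (forall j, disjoint_curves d (gam j)) ->
        exists j, same_homotopy_class d (gam j)].

(* The model pair of pants: the disc of radius 4 about the origin minus the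
   unit discs about (-2, 0) and (2, 0). *)
Definition pants : set (R * R) :=
  [set z | [/\ z.1 ^+ 2 + z.2 ^+ 2 <= 16, 1 <= (z.1 + 2) ^+ 2 + z.2 ^+ 2 &
               1 <= (z.1 - 2) ^+ 2 + z.2 ^+ 2]].
Definition pants_interior : set (R * R) :=
  [set z | [/\ z.1 ^+ 2 + z.2 ^+ 2 < 16, 1 < (z.1 + 2) ^+ 2 + z.2 ^+ 2 &
               1 < (z.1 - 2) ^+ 2 + z.2 ^+ 2]].

(* The boundary circles, run through once from their lowest point with the
   pants on the left: clockwise for the two inner ones, anticlockwise for the
   outer one. *)
Definition bdry (i : 'I_3) (t : R) : R * R :=
  let s := 2 * pi * t in
  [:: (- 2 - sin s, - cos s); (2 - sin s, - cos s);
      (4 * sin s, - (4 * cos s))]`_i.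

(* Segments from the base point (0, -3) to the boundary circles.  With these,
   the loops tail i, bdry i, reversed tail i (for i = 0, 1, 2) have trivial
   product, taken in this order. *)
Definition pants_base : R * R := (0, - 3).
Definition tail (i : 'I_3) (t : R) : R * R :=
  ((1 - t) * pants_base.1 + t * (bdry i 0).1,
   (1 - t) * pants_base.2 + t * (bdry i 0).2).

(* A marking of a curve system: parametrizations of the complementary pairs of
   pants; the two sides of each curve, as boundary components of pants; a base
   point, joined to the base points of the pants. *)
Record marking (g : nat) := Marking {
  pant : 'I_(2 * g - 2) -> R * R -> S;
  side : 'I_(3 * g - 3) -> bool -> 'I_(2 * g - 2) * 'I_3;
  base : S;
  arm : 'I_(2 * g - 2) -> R -> S }.

(* The two sides of a curve run along it in opposite directions: all pants
   are parametrized compatibly with one orientation of the surface. *)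
Definition marks (g : nat) (gam : 'I_(3 * g - 3) -> R -> S) (m : marking g)
    : Prop :=
  [/\ bijective (fun e : 'I_(3 * g - 3) * bool => side m e.1 e.2),
      [/\ forall v, {within pants, continuous pant m v},
          forall v w z z', pants_interior z -> pants_interior z' ->
            pant m v z = pant m w z' -> v = w /\ z = z' &
          \bigcup_v (pant m v @` pants_interior)
            = ~` (\bigcup_j support (gam j))],
      forall j t, I01 t ->
        pant m (side m j false).1 (bdry (side m j false).2 t) = gam j t /\
        pant m (side m j true).1 (bdry (side m j true).2 t) = gam j (1 - t) &
      forall v, path_from_to (base m) (pant m v pants_base) (arm m v)].

(* [j] corresponds to two boundary components of one pair of pants. *)
Definition is_handle (g : nat) (m : marking g) (j : 'I_(3 * g - 3)) : bool :=
  (side m j false).1 == (side m j true).1.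

Definition is_simple (g : nat) (m : marking g) : Prop :=
  #|[set j | is_handle m j]%SET| = g.

Definition reach (g : nat) (m : marking g) (e : 'I_(2 * g - 2) * 'I_3)
    : R -> S :=
  pcat (arm m e.1) (pant m e.1 \o tail e.2).

Definition boundary_loop (g : nat) (m : marking g)
    (e : 'I_(2 * g - 2) * 'I_3) : R -> S :=
  pcat (pcat (reach m e) (pant m e.1 \o bdry e.2)) (prev (reach m e)).

(* The loop that leaves through side [b] of [gam j] and comes back from the
   other side. *)
Definition crossing_loop (g : nat) (m : marking g) (j : 'I_(3 * g - 3))
    (b : bool) : R -> S :=
  pcat (reach m (side m j b)) (prev (reach m (side m j (~~ b)))).

End Surfaces.

Section Representations.
Variables (R : realType) (S : topologicalType).
Notation C := R[i].
Notation M := 'M[C]_4.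
Implicit Types rho : (R -> S) -> M.

(* A homomorphism from pi_1(S, x) to SU(3,1), as a function on loops. *)
Definition representation (x : S) rho : Prop :=
  [/\ forall p, loop_at x p -> SU31 (rho p),
      forall p q, loop_at x p -> loop_at x q -> path_homotopic p q ->
        rho p = rho q &
      forall p q, loop_at x p -> loop_at x q ->
        rho (pcat p q) = rho p *m rho q].

(* Equality in Hom(pi_1(S, x), SU(3,1)) / SU(3,1). *)
Definition conjugate_reps (x : S) rho rho' : Prop :=
  exists2 g, SU31 g & forall p, loop_at x p -> rho' p = cj g (rho p).

Definition discrete_rep (x : S) rho : Prop :=
  exists2 e : R, 0 < e & forall p, loop_at x p ->
    (forall i j, `|rho p i j - (1%:M : M) i j| < e%:C) -> rho p = 1%:M.

Definition faithful_rep (x : S) rho : Prop :=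
  forall p, loop_at x p -> rho p = 1%:M -> null_homotopic p.

Definition totally_loxodromic (x : S) rho : Prop :=
  forall p, loop_at x p -> ~ null_homotopic p -> loxodromic (rho p).

Section Marked.
Variables (g : nat) (m : marking R S g).
Notation E := ('I_(2 * g - 2) * 'I_3)%type.

Definition rho_bdry rho (e : E) : M := rho (boundary_loop m e).

(* The (0,3) group <A, B> of the pants v. *)
Definition piece rho (v : 'I_(2 * g - 2)) : M * M :=
  (rho_bdry rho (v, inord 0), rho_bdry rho (v, inord 1)).

Definition tame rho : Prop :=
  [/\ representation (base m) rho, discrete_rep (base m) rho,
      faithful_rep (base m) rho, totally_loxodromic (base m) rho &
      forall v, nonsingular (piece rho v).1 (piece rho v).2].

Definition next_side (e : E) : E := (e.1, ordS e.2).
Definition prev_side (e : E) : E := (e.1, ord_pred e.2).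

(* [kp] is the twist-bend parameter (kappa, psi) of [rho] along [gam j].  Any
   two cyclically consecutive peripheral elements generate the (0,3) group;
   the ones used here put it in the form <A, B>, resp. <C, A^-1>, with A the
   peripheral element on side [false] of [gam j]. *)
Definition twist_bend (T : references R 'I_(3 * g - 3)) rho
    (j : 'I_(3 * g - 3)) (kp : C * R) : Prop :=
  is_angle (complex.Im kp.1) /\ is_angle kp.2 /\
  let e := side m j false in
  let f := side m j true in
  if is_handle m j then
    let G := handle_ref T j (rho_bdry rho e, rho_bdry rho f) in
    let K := cj (hQ G) (Emx kp.1 kp.2) in
    exists2 h, SU31 h &
      hA G = cj h (rho_bdry rho e) /\
      hB G *m K = cj h (rho (crossing_loop m j true))
  else
    let G := sep_ref T j (rho_bdry rho e, rho_bdry rho (next_side e))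
                         (rho_bdry rho (prev_side f), rho_bdry rho f) in
    let K := cj (sQ G) (Emx kp.1 kp.2) in
    exists2 h, SU31 h &
      [/\ sA G = cj h (rho_bdry rho e),
          sB G = cj h (rho_bdry rho (next_side e)) &
          cj K (sC G) = cj h (cj (rho (crossing_loop m j false))
                                 (rho_bdry rho (prev_side f)))].

End Marked.

Record fn_coord (g : nat) := FNCoord {
  fn_piece : 'I_(2 * g - 2) -> piece_coord R;
  fn_twist : 'I_(3 * g - 3) -> C * R }.

Definition fn_coord_of (lab : {poly C} -> C) (g : nat) (m : marking R S g)
    (T : references R 'I_(3 * g - 3)) rho (c : fn_coord g) : Prop :=
  (forall v, piece_coord_of lab (piece m rho v) (fn_piece c v)) /\
  (forall j, twist_bend m T rho j (fn_twist c j)).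

Definition admissible (g : nat) (c : fn_coord g) : Prop :=
  forall v, cross_ratio_variety (pc_X (fn_piece c v)).

(* The compatibility conditions are conditions on the coordinates of the
   pieces: they are imposed on all pairs (A_v, B_v) with these coordinates. *)
Definition compatible (lab : {poly C} -> C) (g : nat) (m : marking R S g)
    (c : fn_coord g) : Prop :=
  forall P : 'I_(2 * g - 2) -> M * M,
    (forall v, nonsingular (P v).1 (P v).2 /\
               piece_coord_of lab (P v) (fn_piece c v)) ->
    forall e : 'I_(3 * g - 3) * 'I_3,
      let s := side m e.1 false in
      let s' := side m e.1 true in
      mismatch (peripheral (P s.1) s.2) (peripheral (P s'.1) s'.2) e.2 = 0.

End Representations.

Section RealParameters.
Variable g : nat.

Definition trace_index : finType := ('I_(2 * g - 2) * bool * bool)%type.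
Definition sigma_index : finType := ('I_(2 * g - 2) * bool)%type.
Definition xr_index : finType := ('I_(2 * g - 2) * 'I_5)%type.
Definition alpha_index : finType := ('I_(2 * g - 2) * bool)%type.
Definition beta_index : finType := ('I_(2 * g - 2) * bool)%type.
Definition twist_index : finType := ('I_(3 * g - 3) * 'I_3)%type.

Definition real_index : finType :=
  (trace_index + sigma_index + xr_index + alpha_index + beta_index
   + twist_index)%type.

(* One compatibility condition, [mismatch _ _ k = 0], for each curve and each
   k < 3. *)
Definition constraint_index : finType := ('I_(3 * g - 3) * 'I_3)%type.

Variable R : realType.

Definition re_im (z : R[i]) (b : bool) : R :=
  if b then complex.Im z else complex.Re z.

Definition real_coord (c : fn_coord R g) (i : real_index) : R :=
  match i with
  | inl (inl (inl (inl (inl (v, k, b))))) =>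
      re_im (if k then pc_trB (fn_piece c v) else pc_trA (fn_piece c v)) b
  | inl (inl (inl (inl (inr (v, k))))) =>
      if k then pc_sigmaB (fn_piece c v) else pc_sigmaA (fn_piece c v)
  | inl (inl (inl (inr (v, k)))) => xr_coord (pc_X (fn_piece c v)) k
  | inl (inl (inr (v, b))) => re_im (pc_alpha (fn_piece c v)) b
  | inl (inr (v, b)) => re_im (pc_beta (fn_piece c v)) b
  | inr (j, k) =>
      [:: complex.Re (fn_twist c j).1; complex.Im (fn_twist c j).1;
          (fn_twist c j).2]`_k
  end.

Definition same_kinds (c c' : fn_coord R g) : Prop :=
  forall v, pc_akind (fn_piece c v) = pc_akind (fn_piece c' v) /\
            pc_bkind (fn_piece c v) = pc_bkind (fn_piece c' v).

End RealParameters.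

(* Main.v *)
(* Linear algebra. A loxodromic element is determined up to conjugation by its
   trace and its sigma-invariant, which determine the spectrum. For a
   non-singular pair <A, B>, the four fixed points form a basis of C^{3,1} whose
   Gram matrix is recovered, up to rescaling the vectors, from the cross-ratios
   (the only ambiguity, a sign, is settled by the negativity of
   Re <p1,p2><p2,p3><p3,p1>); a non-zero alpha- and beta-invariant then locate
   the positive eigenvectors. Hence the coordinates of a piece determine it up
   to conjugation, and its centralizer in SU(3,1) consists of the scalars of
   fourth power 1.

   Topology. For two representations rho and rho', transport
   e |-> rho'(p)^-1 e rho(p) is a local system of matrices on the surface.
   Conjugators g_v of the pieces that match across all curves define a flat
   section on each pair of pants; these sections agree on the curves, and the
   section they define on the closed surface is flat near every point because
   the pants are compact and locally path-connected. Its value at the base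
   point intertwines rho and rho'. No van Kampen theorem is needed.

   Equality of the twist-bend parameters makes the g_v match across each curve
   up to a fourth root of unity. As the curve system is simple, the curves
   between distinct pants form a tree, so these scalars can be absorbed in the
   g_v. *)
Require Import Defs.
From HB Require Import structures.
From mathcomp Require Import all_boot all_order all_algebra.
From mathcomp Require Import complex separable.
From mathcomp Require Import all_classical all_reals all_analysis.
From mathcomp Require Import ring lra zify.

Set Implicit Arguments.
Unset Strict Implicit.
Unset Printing Implicit Defensive.

Import Order.TTheory GRing.Theory Num.Theory.
Import numFieldNormedType.Exports.

Local Open Scope classical_set_scope.
Local Open Scope complex_scope.
Local Open Scope ring_scope.

(** * Linear algebra of the Hermitian form *)

(** Two difficulties shape the statement. First, the conjugator of a piece is defined only up to a
    fourth root of unity. On a handle the same conjugator occurs on both sides of the curve and the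
    root cancels; between distinct pants a quotient of two roots survives, and along a cycle of such
    curves these quotients could have a non-trivial product. Second, if the two unit eigenvalues of
    a peripheral element coincide, its centralizer contains rotations mixing x and y, which no Q
    E(kappa, psi) Q^-1 realizes. Hence twist-bend parameters relative to an arbitrary reference
    system are derived from a separable characteristic polynomial, whereas in general coordinates
    come from a reference system adapted to the representation, where all twists vanish.

    Per unit of g - 1 there are 8 + 4 + 10 + 4 + 4 + 9 = 39 real parameters and 9 conditions. The
    dimension five of the cross-ratio variety is expressed in two halves: |X2| = |X1| |X3| makes the
    five coordinates of a point injective, and near (1/2, 0, 0, 1, 0) they take all values. *)

Section HermitianForm.
Variable R : realType.
Notation C := R[i].
Notation V := 'cV[C]_4.
Notation M := 'M[C]_4.
Implicit Types (A B g P Q : M) (u v w z : V) (k : C).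

Lemma ord4P (i : 'I_4) : [\/ i = ix1, i = ix2, i = ix3 | i = ix4].
Proof.
case: i => [[|[|[|[|//]]]] lt_i4].
- by constructor 1; apply/val_inj; rewrite /= inordK.
- by constructor 2; apply/val_inj; rewrite /= inordK.
- by constructor 3; apply/val_inj; rewrite /= inordK.
- by constructor 4; apply/val_inj; rewrite /= inordK.
Qed.

Lemma sum4 (Z : nmodType) (F : 'I_4 -> Z) :
  \sum_i F i = F ix1 + F ix2 + F ix3 + F ix4.
Proof.
rewrite !big_ord_recl big_ord0 addr0 !addrA.
by congr (F _ + F _ + F _ + F _); apply/val_inj; rewrite /= inordK.
Qed.

Lemma prod4 (F : 'I_4 -> C) : \prod_i F i = F ix1 * F ix2 * F ix3 * F ix4.
Proof.
rewrite !big_ord_recl big_ord0 mulr1 !mulrA.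
by congr (F _ * F _ * F _ * F _); apply/val_inj; rewrite /= inordK.
Qed.

Lemma ix_neq : ((ix1 == ix2 = false) * (ix1 == ix3 = false) *
  (ix1 == ix4 = false) * (ix2 == ix1 = false) * (ix2 == ix3 = false) *
  (ix2 == ix4 = false) * (ix3 == ix1 = false) * (ix3 == ix2 = false) *
  (ix3 == ix4 = false) * (ix4 == ix1 = false) * (ix4 == ix2 = false) *
  (ix4 == ix3 = false))%type.
Proof. by do !split; apply/eqP=> /(congr1 val); rewrite /= !inordK. Qed.

Lemma vec4P u v : u ix1 0 = v ix1 0 -> u ix2 0 = v ix2 0 ->
  u ix3 0 = v ix3 0 -> u ix4 0 = v ix4 0 -> u = v.
Proof.
move=> h1 h2 h3 h4; apply/matrixP=> i j; rewrite (ord1 j).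
by case: (ord4P i) => ->.
Qed.

Lemma hermDl u v w : herm (u + v) w = herm u w + herm v w.
Proof. by rewrite /herm !mxE; ring. Qed.

Lemma hermZl k u w : herm (k *: u) w = k * herm u w.
Proof. by rewrite /herm !mxE; ring. Qed.

Lemma hermC u v : (herm u v)^* = herm v u.
Proof. by rewrite /herm !rmorphD !rmorphM /= !conjCK; ring. Qed.

Lemma hermDr u v w : herm u (v + w) = herm u v + herm u w.
Proof. by rewrite -[LHS]hermC hermDl rmorphD /= !hermC. Qed.

Lemma hermZr k u w : herm u (k *: w) = k^* * herm u w.
Proof. by rewrite -[LHS]hermC hermZl rmorphM /= !hermC. Qed.

Lemma hermNl u w : herm (- u) w = - herm u w.
Proof. by rewrite -scaleN1r hermZl mulN1r. Qed.

Lemma hermNr u w : herm u (- w) = - herm u w.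
Proof. by rewrite -[LHS]hermC hermNl rmorphN /= hermC. Qed.

Lemma hermBl u v w : herm (u - v) w = herm u w - herm v w.
Proof. by rewrite hermDl hermNl. Qed.

Lemma hermBr u v w : herm u (v - w) = herm u v - herm u w.
Proof. by rewrite hermDr hermNr. Qed.

Lemma herm0l w : herm 0 w = 0.
Proof. by rewrite -(scale0r 0) hermZl mul0r. Qed.

Lemma herm0r w : herm w 0 = 0.
Proof. by rewrite -hermC herm0l conjC0. Qed.

Lemma herm0C u v : herm u v = 0 -> herm v u = 0.
Proof. by move=> h; rewrite -hermC h conjC0. Qed.

Definition hermE := (hermDl, hermDr, hermBl, hermBr, hermNl, hermNr,
  hermZl, hermZr, herm0l, herm0r).

Lemma herm_real v : herm v v \is Num.real.
Proof. by apply/CrealP; rewrite hermC. Qed.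

Lemma herm_ge0 v : v ix1 0 = v ix4 0 -> 0 <= herm v v.
Proof.
by move=> h; rewrite /herm h -!normCK !addr_ge0 // exprn_ge0.
Qed.

Lemma herm_eq0 v : v ix1 0 = v ix4 0 -> herm v v <= 0 -> v = 0.
Proof.
move=> h; have := herm_ge0 h; rewrite {1 2}/herm h -!normCK => h1 h2.
have /eqP : `|v ix4 0| ^+ 2 + `|v ix2 0| ^+ 2 + `|v ix3 0| ^+ 2
  + `|v ix4 0| ^+ 2 = 0 by apply/le_anti; rewrite h1 h2.
rewrite !paddr_eq0 ?addr_ge0 ?exprn_ge0 // !expf_eq0 /= !normr_eq0.
move=> /andP[/andP[/andP[/eqP e4 /eqP e2] /eqP e3] _].
by apply: vec4P; rewrite !mxE ?h ?e4 ?e2 ?e3.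
Qed.

(* The span of [u] and [v] meets the hyperplane [z1 = z4], on which the form is
   positive definite. *)
Lemma orth_nonpos_prop u v : herm u u <= 0 -> herm v v <= 0 ->
  herm u v = 0 -> u != 0 -> v != 0 -> exists2 k, k != 0 & u = k *: v.
Proof.
move=> hu hv huv u0 v0.
have l0 z : herm z z <= 0 -> z != 0 -> z ix1 0 - z ix4 0 != 0.
  move=> hz; apply: contraNneq => /subr0_eq /herm_eq0 -> //.
set lu := u ix1 0 - u ix4 0; set lv := v ix1 0 - v ix4 0.
have hvu := herm0C huv.
have lu0 : lu != 0 := l0 _ hu u0.
have lv0 : lv != 0 := l0 _ hv v0.
have /subr0_eq e : lv *: u - lu *: v = 0.
  apply: herm_eq0; first by rewrite /lu /lv !mxE; ring.
  rewrite !hermE huv hvu.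
  rewrite [X in X <= _](_ : _ = `|lv| ^+ 2 * herm u u + `|lu| ^+ 2 * herm v v).
    by rewrite -[0]addr0 lerD // mulr_ge0_le0 // exprn_ge0.
  rewrite !normCK; ring.
exists (lu / lv); first by rewrite mulf_neq0 ?invr_eq0.
by rewrite mulrC -scalerA -e scalerA mulVf // scale1r.
Qed.

Lemma orth_neg_pos u v : herm u u < 0 -> v != 0 -> herm u v = 0 ->
  0 < herm v v.
Proof.
move=> hu v0 huv; rewrite real_ltNge ?real0 ?herm_real //; apply/negP=> hv.
have u0 : u != 0 by apply: contraTneq hu => ->; rewrite herm0l ltxx.
have [k _ e] := orth_nonpos_prop (ltW hu) hv huv u0 v0.
by move: hu; rewrite {2}e hermZr huv mulr0 ltxx.
Qed.

Lemma null_orth_same u v : null u -> null v -> herm u v = 0 -> same_point u v.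
Proof.
by move=> [u0 hu] [v0 hv] huv; apply: orth_nonpos_prop; rewrite ?hu ?hv.
Qed.

(** The coefficient of [v] makes both cross terms equal to minus the squared modulus of [herm u v].
    Hence two distinct null points always span a plane containing a negative vector. *)
Lemma null_pair_neg u v : herm u u = 0 -> herm v v = 0 -> herm u v != 0 ->
  herm (u - herm u v *: v) (u - herm u v *: v) < 0.
Proof.
move=> hu hv huv; rewrite !hermE hu hv -(hermC u v).
rewrite [X in X < _](_ : _ = - (`|herm u v| ^+ 2 + `|herm u v| ^+ 2)).
  by rewrite oppr_lt0 addr_gt0 ?exprn_gt0 ?normr_gt0.
rewrite !normCK; ring.
Qed.

Lemma orth_pair_pos u v p : herm u u = 0 -> herm v v = 0 -> herm u v != 0 ->
  herm u p = 0 -> herm v p = 0 -> p != 0 -> 0 < herm p p.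
Proof.
move=> hu hv huv hup hvp p0; apply: (orth_neg_pos (null_pair_neg hu hv huv)) => //.
by rewrite !hermE hup hvp mulr0 subr0.
Qed.

Definition Jm : M := \matrix_(i, j) herm (delta_mx i 0) (delta_mx j 0).
Definition gram P Q : M := P^T *m Jm *m map_mx Num.conj Q.

Lemma hermEmx z w : herm z w = (z^T *m Jm *m map_mx Num.conj w) 0 0.
Proof.
rewrite mxE sum4 ![(z^T *m Jm) _ _]mxE !sum4 !mxE /herm !mxE !eqxx !ix_neq /=.
by rewrite !conjC0 !conjC1; ring.
Qed.

Lemma gramE P Q i j : gram P Q i j = herm (col i P) (col j Q).
Proof.
rewrite hermEmx /gram tr_col map_col -row_mul -row_mul.
by rewrite colE mulmxA -colE !mxE.
Qed.

Lemma gram_mul A P Q : gram (A *m P) (A *m Q)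
  = P^T *m gram A A *m map_mx Num.conj Q.
Proof. by rewrite /gram trmx_mul map_mxM !mulmxA. Qed.

Lemma gram11 : gram 1%:M 1%:M = Jm.
Proof. by rewrite /gram trmx1 map_mx1 mul1mx mulmx1. Qed.

Lemma mx4P P Q : (forall j, col j P = col j Q) -> P = Q.
Proof. by move=> h; apply/matrixP=> i j; have /matrixP/(_ i 0) := h j; rewrite !mxE. Qed.

Lemma mul_col A P j : A *m col j P = col j (A *m P).
Proof. by rewrite !colE mulmxA. Qed.

Lemma isometryP A :
  (forall z w, herm (A *m z) (A *m w) = herm z w) <-> gram A A = Jm.
Proof.
split=> [h|h z w].
  by apply/matrixP=> i j; rewrite gramE !colE h mxE.
by rewrite !hermEmx trmx_mul map_mxM -!mulmxA (mulmxA A^T) (mulmxA _ _ (map_mx _ w))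
  -/(gram A A) h.
Qed.

Lemma JmK : Jm *m Jm = 1%:M.
Proof.
apply/matrixP=> i j; rewrite !mxE sum4 !mxE /herm !mxE !eqxx !ix_neq /=.
case: (ord4P i) => ->; case: (ord4P j) => ->; rewrite ?eqxx ?ix_neq /= ?conjC0 ?conjC1; ring.
Qed.

Lemma det_Jm : \det Jm != 0.
Proof.
apply/eqP=> h; have /eqP := congr1 determinant JmK.
by rewrite det_mulmx h mul0r det1 eq_sym oner_eq0.
Qed.

Lemma gram_unit P Q : gram P Q \in unitmx -> P \in unitmx.
Proof. by rewrite !unitmxE !unitfE !det_mulmx det_tr !mulf_eq0 !negb_or -andbA => /and3P[]. Qed.

Lemma Jm_unit : Jm \in unitmx.
Proof. by rewrite unitmxE unitfE det_Jm. Qed.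

Lemma SU31_unit A : SU31 A -> A \in unitmx.
Proof. by case=> h _; rewrite unitmxE h unitr1. Qed.

Lemma SU31_1 : SU31 (1%:M : M).
Proof. by split; [exact: det1 | move=> z w; rewrite !mul1mx]. Qed.

Lemma SU31_mul A B : SU31 A -> SU31 B -> SU31 (A *m B).
Proof.
move=> [a1 a2] [b1 b2]; split; first by rewrite det_mulmx a1 b1 mulr1.
by move=> z w; rewrite -!mulmxA a2 b2.
Qed.

Lemma SU31_inv A : SU31 A -> SU31 (invmx A).
Proof.
move=> hA; have uA := SU31_unit hA; case: hA => [a1 a2]; split.
  by rewrite det_inv a1 invr1.
by move=> z w; rewrite -a2 !mulKVmx.
Qed.

Lemma eq_on_basis A B P : P \in unitmx ->
  (forall j, A *m col j P = B *m col j P) -> A = B.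
Proof.
move=> uP h; rewrite -[A](mulmxK uP) -[B](mulmxK uP); congr (_ *m _).
by apply: mx4P => j; rewrite !colE -!mulmxA -!colE h.
Qed.

Lemma det_isometry g : gram g g = Jm -> \det g * (\det g)^* = 1.
Proof.
move=> /(congr1 determinant); rewrite /gram 2!det_mulmx det_tr det_map_mx /= => e.
by apply: (mulIf det_Jm); rewrite mul1r mulrAC.
Qed.

(** The matrix Q P^-1 preserves the form, so its determinant has modulus one. Dividing by a fourth
    root of the determinant lands in SU(3,1), at the price of the unit scalar [s]. *)
Lemma isometry_of_gram P Q : P \in unitmx -> gram P P = gram Q Q ->
  exists g s, [/\ SU31 g, s * s^* = 1 & g *m P = s *: Q].
Proof.
move=> uP ePQ; pose g0 := Q *m invmx P.
have g0P : g0 *m P = Q by rewrite mulmxKV.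
have gg : gram g0 g0 = Jm.
  rewrite /g0 gram_mul -ePQ -gram11 -(mulmxV uP) gram_mul.
  by rewrite -[gram P P]/(gram P P) ?mulmxA.
have dg := det_isometry gg.
pose s := 4.-root (\det g0)^-1.
have s4 : s ^+ 4 = (\det g0)^-1 by rewrite rootCK.
have ss : s * s^* = 1.
  rewrite -normCK; apply/eqP; rewrite sqrp_eq1 // -(@eqrXn2 _ 4) ?ler01 //.
  by rewrite -normrX s4 normfV expr1n invr_eq1 -sqrp_eq1 // normCK dg.
exists (s *: g0), s; split=> //; last by rewrite -scalemxAl g0P.
split.
  rewrite detZ s4 mulVf //; apply/eqP=> d0; move: dg.
  by rewrite d0 mul0r => /eqP; rewrite eq_sym oner_eq0.
have /isometryP g0i := gg.
by move=> z w; rewrite -!scalemxAl !hermE g0i mulrA ss mul1r.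
Qed.

Definition mx4 (a b c d : V) : M := \matrix_(i, j) ([:: a; b; c; d]`_j) i 0.

Lemma col_mx4 a b c d : ((col ix1 (mx4 a b c d) = a) * (col ix2 (mx4 a b c d) = b) *
  (col ix3 (mx4 a b c d) = c) * (col ix4 (mx4 a b c d) = d))%type.
Proof.
by do !split; apply/matrixP=> i j; rewrite !mxE (ord1 j) inordK.
Qed.
End HermitianForm.

(** * Unit complex numbers and arguments *)

Section Cis.
Variable R : realType.
Notation C := R[i].
Implicit Types (s t : R) (z : C).

Lemma cisD s t : cis (s + t) = cis s * cis t.
Proof. by apply/eqP; rewrite eq_complex /= sinD cosD; apply/andP; split; apply/eqP; ring. Qed.

Lemma cis0 : cis (0 : R) = 1.
Proof. by rewrite /cis cos0 sin0. Qed.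

Lemma cisN t : cis (- t) = (cis t)^*.
Proof. by rewrite /cis cosN sinN. Qed.

Lemma cis_conj t : cis t * (cis t)^* = 1.
Proof. by rewrite -cisN -cisD subrr cis0. Qed.

Lemma norm_cis t : `|cis t| = 1.
Proof. by apply/eqP; rewrite -sqrp_eq1 // normCK cis_conj. Qed.

Lemma cis_neq0 t : cis t != 0.
Proof. by rewrite -normr_eq0 norm_cis oner_eq0. Qed.

Lemma norm1_Re_Im z : `|z| = 1 -> complex.Re z ^+ 2 + complex.Im z ^+ 2 = 1.
Proof.
by move=> h; apply/complexI; rewrite add_Re2_Im2 h expr1n.
Qed.

Lemma cis_exists z : `|z| = 1 -> exists2 t, is_angle t & z = cis t.
Proof.
move=> /norm1_Re_Im; case: z => a b /= h.
have a1 : -1 <= a <= 1 by rewrite -ler_norml -(@ler_sqr _ `|a|) ?nnegrE // real_normK ?num_real // expr1n -h lerDl sqr_ge0.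
have b2 : Num.sqrt (1 - a ^+ 2) = `|b| by rewrite -h addrC addKr sqrtr_sqr.
have pi0 := pi_gt0 R.
case: (leP 0 b) => b0.
  exists (acos a); last by rewrite /cis acosK // sin_acos // b2 ger0_norm.
  split; last by rewrite acos_lepi.
  by rewrite (lt_le_trans _ (acos_ge0 a1)) // oppr_lt0.
exists (- acos a); last by rewrite /cis cosN sinN acosK // sin_acos // b2 ltr0_norm // opprK.
split; last by rewrite (@le_trans _ _ 0) ?oppr_le0 ?acos_ge0 // ltW.
(* The angle -pi is excluded: a = -1 would force b = 0, against b < 0. *)
rewrite ltrN2 acos_ltpi //; case/andP: a1 => a1 ->; rewrite andbT lt_neqAle a1 andbT.
apply: contraTneq b0 => ae; move: h; rewrite -ae sqrrN expr1n => /eqP.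
by rewrite -[X in _ == X]addr0 (inj_eq (addrI _)) sqrf_eq0 => /eqP ->; rewrite ltxx.
Qed.

(** With u = s - t, cos u = 1 forces sin (u / 2) = 0, and u / 2 lies strictly between -pi and pi,
    where the sine vanishes only at 0. *)
Lemma cis_inj s t : is_angle s -> is_angle t -> cis s = cis t -> s = t.
Proof.
move=> [s1 s2] [t1 t2] e.
have : cis (s - t) = 1 by rewrite cisD cisN e cis_conj.
set u := s - t => -[cu _].
have u1 : - pi < u / 2 by rewrite /u; lra.
have u2 : u / 2 < pi by rewrite /u; lra.
have : sin (u / 2) ^+ 2 = 0.
  have := cosD (u / 2) (u / 2); rewrite -splitr cu -[cos _ * _]expr2 cos2sin2 -expr2; lra.
move=> /eqP; rewrite sqrf_eq0 => /eqP su.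
suff : u / 2 = 0 by rewrite /u; lra.
case: (ltgtP (u / 2) 0) => // h.
  by have := @sin_gt0_pi R (- (u / 2)); rewrite sinN su oppr0 ltxx => /(_ _)/wrap[]//; rewrite oppr_gt0 h ltrNl.
by have := @sin_gt0_pi R (u / 2); rewrite su ltxx h u2 => /(_ isT).
Qed.

Lemma polar z : exists2 t, is_angle t & z = `|z| * cis t.
Proof.
have [->|z0] := eqVneq z 0.
  by exists 0; rewrite ?normr0 ?mul0r //; split; rewrite ?oppr_lt0 ?pi_gt0 ?pi_ge0.
have [|t ht e] := @cis_exists (z / `|z|).
  by rewrite normrM normfV normr_id mulfV ?normr_eq0.
by exists t => //; rewrite -e mulrC mulfVK ?normr_eq0.
Qed.

Lemma argP z : is_angle (arg z) /\ z = `|z| * cis (arg z).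
Proof.
rewrite /arg; case: xgetP => [t _ //|]; have [t h1 h2] := polar z.
by move=> /(_ t) []; split.
Qed.

Lemma arg_unique z t : z != 0 -> is_angle t -> z = `|z| * cis t -> arg z = t.
Proof.
move=> z0 ht e; have [ha ea] := argP z; apply: cis_inj => //.
by apply: (@mulfI _ `|z|); rewrite ?normr_eq0 // -ea.
Qed.
End Cis.

(** * Isometries, standard bases and eigenvalue data *)

Section Loxodromic.
Variable R : realType.
Notation C := R[i].
Notation V := 'cV[C]_4.
Notation M := 'M[C]_4.
Implicit Types (A B g P Q : M) (a x y r u v w z : V) (k l : C) (F : frame R).

Lemma norm_eq1 k : (`|k| == 1) = (k * k^* == 1).
Proof. by rewrite -sqrp_eq1 // normCK. Qed.

(** Applying [A] multiplies the product of the two vectors by [k * l^*], and also preserves it. *)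
Lemma isometry_orth A u v k l : SU31 A -> A *m u = k *: u -> A *m v = l *: v ->
  k * l^* != 1 -> herm u v = 0.
Proof.
move=> [_ hA] hu hv; have := hA u v; rewrite hu hv !hermE mulrA => /eqP.
rewrite -subr_eq0 -[X in _ - X]mul1r -mulrBl mulf_eq0 subr_eq0.
by case/orP=> [->//|/eqP].
Qed.

Lemma isometry_eig A u v k l : SU31 A -> A *m u = k *: u -> A *m v = l *: v ->
  herm u v != 0 -> k * l^* = 1.
Proof.
move=> hA hu hv h; apply: contraNeq h => h; apply/eqP.
exact: (isometry_orth hA hu hv h).
Qed.

(** These are the products of e1, e2, e3, e4 under [herm], so the matrix with these columns
    preserves the form. *)
Definition stdbasis a x y r : Prop :=
  [/\ herm a a = 0, herm r r = 0, herm a r = 1, herm x x = 1 &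
   [/\ herm y y = 1, herm x y = 0, herm a x = 0, herm a y = 0 &
     herm r x = 0 /\ herm r y = 0]].

Lemma stdbasis_gram a x y r : stdbasis a x y r ->
  gram (mx4 a x y r) (mx4 a x y r) = Jm R.
Proof.
case=> haa hrr har hxx [hyy hxy hax hay [hrx hry]].
have hra : herm r a = 1 by rewrite -hermC har conjC1.
have hJ := (haa, hrr, har, hra, hxx, hyy, hxy, hax, hay, hrx, hry,
  herm0C hxy, herm0C hax, herm0C hay, herm0C hrx, herm0C hry).
apply/matrixP=> i j; rewrite gramE.
by case: (ord4P i) => ->; case: (ord4P j) => ->; rewrite !col_mx4 hJ;
  rewrite !mxE /herm !mxE !eqxx ?ix_neq /= ?(conjC0,conjC1,mulr0,mulr1,mul0r,addr0,add0r).
Qed.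

Lemma mx4_mulv a b c d v : mx4 a b c d *m v =
  v ix1 0 *: a + v ix2 0 *: b + v ix3 0 *: c + v ix4 0 *: d.
Proof.
apply/matrixP=> i j; rewrite (ord1 j) !mxE sum4 !mxE !inordK //=.
by rewrite ![_ * v _ _]mulrC.
Qed.

Lemma stdbasis_unit a x y r : stdbasis a x y r -> mx4 a x y r \in unitmx.
Proof. by move=> /stdbasis_gram h; apply: (@gram_unit _ _ (mx4 a x y r)); rewrite h Jm_unit. Qed.

Lemma stdbasis_expand a x y r v : stdbasis a x y r ->
  v = herm v r *: a + herm v x *: x + herm v y *: y + herm v a *: r.
Proof.
move=> hS; have hU := stdbasis_unit hS; move: hS.
case=> haa hrr har hxx [hyy hxy hax hay [hrx hry]].
have hra : herm r a = 1 by rewrite -hermC har conjC1.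
have -> : v = mx4 a x y r *m (invmx (mx4 a x y r) *m v) by rewrite mulKVmx.
move: (invmx _ *m v) => c; rewrite mx4_mulv !hermE haa hrr har hra hxx hyy hxy.
rewrite hax hay hrx hry (herm0C hxy) (herm0C hax) (herm0C hay) (herm0C hrx) (herm0C hry).
by rewrite !mulr0 !mulr1 !addr0 !add0r.
Qed.

Lemma singular_orth P : \det P = 0 -> exists2 p, p != 0 &
  forall j, herm (col j P) p = 0.
Proof.
move=> /eqP/det0P[q q0 qP].
have JR : map_mx Num.conj (Jm R) = Jm R.
  apply/matrixP=> i j; rewrite !mxE /herm !mxE !eqxx.
  by case: (ord4P i) => ->; case: (ord4P j) => ->; rewrite ?ix_neq ?eqxx /=
     ?(conjC0,conjC1,mulr0,mulr1,addr0,add0r).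
(* For a row [q] with q P = 0, the product of z with this vector is z^T J J q^T = z^T q^T, which
   vanishes on the columns of P. *)
exists (map_mx Num.conj (Jm R *m q^T)).
  apply: contra q0 => /eqP h; apply/eqP/trmx_inj.
  rewrite trmx0 -[q^T]mul1mx -(JmK R) -mulmxA.
  have -> : Jm R *m q^T = 0; last by rewrite mulmx0.
  apply/matrixP=> i j; have /matrixP/(_ i j) := h; rewrite !mxE => /eqP.
  by rewrite conjC_eq0 => /eqP.
move=> j; rewrite hermEmx.
have -> : map_mx Num.conj (map_mx Num.conj (Jm R *m q^T)) = Jm R *m q^T.
  by apply/matrixP=> i k; rewrite !mxE conjCK.
rewrite -!mulmxA (mulmxA (Jm R)) JmK mul1mx.
by rewrite -[_ *m _]trmxK trmx_mul !trmxK colE mulmxA qP mul0mx !mxE.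
Qed.

Lemma exists_orth u v w : exists p,
  [/\ p != 0, herm u p = 0, herm v p = 0 & herm w p = 0].
Proof.
(* A zero fourth column makes the matrix singular whatever the three vectors are. *)
have [|p p0 hp] := @singular_orth (mx4 u v w 0).
  apply/eqP; rewrite -det_tr; apply/det0P; exists (delta_mx 0 ix4).
    by apply/eqP=> /rowP/(_ ix4); rewrite !mxE !eqxx => /eqP; rewrite oner_eq0.
  by rewrite -rowE -tr_col col_mx4 trmx0.
by exists p; split=> //; [have := hp ix1|have := hp ix2|have := hp ix3]; rewrite col_mx4.
Qed.

Definition unitize v : V := (sqrtC (herm v v))^-1 *: v.

Lemma unitize1 v : 0 < herm v v -> herm (unitize v) (unitize v) = 1.
Proof.
move=> h; rewrite /unitize !hermE mulrA -normCK normfV ger0_norm ?sqrtC_ge0 ?ltW //.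
by rewrite exprVn sqrtCK mulVf // gt_eqF.
Qed.

Lemma unitize_orth u v : herm u v = 0 -> herm u (unitize v) = 0.
Proof. by move=> h; rewrite hermE h mulr0. Qed.

Lemma exists_orth_unit u v w : herm u u = 0 -> herm v v = 0 -> herm u v != 0 ->
  exists p, [/\ herm p p = 1, herm u p = 0, herm v p = 0 & herm w p = 0].
Proof.
move=> hu hv huv; have [p [p0 up vp wp]] := exists_orth u v w.
by exists (unitize p); rewrite unitize1 ?(orth_pair_pos hu hv huv) ?unitize_orth.
Qed.

(** The angle-free form of [eigenframe]: l1 stands for r e^(i theta), whose inverse conjugate is
    r^-1 e^(i theta), and [l1 * l2 * l3 = l1^*] says that the four eigenvalues have product one. *)
Definition eigdata A F l1 l2 l3 : Prop :=
  [/\ 1 < `|l1|, `|l2| = 1, `|l3| = 1, l1 * l2 * l3 = l1^* &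
   [/\ A *m fr_a F = l1 *: fr_a F, A *m fr_r F = (l1^*)^-1 *: fr_r F,
       A *m fr_x F = l2 *: fr_x F & A *m fr_y F = l3 *: fr_y F]].

Definition nullframe F : Prop := [/\ null (fr_a F), null (fr_r F) &
  [/\ herm (fr_x F) (fr_x F) = 1, herm (fr_y F) (fr_y F) = 1 &
      herm (fr_x F) (fr_y F) = 0]].

Lemma eigenframeP A F :
  eigenframe A F <-> nullframe F /\ exists l1 l2 l3, eigdata A F l1 l2 l3.
Proof.
split.
  case=> na nr xy [r [th [ph [r1 [ha hr hx hy]]]]]; split=> //.
  have r0 : 0 < r by apply: lt_trans r1; rewrite ltr01.
  have nr1 : `|r%:C| = r%:C :> C by rewrite ger0_norm // ler0c ltW.
  have cj : (r%:C * cis th)^* = r%:C * cis (- th) 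
    by have := conj_normC (r%:C : C); rewrite nr1 cisN rmorphM /= => ->.
  exists (r%:C * cis th), (cis ph), (cis (- (2 * th + ph))); split; rewrite ?norm_cis //.
  - by rewrite normrM norm_cis mulr1 nr1 (ltcR 1).
  - by rewrite cj -!mulrA -!cisD; congr (_ * cis _); ring.
  - split=> //; rewrite cj invfM hr; congr (_ *: _); rewrite fmorphV /=; congr (_ * _).
    by apply: (mulfI (cis_neq0 (- th))); rewrite mulfV ?cis_neq0 // -cisD addNr cis0.
case=> -[na nr xy] [l1 [l2 [l3 [n1 n2 n3 hd [ha hr hx hy]]]]]; split=> //.
have [th _ eth] := polar l1; have [ph _ eph] := cis_exists n2.
have nr1 : (complex.Re `|l1|)%:C = `|l1| by rewrite RRe_real // normr_real.
have l10 : `|l1| != 0 by rewrite gt_eqF // (lt_trans ltr01).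
exists (complex.Re `|l1|), th, ph; split; first by rewrite -ltcR nr1.
have cj : l1^* = `|l1| * cis (- th) by rewrite {1}eth rmorphM /= conj_normC cisN.
split; rewrite ?nr1 -?eth -?eph //.
  rewrite hr cj invfM fmorphV /= nr1; congr (_ *: _); congr (_ * _).
  by apply: (mulfI (cis_neq0 (- th))); rewrite mulfV ?cis_neq0 // -cisD addNr cis0.
have l1l2 : l1 * l2 != 0 by rewrite mulf_neq0 // -normr_gt0 ?n2 ?ltr01 // normr_gt0 -normr_eq0.
rewrite hy; congr (_ *: _); apply: (mulfI l1l2); rewrite hd cj.
transitivity (`|l1| * cis th * cis ph * cis (- (2 * th + ph))); last by rewrite -eth -eph.
rewrite -!mulrA -!cisD; congr (_ * cis _); ring.
Qed.
End Loxodromic.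

(** * Spectrum and normal form of a loxodromic element *)

Section Spectrum.
Variable R : realType.
Notation C := R[i].
Notation V := 'cV[C]_4.
Notation M := 'M[C]_4.
Implicit Types (A B g P Q : M) (a x y r u v w z : V) (k l : C) (F : frame R).

Lemma same_point_sym u v : same_point u v -> same_point v u.
Proof. by case=> k k0 ->; exists k^-1; rewrite ?invr_eq0 // scalerA mulVf ?scale1r. Qed.

Lemma same_point_trans u v w : same_point u v -> same_point v w -> same_point u w.
Proof. by case=> k k0 -> [l l0 ->]; exists (k * l); rewrite ?mulf_neq0 // scalerA. Qed.

Lemma distinct_null_herm u v : null u -> null v -> ~ same_point u v -> herm u v != 0.
Proof. by move=> nu nv h; apply/eqP=> /(null_orth_same nu nv). Qed.

Lemma fixes_same_point A u v : same_point u v -> fixes A v -> fixes A u.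
Proof. by case=> k _ -> [l e]; exists l; rewrite -scalemxAr e !scalerA mulrC. Qed.

Lemma null_scale k v : k != 0 -> null v -> null (k *: v).
Proof.
move=> k0 [v0 h]; split; last by rewrite !hermE h !mulr0.
by rewrite scaler_eq0 negb_or k0.
Qed.

Lemma same_point_null u v : same_point u v -> null v -> null u.
Proof. by case=> k k0 -> /(null_scale k0). Qed.

Lemma eig_unique A v k l : v != 0 -> A *m v = k *: v -> A *m v = l *: v -> k = l.
Proof.
move=> v0 -> /eqP; rewrite -subr_eq0 -scalerBl scaler_eq0 (negPf v0) orbF.
by rewrite subr_eq0 => /eqP.
Qed.

Section Data.
Variables (A : M) (F : frame R) (l1 l2 l3 : C).
Hypotheses (hA : SU31 A) (hF : nullframe F) (hD : eigdata A F l1 l2 l3).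
Let a := fr_a F. Let r := fr_r F. Let x := fr_x F. Let y := fr_y F.

Let l10 : l1 != 0.
Proof. by rewrite -normr_gt0 (lt_trans ltr01) //; case: hD. Qed.

Let lJ0 : l1^* != 0. Proof. by rewrite conjC_eq0. Qed.

Lemma eigdata_l11 : l1 * l1^* != 1.
Proof.
by rewrite -normCK sqrp_eq1 // gt_eqF //; case: hD.
Qed.

Let unit_neq k : `|k| = 1 -> l1 * k^* != 1.
Proof.
move=> k1; apply/eqP=> /(congr1 Num.norm); rewrite normrM norm_conjC k1 mulr1 normr1.
by move=> e; case: hD; rewrite e ltxx.
Qed.

Let unit_neq' k : `|k| = 1 -> (l1^*)^-1 * k^* != 1.
Proof.
move=> k1; apply/eqP=> /(congr1 Num.norm); rewrite normrM normfV !norm_conjC k1 mulr1 normr1.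
by move=> /eqP; rewrite invr_eq1 => /eqP e; case: hD; rewrite e ltxx.
Qed.

Lemma eigdata_ar : herm a r != 0.
Proof.
case: hD hF => _ _ _ _ [ha hr _ _] [na nr _]; apply/eqP=> h.
have [k k0 e] := null_orth_same na nr h.
have : A *m a = (l1^*)^-1 *: a.
  by rewrite /a e -scalemxAr hr !scalerA mulrC.
move/(eig_unique na.1 ha)/(congr1 ( *%R^~ l1^*)); rewrite mulVf // => /eqP.
by rewrite (negPf eigdata_l11).
Qed.

Lemma eigdata_orth : [/\ herm a x = 0, herm a y = 0, herm r x = 0 & herm r y = 0].
Proof.
case: hD => _ n2 n3 _ [ha hr hx hy].
split.
- exact: isometry_orth hA ha hx (unit_neq n2).
- exact: isometry_orth hA ha hy (unit_neq n3).
- exact: isometry_orth hA hr hx (unit_neq' n2).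
- exact: isometry_orth hA hr hy (unit_neq' n3).
Qed.

Lemma eigdata_stdbasis : stdbasis ((herm a r)^-1 *: a) x y r.
Proof.
case: eigdata_orth => h1 h2 h3 h4; case: hF => [[_ ha] [_ hr] [hx hy hxy]].
have h0 := eigdata_ar.
split; rewrite ?hermE -?/a ?ha ?mulr0 // ?mulVf //.
by split; rewrite ?hermE -?/x -?/y ?h1 ?h2 ?mulr0.
Qed.

Lemma eigdata_basis : mx4 a x y r \in unitmx.
Proof.
have h := stdbasis_unit eigdata_stdbasis.
have e : mx4 a x y r = mx4 ((herm a r)^-1 *: a) x y r *m
    diag_mx (\row_j (if j == ix1 then herm a r else 1)).
  apply: mx4P => j; apply/matrixP=> i k; rewrite mul_mx_diag !mxE.
  by case: (ord4P j) => ->; rewrite ?inordK //= ?ix_neq ?eqxx ?mulr1 // mxE mulrC mulVKf // eigdata_ar.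
rewrite e unitmx_mul h /= unitmxE det_diag prod4 !mxE !ix_neq eqxx !mulr1 unitfE.
exact: eigdata_ar.
Qed.

(** A component of [v] along x or y would give [v] an eigenvalue of modulus one, making it
    orthogonal to a and r, hence positive. So [v] lies in the span of a and r, and two non-zero
    components there would force |l1| = 1. *)
Lemma eigdata_fixed v : v != 0 -> herm v v <= 0 -> fixes A v ->
  same_point v a \/ same_point v r.
Proof.
move=> v0 hv [k hk]; have hS := eigdata_stdbasis.
case: hD hF => n1 n2 n3 _ [ha hr hx hy] [na nr [xx yy xy]].
have h0 := eigdata_ar.
have e := stdbasis_expand v hS.
have vx : herm v x = 0.
  apply/eqP; apply: contraTT hv => vx; rewrite -real_ltNge ?real0 ?herm_real //.
  have kk := isometry_eig hA hk hx vx.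
  have k1 : `|k| = 1 by move: (congr1 Num.norm kk); rewrite normrM norm_conjC n2 mulr1 normr1.
  apply: (orth_pair_pos na.2 nr.2 h0) => //.
    exact: isometry_orth hA ha hk (unit_neq k1).
  exact: isometry_orth hA hr hk (unit_neq' k1).
have vy : herm v y = 0.
  apply/eqP; apply: contraTT hv => vy; rewrite -real_ltNge ?real0 ?herm_real //.
  have kk := isometry_eig hA hk hy vy.
  have k1 : `|k| = 1 by move: (congr1 Num.norm kk); rewrite normrM norm_conjC n3 mulr1 normr1.
  apply: (orth_pair_pos na.2 nr.2 h0) => //.
    exact: isometry_orth hA ha hk (unit_neq k1).
  exact: isometry_orth hA hr hk (unit_neq' k1).
rewrite vx vy !scale0r !addr0 hermE in e.
have [va|va] := eqVneq (herm v a) 0.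
  left; rewrite va mulr0 scale0r addr0 scalerA in e.
  exists (herm v r / herm a r) => //; apply: contraNneq v0 => z.
  by rewrite e z scale0r.
have [vr|vr] := eqVneq (herm v r) 0.
  right; rewrite vr scale0r add0r in e; exists ((herm a r)^-1^* * herm v a) => //.
  by apply: contraNneq v0 => z; rewrite e z scale0r.
have ka := isometry_eig hA hk ha va.
have := isometry_eig hA hk hr vr.
rewrite rmorphV ?unitfE //= conjCK => kr.
have kl : k = l1 by rewrite -[k](divfK l10) kr mul1r.
by have := eigdata_l11; rewrite -{1}kl ka eqxx.
Qed.

Lemma eigdata_fixes : [/\ fixes A a, fixes A r, fixes A x & fixes A y].
Proof. by case: hD => _ _ _ _ [ha hr hx hy]; split; [exists l1|exists (l1^*)^-1|exists l2|exists l3]. Qed.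

Lemma eigdata_distinct : ~ same_point a r.
Proof.
case=> k k0 e; have := eigdata_ar; rewrite e hermE.
by case: hF => _ [_ ->] _; rewrite mulr0 eqxx.
Qed.

Lemma eigdata_lox : loxodromic A.
Proof.
case: hF eigdata_fixes => na nr _ [fa fr _ _]; split=> //.
  move=> v nv fv; have v0 : v != 0.
    by apply: contraTneq nv => ->; rewrite /negative herm0l ltxx.
  have [] := eigdata_fixed v0 (ltW nv) fv => -[k k0 e];
    by move: nv; rewrite /negative e !hermE ?na.2 ?nr.2 ?mulr0 ltxx.
exists a, r; split=> //; first exact: eigdata_distinct.
by move=> v [[v0 hv] fv]; apply: eigdata_fixed; rewrite ?hv.
Qed.

Lemma eigdata_fixpoints v : fixpoints A v <-> same_point v a \/ same_point v r.
Proof.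
case: hF eigdata_fixes => na nr _ [fa fr _ _]; split=> [[[v0 hv] fv]|].
  by apply: eigdata_fixed; rewrite ?hv.
by case=> h; (split; [exact: (same_point_null h) | exact: (fixes_same_point h)]).
Qed.

(** An eigenvector orthogonal to both x and y lies in the span of a and r, where eigenvectors are
    null. This is what makes a label an eigenvalue of x or of y. *)
Lemma eigdata_pos v k : positive v -> A *m v = k *: v -> k = l2 \/ k = l3.
Proof.
move=> pv hk; case: hD hF => n1 n2 n3 _ [ha hr hx hy] [na nr [xx yy xy]].
have unitK l : `|l| = 1 -> k * l^* = 1 -> k = l.
  move=> l1' e; rewrite -[k]mulr1; have /eqP : `|l| == 1 by rewrite l1'.
  by move/eqP; rewrite norm_eq1 => /eqP <-; rewrite mulrCA e mulr1.
have [vx|vx] := eqVneq (herm v x) 0; last first.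
  by left; apply: unitK => //; apply: isometry_eig hA hk hx vx.
have [vy|vy] := eqVneq (herm v y) 0; last first.
  by right; apply: unitK => //; apply: isometry_eig hA hk hy vy.
have v0 : v != 0 by apply: contraTneq pv => ->; rewrite /positive herm0l ltxx.
have := stdbasis_expand v eigdata_stdbasis; rewrite vx vy !scale0r !addr0 hermE => e.
have [va|va] := eqVneq (herm v a) 0.
  by move: pv; rewrite /positive e va mulr0 scale0r addr0 !hermE na.2 !mulr0 ltxx.
have [vr|vr] := eqVneq (herm v r) 0.
  by move: pv; rewrite /positive e vr scale0r add0r !hermE nr.2 !mulr0 ltxx.
have ka := isometry_eig hA hk ha va.
have := isometry_eig hA hk hr vr; rewrite fmorphV /= conjCK => kr.
have kl : k = l1 by rewrite -[k](divfK l10) kr mul1r.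
by have := eigdata_l11; rewrite -{1}kl ka eqxx.
Qed.

Lemma eigdata_orth_ar v : herm v a = 0 -> herm v r = 0 ->
  v = herm v x *: x + herm v y *: y.
Proof.
move=> va vr; have := stdbasis_expand v eigdata_stdbasis.
by rewrite hermE va vr mulr0 !scale0r add0r addr0.
Qed.
End Data.

Lemma eigdata_det (A : M) F l1 l2 l3 :
  mx4 (fr_a F) (fr_x F) (fr_y F) (fr_r F) \in unitmx ->
  [/\ A *m fr_a F = l1 *: fr_a F, A *m fr_r F = (l1^*)^-1 *: fr_r F,
       A *m fr_x F = l2 *: fr_x F & A *m fr_y F = l3 *: fr_y F] ->
  A *m mx4 (fr_a F) (fr_x F) (fr_y F) (fr_r F)
  = mx4 (fr_a F) (fr_x F) (fr_y F) (fr_r F)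
    *m diag_mx (\row_j [:: l1; l2; l3; (l1^*)^-1]`_j).
Proof.
move=> _ [ha hr hx hy]; apply: mx4P => j.
have -> : forall D, col j (mx4 (fr_a F) (fr_x F) (fr_y F) (fr_r F) *m diag_mx D)
   = D 0 j *: col j (mx4 (fr_a F) (fr_x F) (fr_y F) (fr_r F)).
  by move=> D; apply/matrixP=> i k; rewrite mul_mx_diag !mxE mulrC.
rewrite colE -mulmxA -colE mxE.
by case: (ord4P j) => ->; rewrite col_mx4 inordK.
Qed.

Lemma isometry_unit_eig A v k : SU31 A -> herm v v = 1 -> A *m v = k *: v -> `|k| = 1.
Proof.
move=> hA hv hk; apply/eqP; rewrite norm_eq1; apply/eqP.
by apply: (isometry_eig hA hk hk); rewrite hv oner_eq0.
Qed.

Lemma isometry_fix_orth A u v k : SU31 A -> A *m u = k *: u -> k != 0 ->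
  herm u v = 0 -> herm u (A *m v) = 0.
Proof.
move=> [_ hA] hu k0 h; have := hA u v; rewrite hu hermE h => /eqP.
by rewrite mulf_eq0 (negPf k0) => /eqP.
Qed.

(** The orthogonal complement of [u] and [w] is an invariant positive definite plane. It contains an
    eigenvector because C is algebraically closed, and the unit vector orthogonal to that one is
    then an eigenvector as well. *)
Lemma exists_eigframe A u w k : SU31 A -> null u -> null w -> herm u w != 0 ->
  A *m u = k *: u -> 1 < `|k| -> fixes A w ->
  exists F l2 l3, [/\ fr_a F = u, fr_r F = w, nullframe F & eigdata A F k l2 l3].
Proof.
move=> hA nu nw uw hu k1 [l hw].
have k0 : k != 0 by rewrite -normr_gt0 (lt_trans ltr01).
have kl : k * l^* = 1 := isometry_eig hA hu hw uw.
have l0 : l != 0.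
  by apply/eqP=> z; move/eqP: kl; rewrite z conjC0 mulr0 eq_sym oner_eq0.
have el : l = (k^*)^-1.
  by apply: (mulIf (_ : k^* != 0)); rewrite ?conjC_eq0 // mulVf ?conjC_eq0 // -[l]conjCK -rmorphM /= mulrC kl rmorph1.
have std p q : herm p p = 1 -> herm q q = 1 -> herm p q = 0 -> herm u p = 0 ->
    herm u q = 0 -> herm w p = 0 -> herm w q = 0 -> stdbasis ((herm u w)^-1 *: u) p q w.
  move=> pp qq pq up uq wp wq; split; rewrite ?hermE ?nu.2 ?nw.2 ?mulr0 ?mulVf //.
  by split; rewrite ?hermE ?up ?uq ?mulr0.
have [x0 [xx0 ux0 wx0 _]] := exists_orth_unit 0 nu.2 nw.2 uw.
have [y0 [yy0 uy0 wy0 xy0]] := exists_orth_unit x0 nu.2 nw.2 uw.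
have S0 := std _ _ xx0 yy0 xy0 ux0 uy0 wx0 wy0.
have expA v : herm u v = 0 -> herm w v = 0 ->
    A *m v = herm (A *m v) x0 *: x0 + herm (A *m v) y0 *: y0.
  move=> uv wv; have := stdbasis_expand (A *m v) S0.
  have h1 := herm0C (isometry_fix_orth hA hu k0 uv).
  have h2 := herm0C (isometry_fix_orth hA hw l0 wv).
  by rewrite hermE h1 h2 mulr0 !scale0r add0r addr0.
pose f (i : 'I_2) := if i == 0 then x0 else y0.
(* Row i holds the coordinates of the image of the i-th basis vector of the plane, so a left
   eigenvector of [B] gives the coordinates of an eigenvector of [A]. *)
pose B : 'M[C]_2 := \matrix_(i, j) herm (A *m f i) (f j).
have [mu] : exists mu, root (char_poly B) mu.
  by apply/closed_rootP; rewrite size_char_poly.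
rewrite -eigenvalue_root_char => /eigenvalueP[s sB s0].
pose p := s 0 0 *: x0 + s 0 1 *: y0.
have Ap : A *m p = mu *: p.
  have e0 := congr1 (fun m : 'rV_2 => m 0 0) sB.
  have e1 := congr1 (fun m : 'rV_2 => m 0 1) sB.
  move: e0 e1; rewrite /= !mxE !big_ord_recl !big_ord0 /= !mxE /f /= !addr0.
  rewrite (_ : lift ord0 ord0 = 1) /=; last exact/val_inj.
  move=> e0 e1; rewrite /p mulmxDr -!scalemxAr (expA x0) // (expA y0) //.
  by rewrite !scalerDr !scalerA -e0 -e1 !scalerDl addrACA.
have up : herm u p = 0 by rewrite !hermE ux0 uy0 !mulr0 addr0.
have wp : herm w p = 0 by rewrite !hermE wx0 wy0 !mulr0 addr0.
have p0 : p != 0.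
  apply: contra s0 => /eqP p0; apply/eqP/rowP=> i; rewrite mxE.
  have h1 : s 0 0 = 0.
    by have := congr1 (fun q : V => herm q x0) p0; rewrite !hermE xx0 (herm0C xy0) mulr0 addr0 mulr1.
  have h2 : s 0 1 = 0.
    by have := congr1 (fun q : V => herm q y0) p0; rewrite !hermE yy0 xy0 mulr0 add0r mulr1.
  case: i => [[|[|//]] lt_i]; [rewrite -[RHS]h1|rewrite -[RHS]h2]; congr (s _ _); exact/val_inj.
pose x := unitize p.
have xx : herm x x = 1 by rewrite unitize1 // (orth_pair_pos nu.2 nw.2 uw).
have ux : herm u x = 0 by apply: unitize_orth.
have wx : herm w x = 0 by apply: unitize_orth.
have Ax : A *m x = mu *: x by rewrite -scalemxAr Ap !scalerA mulrC.
have mu1 : `|mu| = 1 := isometry_unit_eig hA xx Ax.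
have mu0 : mu != 0 by rewrite -normr_eq0 mu1 oner_eq0.
have [y [yy uy wy xy]] := exists_orth_unit x nu.2 nw.2 uw.
have S1 := std _ _ xx yy xy ux uy wx wy.
have Ay : A *m y = herm (A *m y) y *: y.
  have := stdbasis_expand (A *m y) S1; rewrite [herm _ (_ *: u)]hermZr.
  rewrite (herm0C (isometry_fix_orth hA hu k0 uy)) (herm0C (isometry_fix_orth hA hw l0 wy)).
  by rewrite (herm0C (isometry_fix_orth hA Ax mu0 xy)) mulr0 !scale0r addr0 !add0r.
pose F := Frame u x y w; pose l3 := herm (A *m y) y.
have n3 : `|l3| = 1 := isometry_unit_eig hA yy Ay.
exists F, mu, l3; split=> //; split=> //=; last by rewrite -el.
(* The relation between the eigenvalues comes from taking determinants in A Q = Q D. *)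
have uQ : mx4 ((herm u w)^-1 *: u) x y w \in unitmx := stdbasis_unit S1.
have AQ := @eigdata_det A (Frame ((herm u w)^-1 *: u) x y w) k mu l3 uQ.
have /AQ/(congr1 determinant) : [/\ A *m ((herm u w)^-1 *: u) = k *: ((herm u w)^-1 *: u),
    A *m w = (k^*)^-1 *: w, A *m x = mu *: x & A *m y = l3 *: y].
  by split; rewrite -?el // -scalemxAr hu !scalerA mulrC.
rewrite !det_mulmx /= mulrC hA.1 det_diag prod4 !mxE !inordK //=.
move: uQ; rewrite unitmxE unitfE => uQ /(mulfI uQ) e.
by apply: (mulIf (_ : (k^*)^-1 != 0)); rewrite ?invr_eq0 ?conjC_eq0 // -e mulfV ?conjC_eq0.
Qed.

(** The eigenvalues k and l at the two fixed null points satisfy k l^* = 1. If |k| = 1 they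
    coincide, and the negative vector of [null_pair_neg] would be fixed. Otherwise the point whose
    eigenvalue has the larger modulus becomes [fr_a]. *)
Lemma loxodromic_eigenframe A : loxodromic A ->
  exists F l1 l2 l3, nullframe F /\ eigdata A F l1 l2 l3.
Proof.
case=> hA hneg [u [w [[nu fu] [nw fw] uw _]]].
have huw := distinct_null_herm nu nw uw.
have hwu : herm w u != 0 by rewrite -hermC conjC_eq0.
have [[k hk] [l hl]] := (fu, fw).
have kl := isometry_eig hA hk hl huw.
have n0 : `|k| != 0.
  by rewrite normr_eq0; apply/eqP=> z; move/eqP: kl; rewrite z mul0r eq_sym oner_eq0.
have nl : `|l| = `|k|^-1.
  by apply: (mulfI n0); rewrite mulfV // -(norm_conjC l) -normrM kl normr1.
have : `|k| != 1.
  apply/negP; rewrite norm_eq1 => /eqP kk.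
  have k0 : k != 0 by rewrite -normr_eq0.
  have elk : l = k by rewrite -[l]conjCK -[k in RHS]conjCK; congr _^*; apply: (mulfI k0); rewrite kl.
  apply: (hneg _ (null_pair_neg nu.2 nw.2 huw)); exists k.
  by rewrite mulmxBr -scalemxAr hk hl elk scalerBr !scalerA mulrC.
case: (real_ltgtP (normr_real k) (real1 C)) => // k1 _.
  have l1 : 1 < `|l| by rewrite nl invf_gt1 // lt_neqAle eq_sym n0 normr_ge0.
  have [F [l2 [l3 [_ _ h1 h2]]]] := exists_eigframe hA nw nu hwu hl l1 fu.
  by exists F, l, l2, l3.
have [F [l2 [l3 [_ _ h1 h2]]]] := exists_eigframe hA nu nw huw hk k1 fw.
by exists F, k, l2, l3.
Qed.

Definition swap_xy F := Frame (fr_a F) (fr_y F) (fr_x F) (fr_r F).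

Lemma swap_eigdata A F l1 l2 l3 : nullframe F -> eigdata A F l1 l2 l3 ->
  nullframe (swap_xy F) /\ eigdata A (swap_xy F) l1 l3 l2.
Proof.
case=> na nr [xx yy xy] [n1 n2 n3 hd [ha hr hx hy]]; split; split=> //.
  by split=> //; apply: herm0C.
by rewrite mulrAC.
Qed.

Section Labelling.
Variable lab : {poly C} -> C.
Hypothesis hlab : labelling lab.

Lemma labelled_or_swap A F : loxodromic A -> eigenframe A F ->
  labelled lab A F \/ labelled lab A (swap_xy F).
Proof.
move=> lA eF; case/eigenframeP: (eF) => nF [l1 [l2 [l3 hD]]].
have [hA _ _] := lA; have [v pv hv] := hlab lA.
have [e|e] := eigdata_pos hA nF hD pv hv.
  by left; split=> //; rewrite e; case: hD => _ _ _ _ [].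
right; split; first by apply/eigenframeP; have [? ?] := swap_eigdata nF hD; split=> //; exists l1, l3, l2.
by rewrite e; case: hD => _ _ _ _ [].
Qed.

Lemma labelled_exists A : loxodromic A -> exists F, labelled lab A F.
Proof.
move=> lA; have [F [l1 [l2 [l3 [h1 h2]]]]] := loxodromic_eigenframe lA.
have : eigenframe A F by apply/eigenframeP; split=> //; exists l1, l2, l3.
by case/(labelled_or_swap lA); [exists F|exists (swap_xy F)].
Qed.

Lemma cexpE (p q : R) : cexp (p +i* q) = (expR p)%:C * cis q.
Proof. by []. Qed.

(** There is no bound on |l1|, so that the lemma covers both loxodromic elements and the twist
    matrices commuting with them, for which the real part of the parameter may have any sign. *)
Lemma Emx_diag l1 l2 l3 : l1 != 0 -> `|l2| = 1 -> l1 * l2 * l3 = l1^* ->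
  exists l phi, [/\ is_angle (complex.Im l), is_angle phi, expR (complex.Re l) = complex.Re `|l1|
   & Emx l phi = diag_mx (\row_j [:: l1; l2; l3; (l1^*)^-1]`_j)].
Proof.
move=> l10 n2 hd; have [th hth eth] := polar l1.
have n1 : (complex.Re `|l1|)%:C = `|l1| by rewrite RRe_real // normr_real.
have n10 : 0 < complex.Re `|l1| by rewrite -ltcR n1 normr_gt0.
(* The second entry of [Emx] is exp (-i (psi + Im lambda)), whence the conjugate. *)
have [|ph hph eph] := @cis_exists R (l2 * cis th)^*.
  by rewrite norm_conjC normrM n2 norm_cis mulr1.
exists (ln (complex.Re `|l1|) +i* th), ph; split=> //=; first by rewrite lnK.
have e1 : cexp (ln (complex.Re `|l1|) +i* th) = l1 by rewrite cexpE lnK // n1 -eth.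
have e4 : cexp (- (ln (complex.Re `|l1|) +i* th)^*) = (l1^*)^-1.
  have -> : - (ln (complex.Re `|l1|) +i* th)^* = (- ln (complex.Re `|l1|)) +i* th.
    by apply/eqP; rewrite eq_complex /= opprK !eqxx.
  rewrite cexpE expRN lnK // fmorphV /= n1 eth.
  rewrite rmorphM /= conj_normC normrM normr_id norm_cis mulr1 -cisN invfM; congr (_ * _).
  by apply: (mulfI (cis_neq0 (- th))); rewrite mulfV ?cis_neq0 // -cisD addNr cis0.
have eh : ((ln (complex.Re `|l1|) +i* th)^* - (ln (complex.Re `|l1|) +i* th)) / 2 = 0 +i* (- th).
  apply: (mulIf (_ : 2 != 0)); rewrite ?pnatr_eq0 // divfK ?pnatr_eq0 //.
  by apply/eqP; rewrite eq_complex /=; apply/andP; split; apply/eqP; ring.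
have e2 : cexp (- (0 +i* ph) + ((ln (complex.Re `|l1|) +i* th)^* - (ln (complex.Re `|l1|) +i* th)) / 2) = l2.
  rewrite eh (_ : - (0 +i* ph) + 0 +i* (- th) = 0 +i* (- ph - th)); last first.
    by apply/eqP; rewrite eq_complex /= oppr0 addr0 !eqxx.
  rewrite cexpE expR0 mul1r cisD cisN -eph conjCK -mulrA -cisD subrr cis0 mulr1 //.
have e3 : cexp (0 +i* ph + ((ln (complex.Re `|l1|) +i* th)^* - (ln (complex.Re `|l1|) +i* th)) / 2) = l3.
  rewrite eh (_ : 0 +i* ph + 0 +i* (- th) = 0 +i* (ph - th)); last first.
    by apply/eqP; rewrite eq_complex /= addr0 !eqxx.
  have l20 : l2 != 0 by rewrite -normr_eq0 n2 oner_eq0.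
  rewrite cexpE expR0 mul1r cisD -eph; apply: (mulfI (mulf_neq0 l10 l20)); rewrite hd.
  have l22 : l2 * l2^* = 1 by rewrite -normCK n2 expr1n.
  have e5 : l1^* = `|l1| * (cis th)^* by rewrite {1}eth rmorphM /= conj_normC.
  have e6 : l1 * (cis th)^* = `|l1| by rewrite {1}eth -mulrA cis_conj mulr1.
  rewrite rmorphM /= cisN e5 -e6 -[RHS]mul1r -l22; ring.
rewrite /Emx e1 e2 e3 e4 //.
Qed.

(** Dividing [fr_a F] by its product with [fr_r F] turns the eigenvectors into a standard basis, and
    [isometry_of_gram] carries the coordinate basis to it up to one common scalar. *)
Lemma diagonalizes_exists A : loxodromic A -> exists Q, diagonalizes lab A Q.
Proof.
move=> lA; have [F hF] := labelled_exists lA; have [eF _] := hF.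
case/eigenframeP: eF => nF [l1 [l2 [l3 hD]]].
have [hA _ _] := lA; have hS := eigdata_stdbasis hA nF hD.
have [g [s [hg ss]]] := @isometry_of_gram R 1%:M _ (unitmx1 _ _) (etrans (@gram11 R) (esym (stdbasis_gram hS))).
rewrite mulmx1 => eg.
have s0 : s != 0 by apply/eqP=> z; move/eqP: ss; rewrite z mul0r eq_sym oner_eq0.
have [n1 n2 n3 hd [ha hr hx hy]] := hD.
have l10 : l1 != 0 by rewrite -normr_gt0 (lt_trans ltr01).
exists g; split=> //.
  exists F => //; rewrite eg; split.
  - exists (s * (herm (fr_a F) (fr_r F))^-1); first by rewrite mulf_neq0 // invr_eq0 (eigdata_ar nF hD).
    by rewrite colE -scalemxAl -colE col_mx4 scalerA.
  - by exists s; rewrite // colE -scalemxAl -colE col_mx4.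
  - by exists s; rewrite // colE -scalemxAl -colE col_mx4.
  - by exists s; rewrite // colE -scalemxAl -colE col_mx4.
have [l [phi [h1 h2 h3 h4]]] := Emx_diag l10 n2 hd.
exists l, phi; split=> //.
  rewrite ltNge -expR_le1 h3 -ltNge -ltcR RRe_real ?normr_real //.
rewrite /cj h4 -[LHS](mulmxK (SU31_unit hg)); congr (_ *m _).
rewrite eg -scalemxAr -scalemxAl; congr (_ *: _).
apply: (@eigdata_det A (Frame ((herm (fr_a F) (fr_r F))^-1 *: fr_a F) (fr_x F) (fr_y F) (fr_r F))).
  exact: stdbasis_unit hS.
by split=> //=; rewrite -scalemxAr ha !scalerA mulrC.
Qed.
End Labelling.
End Spectrum.

(** * Conjugation *)

Section Conjugation.
Variable R : realType.
Notation C := R[i].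
Notation V := 'cV[C]_4.
Notation M := 'M[C]_4.
Implicit Types (A B g h P Q : M) (a x y r u v w z : V) (k l : C) (F : frame R).

Lemma cj_mul g A B : SU31 g -> cj g (A *m B) = cj g A *m cj g B.
Proof. by move=> hg; rewrite /cj !mulmxA mulmxKV // SU31_unit. Qed.

Lemma cj_cj g h A : SU31 g -> SU31 h -> cj g (cj h A) = cj (g *m h) A.
Proof.
move=> /SU31_unit ug /SU31_unit uh; rewrite /cj.
have -> : invmx (g *m h) = invmx h *m invmx g; last by rewrite !mulmxA.
by apply: (can_inj (mulKmx (_ : g *m h \in unitmx)));
  rewrite ?unitmx_mul ?ug // mulmxV ?unitmx_mul ?ug // mulmxA mulmxK // mulmxV.
Qed.

Lemma cj1 A : cj 1%:M A = A.
Proof. by rewrite /cj invmx1 mul1mx mulmx1. Qed.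

Lemma cj_1 g : SU31 g -> cj g 1%:M = 1%:M.
Proof. by move=> hg; rewrite /cj mulmx1 mulmxV ?SU31_unit. Qed.

Lemma cjK g A : SU31 g -> cj (invmx g) (cj g A) = A.
Proof. by move=> hg; rewrite (cj_cj _ (SU31_inv hg) hg) mulVmx ?SU31_unit ?cj1. Qed.

Lemma SU31_cj g A : SU31 g -> SU31 A -> SU31 (cj g A).
Proof. by move=> hg hA; exact: SU31_mul (SU31_mul hg hA) (SU31_inv hg). Qed.

Lemma invmx_mul A B : A \in unitmx -> B \in unitmx ->
  invmx (A *m B) = invmx B *m invmx A.
Proof.
move=> uA uB; have uAB : A *m B \in unitmx by rewrite unitmx_mul uA.
by apply: (can_inj (mulKmx uAB)); rewrite mulmxV // mulmxA mulmxK // mulmxV.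
Qed.

Lemma cj_inv g A : SU31 g -> A \in unitmx -> cj g (invmx A) = invmx (cj g A).
Proof.
move=> /SU31_unit ug uA.
by rewrite /cj !invmx_mul ?unitmx_mul ?ug ?uA ?unitmx_inv // invmxK mulmxA.
Qed.

Lemma conj2_refl (p : M * M) : conj2 p p.
Proof. by exists 1%:M; rewrite ?cj1; first exact: SU31_1. Qed.

Lemma conj2_sym (p q : M * M) : conj2 p q -> conj2 q p.
Proof. by case: p q => [a b] [c d] [g hg /= [-> ->]]; exists (invmx g); rewrite ?cjK //; exact: SU31_inv. Qed.

Lemma conj2_trans (p q s : M * M) : conj2 p q -> conj2 q s -> conj2 p s.
Proof.
case: p q s => [a b] [c d] [e f] [g hg /= [-> ->]] [h hh /= [-> ->]]; exists (h *m g); first exact: SU31_mul.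
by rewrite !cj_cj.
Qed.

Lemma trace_cj g A : SU31 g -> \tr (cj g A) = \tr A.
Proof. by move=> hg; rewrite /cj mxtrace_mulC mulmxA mulVmx ?SU31_unit // mul1mx. Qed.

Lemma sigma_cj g A : SU31 g -> sigma (cj g A) = sigma A.
Proof. by move=> hg; rewrite /sigma -cj_mul // !trace_cj. Qed.

Lemma char_poly_intertwine A B P : P \in unitmx -> P *m A = B *m P ->
  char_poly A = char_poly B.
Proof.
move=> uP e; pose G := map_mx polyC P.
have G0 : \det G != 0 by rewrite det_map_mx /= polyC_eq0 -unitfE -unitmxE.
apply: (mulfI G0); rewrite [RHS]mulrC /char_poly -!det_mulmx; congr (\det _).
by rewrite /char_poly_mx mulmxBr mulmxBl -!map_mxM e scalar_mxC.
Qed.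

Lemma char_poly_cj g A : SU31 g -> char_poly (cj g A) = char_poly A.
Proof.
move=> hg; apply/esym/(@char_poly_intertwine _ _ g); rewrite ?SU31_unit //.
by rewrite /cj mulmxKV ?SU31_unit.
Qed.

Lemma orth_basis0 P q : P \in unitmx -> (forall j, herm (col j P) q = 0) -> q = 0.
Proof.
move=> uP h; have : P^T *m Jm R *m map_mx Num.conj q = 0.
  apply/matrixP=> i j; by rewrite (ord1 j) [RHS]mxE -(h i) hermEmx tr_col -!row_mul [RHS]mxE.
move=> /(congr1 (mulmx (invmx (P^T *m Jm R)))).
rewrite mulmx0 mulKmx ?unitmx_mul ?unitmx_tr ?uP ?Jm_unit // => /matrixP e.
by apply/matrixP=> i j; have := e i j; rewrite !mxE => /eqP; rewrite conjC_eq0 => /eqP.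
Qed.

Lemma cj_on_basis A B g P Q (s : C) : SU31 g -> Q \in unitmx -> s != 0 ->
  g *m P = s *: Q ->
  (forall j, exists k, A *m col j P = k *: col j P /\ B *m col j Q = k *: col j Q) ->
  B = cj g A.
Proof.
move=> hg uQ s0 e h; apply: (eq_on_basis uQ) => j; have [k [h1 h2]] := h j.
have ej : col j Q = s^-1 *: (g *m col j P).
  by rewrite mul_col e linearZ /= scalerA mulVf // scale1r.
rewrite h2 ej -scalemxAr; have -> : cj g A *m (g *m col j P) = g *m (A *m col j P).
  by rewrite /cj !mulmxA mulmxKV ?SU31_unit.
by rewrite h1 -scalemxAr !scalerA mulrC.
Qed.

Lemma mulmx_cj g A v : SU31 g -> cj g A *m (g *m v) = g *m (A *m v).
Proof. by move=> hg; rewrite /cj !mulmxA mulmxKV ?SU31_unit. Qed.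

Lemma eig_cj g A v k : SU31 g -> A *m v = k *: v -> cj g A *m (g *m v) = k *: (g *m v).
Proof. by move=> hg e; rewrite mulmx_cj // e -scalemxAr. Qed.

Lemma SU31_mul_neq0 g v : SU31 g -> v != 0 -> g *m v != 0.
Proof.
move=> /SU31_unit ug; apply: contraNneq => e.
by rewrite -(mulKmx ug v) e mulmx0.
Qed.

Lemma null_SU31 g v : SU31 g -> null v -> null (g *m v).
Proof. by move=> hg [v0 hv]; split; [exact: SU31_mul_neq0 | rewrite hg.2]. Qed.

Definition push g F := Frame (g *m fr_a F) (g *m fr_x F) (g *m fr_y F) (g *m fr_r F).

Lemma eigdata_push g A F l1 l2 l3 : SU31 g -> nullframe F -> eigdata A F l1 l2 l3 ->
  nullframe (push g F) /\ eigdata (cj g A) (push g F) l1 l2 l3.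
Proof.
move=> hg [na nr [xx yy xy]] [n1 n2 n3 hd [ha hr hx hy]]; split; split=> //.
- exact: null_SU31.
- exact: null_SU31.
- by rewrite /= !hg.2.
- by rewrite /=; split; apply: eig_cj.
Qed.

Lemma labelled_push lab g A F : SU31 g -> labelled lab A F ->
  labelled lab (cj g A) (push g F).
Proof.
move=> hg [/eigenframeP[nF [l1 [l2 [l3 hD]]]] hl]; split.
  apply/eigenframeP; have [h1 h2] := eigdata_push hg nF hD; split=> //.
  by exists l1, l2, l3.
by rewrite char_poly_cj //; apply: eig_cj.
Qed.

Lemma lox_cj g A : SU31 g -> loxodromic A -> loxodromic (cj g A).
Proof.
move=> hg lA; have [F [l1 [l2 [l3 [nF hD]]]]] := loxodromic_eigenframe lA.
have [h1 h2] := eigdata_push hg nF hD.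
by apply: (eigdata_lox _ h1 h2); apply: SU31_cj => //; case: lA.
Qed.

Lemma conj_of_eigdata A B F F' l1 l2 l3 : SU31 A -> SU31 B ->
  nullframe F -> nullframe F' -> eigdata A F l1 l2 l3 -> eigdata B F' l1 l2 l3 ->
  conj1 A B.
Proof.
move=> hA hB nF nF' hD hD'.
have S1 := eigdata_stdbasis hA nF hD; have S2 := eigdata_stdbasis hB nF' hD'.
have [g [s [hg ss e]]] := isometry_of_gram (stdbasis_unit S1)
  (etrans (stdbasis_gram S1) (esym (stdbasis_gram S2))).
have s0 : s != 0 by apply/eqP=> z; move/eqP: ss; rewrite z mul0r eq_sym oner_eq0.
exists g => //; apply: (cj_on_basis hg (stdbasis_unit S2) s0 e) => j.
case: hD hD' => _ _ _ _ [ha hr hx hy] [_ _ _ _ [ha' hr' hx' hy']].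
case: (ord4P j) => ->; rewrite !col_mx4.
- by exists l1; rewrite -!scalemxAr ha ha' !scalerA ![_ * l1]mulrC.
- by exists l2.
- by exists l3.
- by exists (l1^*)^-1.
Qed.

Section Spec.
Variables (A : M) (F : frame R) (l1 l2 l3 : C).
Hypotheses (hA : SU31 A) (hF : nullframe F) (hD : eigdata A F l1 l2 l3).
Let Q := mx4 (fr_a F) (fr_x F) (fr_y F) (fr_r F).
Let D : M := diag_mx (\row_j [:: l1; l2; l3; (l1^*)^-1]`_j).
Let uQ : Q \in unitmx. Proof. exact: eigdata_basis hA hF hD. Qed.
Let eQ : A *m Q = Q *m D.
Proof. by apply: eigdata_det => //; case: hD. Qed.
Let eA : A = Q *m D *m invmx Q. Proof. by rewrite -eQ mulmxK. Qed.

Lemma eigdata_tr : \tr A = l1 + l2 + l3 + (l1^*)^-1.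
Proof.
rewrite eA mxtrace_mulC mulmxA mulVmx // mul1mx mxtrace_diag sum4 !mxE !inordK //.
Qed.

Lemma eigdata_sigma : sigma A = l1 * l2 + l1 * l3 + l2 * l3
   + (l1 + l2 + l3) * (l1^*)^-1.
Proof.
have eAA : A *m A = Q *m (D *m D) *m invmx Q.
  by rewrite {1}eA -mulmxA {1}eA !mulmxA mulmxKV.
have e2 : \tr (A *m A) = l1 ^+ 2 + l2 ^+ 2 + l3 ^+ 2 + ((l1^*)^-1) ^+ 2.
  rewrite eAA mxtrace_mulC [invmx Q *m _]mulmxA mulVmx // mul1mx mulmx_diag mxtrace_diag sum4 !mxE !inordK //.
rewrite /sigma e2 eigdata_tr; by move: ((l1^*)^-1) => l4; field.
Qed.

Lemma eigdata_char_poly : char_poly A =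
  ('X - l1%:P) * ('X - l2%:P) * ('X - l3%:P) * ('X - ((l1^*)^-1)%:P).
Proof.
have uQ' : invmx Q \in unitmx by rewrite unitmx_inv.
rewrite (@char_poly_intertwine _ D _ uQ'); last by rewrite {1}eA -!mulmxA mulKmx.
rewrite char_poly_trig ?diag_mx_is_trig // !big_ord_recl big_ord0 mulr1 !mulrA.
by rewrite /D !mxE /= ?eqxx !mulr1n.
Qed.

Lemma eigdata_rel : l1 != 0 /\ [/\ l2^* = l2^-1, l3^* = l3^-1, l2 != 0, l3 != 0 &
  l1 * l2 * l3 * (l1^*)^-1 = 1].
Proof.
case: hD => n1 n2 n3 hd _; have l10 : l1 != 0 by rewrite -normr_gt0 (lt_trans ltr01).
have inv k : `|k| = 1 -> k != 0 /\ k^* = k^-1.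
  move=> k1; have k0 : k != 0 by rewrite -normr_eq0 k1 oner_eq0.
  by split=> //; apply: (mulfI k0); rewrite mulfV // -normCK k1 expr1n.
have [? ?] := inv _ n2; have [? ?] := inv _ n3.
by split=> //; split=> //; rewrite hd mulfV ?conjC_eq0.
Qed.

Lemma eigdata_sigma_real : (sigma A)^* = sigma A.
Proof.
have [l10 [c2 c3 l20 l30 hp]] := eigdata_rel.
rewrite eigdata_sigma !(rmorphD, rmorphM) /= fmorphV /= conjCK c2 c3.
have -> : (l1^*)^-1 = (l1 * l2 * l3)^-1.
  by apply: (mulfI (mulf_neq0 (mulf_neq0 l10 l20) l30)); rewrite hp mulfV ?mulf_neq0.
have -> : l1^* = l1 * l2 * l3.
  by apply: (mulIf (_ : (l1^*)^-1 != 0)); rewrite ?invr_eq0 ?conjC_eq0 // mulfV ?conjC_eq0.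
field; rewrite l10 l20 l30 //.
Qed.

(** The spectrum is stable under inverse conjugation and has product one, so the third symmetric
    function of the eigenvalues is the conjugate of the first. Trace and [sigma] therefore give
    every coefficient of the characteristic polynomial. *)
Lemma eigdata_tr_conj : (\tr A)^* = l1 * l2 * l3 + l1 * l2 * (l1^*)^-1
   + l1 * l3 * (l1^*)^-1 + l2 * l3 * (l1^*)^-1.
Proof.
have [l10 [c2 c3 l20 l30 hp]] := eigdata_rel.
rewrite eigdata_tr !rmorphD /= fmorphV /= conjCK c2 c3.
have -> : (l1^*)^-1 = (l1 * l2 * l3)^-1.
  by apply: (mulfI (mulf_neq0 (mulf_neq0 l10 l20) l30)); rewrite hp mulfV ?mulf_neq0.
have -> : l1^* = l1 * l2 * l3.
  by apply: (mulIf (_ : (l1^*)^-1 != 0)); rewrite ?invr_eq0 ?conjC_eq0 // mulfV ?conjC_eq0.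
field; rewrite l10 l20 l30 //.
Qed.
End Spec.

(** By [eigdata_tr_conj] the characteristic polynomials agree, so m1 is a root of the first one, and
    l1 is its only root of modulus above one. The sum and the product of the two unit eigenvalues
    then agree too, which leaves their order open. *)
Lemma eigdata_unique A B F F' l1 l2 l3 m1 m2 m3 :
  SU31 A -> nullframe F -> eigdata A F l1 l2 l3 ->
  SU31 B -> nullframe F' -> eigdata B F' m1 m2 m3 ->
  \tr A = \tr B -> sigma A = sigma B ->
  m1 = l1 /\ ((m2 = l2 /\ m3 = l3) \/ (m2 = l3 /\ m3 = l2)).
Proof.
move=> hA nF hD hB nF' hD' e1 e2.
have e3 : (\tr A)^* = (\tr B)^* by rewrite e1.
rewrite (eigdata_tr hA nF hD) (eigdata_tr hB nF' hD') in e1.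
rewrite (eigdata_sigma hA nF hD) (eigdata_sigma hB nF' hD') in e2.
rewrite (eigdata_tr_conj hA nF hD) (eigdata_tr_conj hB nF' hD') in e3.
have [l10 [c2 c3 l20 l30 e4]] := eigdata_rel hD.
have [m10 [d2 d3 m20 m30 e4']] := eigdata_rel hD'.
have [n1 n2 n3 hd _] := hD; have [k1 k2 k3 hd' _] := hD'.
have root : (m1 - l1) * (m1 - l2) * (m1 - l3) * (m1 - (l1^*)^-1) = 0.
  move: ((l1^*)^-1) ((m1^*)^-1) e1 e2 e3 e4 e4' => l4 m4 e1 e2 e3 e4 e4'.
  transitivity (m1 ^+ 4 - (l1 + l2 + l3 + l4) * m1 ^+ 3
    + (l1 * l2 + l1 * l3 + l2 * l3 + (l1 + l2 + l3) * l4) * m1 ^+ 2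
    - (l1 * l2 * l3 + l1 * l2 * l4 + l1 * l3 * l4 + l2 * l3 * l4) * m1
    + l1 * l2 * l3 * l4); first by ring.
  by rewrite e1 e2 e3 e4 -e4'; ring.
have em : m1 = l1.
  move/eqP: root; rewrite !mulf_eq0 !subr_eq0 => /orP[/orP[/orP[]|]|] /eqP // e.
  - by move: k1; rewrite e n2 ltxx.
  - by move: k1; rewrite e n3 ltxx.
  - move: k1; rewrite e normfV norm_conjC invf_gt1 ?(lt_trans ltr01) //.
    by move/lt_trans => /(_ _ n1); rewrite ltxx.
split=> //; subst m1.
have s23 : m2 + m3 = l2 + l3.
  by apply/(addrI l1)/(addIr (l1^*)^-1); rewrite !addrA -e1.
have p23 : m2 * m3 = l2 * l3.
  by apply: (mulfI l10); rewrite !mulrA hd hd'.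
have /eqP : (m2 - l2) * (m2 - l3) = 0.
  transitivity (m2 ^+ 2 - (l2 + l3) * m2 + l2 * l3); first by ring.
  by rewrite -s23 -p23; ring.
rewrite mulf_eq0 !subr_eq0 => /orP[] /eqP e; [left|right]; split=> //.
  by apply: (addrI m2); rewrite s23 e.
by apply: (addrI m2); rewrite s23 e addrC.
Qed.

Lemma lox_conj1 A B : loxodromic A -> loxodromic B ->
  \tr A = \tr B -> sigma A = sigma B -> conj1 A B.
Proof.
move=> lA lB e1 e2; have [hA _ _] := lA; have [hB _ _] := lB.
have [F [l1 [l2 [l3 [nF hD]]]]] := loxodromic_eigenframe lA.
have [F' [m1 [m2 [m3 [nF' hD']]]]] := loxodromic_eigenframe lB.
have [em [[em2 em3]|[em2 em3]]] := eigdata_unique hA nF hD hB nF' hD' e1 e2; subst.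
  exact: (conj_of_eigdata hA hB nF nF' hD hD').
have [nF2 hD2] := swap_eigdata nF' hD'.
exact: (conj_of_eigdata hA hB nF nF2 hD hD2).
Qed.

(** The order that [eigdata_unique] leaves open is settled by the label, since conjugate matrices
    have the same characteristic polynomial. *)
Lemma labelled_same_data lab A B F F' : loxodromic A -> loxodromic B ->
  \tr A = \tr B -> sigma A = sigma B -> labelled lab A F -> labelled lab B F' ->
  [/\ nullframe F, nullframe F' &
  exists l1 l2 l3, eigdata A F l1 l2 l3 /\ eigdata B F' l1 l2 l3].
Proof.
move=> lA lB e1 e2 [/eigenframeP[nF [l1 [l2 [l3 hD]]]] hl].
move=> [/eigenframeP[nF' [m1 [m2 [m3 hD']]]] hl'].
have [hA _ _] := lA; have [hB _ _] := lB.
have [em em23] := eigdata_unique hA nF hD hB nF' hD' e1 e2; subst.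
split=> //; exists l1, l2, l3; split=> //.
have [g hg eB] := lox_conj1 lA lB e1 e2.
have ecp : char_poly B = char_poly A by rewrite eB char_poly_cj.
have x0 (G : frame R) : nullframe G -> fr_x G != 0.
  by case=> _ _ [h _ _]; apply/eqP=> z; move/eqP: h; rewrite z herm0l eq_sym oner_eq0.
have [_ _ _ hd [_ _ hx _]] := hD; have [_ _ _ hd' [_ _ hx' _]] := hD'.
have em2 : m2 = l2.
  by rewrite (eig_unique (x0 _ nF) hx hl) (eig_unique (x0 _ nF') hx' hl') ecp.
have em3 : m3 = l3 by case: em23 => -[? ?]; congruence.
by subst.
Qed.

Lemma lox_inv A : loxodromic A -> loxodromic (invmx A).
Proof.
move=> lA; have [hA _ _] := lA; have uA := SU31_unit hA.
have [F [l1 [l2 [l3 [[na nr xy] hD]]]]] := loxodromic_eigenframe lA.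
have [l10 [c2 c3 l20 l30 e4]] := eigdata_rel hD.
have eigV v k : k != 0 -> A *m v = k *: v -> invmx A *m v = k^-1 *: v.
  by move=> k0 e; rewrite -{1}(scale1r v) -(mulVf k0) -scalerA -e -scalemxAr mulKmx.
apply: (@eigdata_lox _ _ (Frame (fr_r F) (fr_x F) (fr_y F) (fr_a F)) (l1^*) l2^-1 l3^-1).
- exact: SU31_inv.
- by split.
case: hD => n1 n2 n3 hd [ha hr hx hy]; split; rewrite ?normfV ?norm_conjC ?n2 ?n3 ?invr1 ?conjCK //.
  by rewrite -hd; field; rewrite l20 l30.
by split; rewrite /= ?(eigV _ _ _ hr) ?(eigV _ _ _ ha) ?(eigV _ _ _ hx) ?(eigV _ _ _ hy) ?invr_eq0 ?conjC_eq0 ?invrK.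
Qed.

Lemma sigma_real A : loxodromic A -> (sigma A)^* = sigma A.
Proof.
move=> lA; have [hA _ _] := lA.
have [F [l1 [l2 [l3 [nF hD]]]]] := loxodromic_eigenframe lA.
exact: eigdata_sigma_real hA nF hD.
Qed.

Lemma sigmaRe A : loxodromic A -> (complex.Re (sigma A))%:C = sigma A.
Proof. by move=> lA; rewrite RRe_real //; apply/CrealP; apply: sigma_real. Qed.

Lemma mismatch_conj P P' : SU31 P -> conj1 (invmx P) P' -> forall i, mismatch P P' i = 0.
Proof.
move=> hP [g hg ->] i; rewrite /mismatch sigma_cj // trace_cj // !subrr /=.
by case: i => [[|[|[|//]]] lt_i].
Qed.

(** The real part of [sigma] suffices because [sigma] is real on loxodromic elements; trace and
    [sigma] then determine the conjugacy class. *)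
Lemma mismatch_conjP P P' : loxodromic P -> loxodromic P' ->
  conj1 (invmx P) P' <-> forall i, mismatch P P' i = 0.
Proof.
move=> lP lP'; split; first by apply: mismatch_conj; case: lP.
move=> h; have lV := lox_inv lP.
apply: lox_conj1 => //.
  apply/esym/eqP; rewrite -subr_eq0 eq_complex /=.
  have := h ord0; have := h (lift ord0 ord0); rewrite /mismatch /= => -> ->.
  by rewrite eqxx.
rewrite -(sigmaRe lV) -(sigmaRe lP'); congr _%:C; apply/esym/eqP; rewrite -subr_eq0.
have := h ord_max; rewrite /mismatch /= => e.
by rewrite -(raddfB (@complex.Re R : Rcomplex R -> R)) /= e.
Qed.
End Conjugation.

(** * Non-singular pairs *)

Section Pieces.
Variable R : realType.
Notation C := R[i].
Notation V := 'cV[C]_4.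
Notation M := 'M[C]_4.
Implicit Types (A B g h P Q Z : M) (a x y r u v w z n q : V) (k l : C) (F : frame R).

(** The chain is the boundary of the orthogonal complement of [n], with orthonormal basis (u' + w) /
    sqrt 2, q, (u' - w) / sqrt 2, where u' is [u] rescaled so that its product with w is 1. It turns
    a linear dependence of fixed points into a common chain. *)
Lemma chain_of_normal n u w : null u -> null w -> herm u w != 0 ->
  herm u n = 0 -> herm w n = 0 -> n != 0 ->
  exists2 X, C2_chain X & forall v, null v -> herm v n = 0 -> X v.
Proof.
move=> nu nw uw un wn n0.
have nn : herm (unitize n) (unitize n) = 1 by apply/unitize1/(orth_pair_pos nu.2 nw.2 uw).
have [q [qq uq wq nq]] := exists_orth_unit n nu.2 nw.2 uw.
pose u' := (herm u w)^-1 *: u.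
have qn' : herm q (unitize n) = 0 by apply/unitize_orth/herm0C.
have u'w : herm u' w = 1 by rewrite hermZl mulVf.
have wu' : herm w u' = 1 by rewrite -hermC u'w conjC1.
have u'u' : herm u' u' = 0 by rewrite hermZl hermZr nu.2 !mulr0.
have S : stdbasis u' q (unitize n) w.
  split=> //; first exact: nw.2.
  by split=> //; rewrite ?[herm u' _]hermZl ?unitize_orth ?uq ?mulr0.
pose s : C := (sqrtC 2)^-1.
have s0 : s != 0 by rewrite invr_eq0 sqrtC_eq0 pnatr_eq0.
have ss : s * s^* = 2^-1.
  by rewrite -normCK normfV exprVn ger0_norm ?sqrtC_ge0 ?ler0n // sqrtCK.
have u'q : herm u' q = 0 by rewrite hermZl uq mulr0.
clearbody u' s.
pose p := s *: (u' + w); pose m := s *: (u' - w).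
exists [set v | null v /\ exists a b c : C, v = a *: p + b *: q + c *: m] => //.
  exists p, q, m; split=> //; split.
  - by rewrite /p hermZl hermZr mulrA ss !hermE u'u' nw.2 u'w wu'; field.
  - exact: qq.
  - by rewrite /m hermZl hermZr mulrA ss !hermE u'u' nw.2 u'w wu'; field.
  - by rewrite /p hermZl hermDl u'q wq addr0 mulr0.
  - by rewrite /p /m hermZl hermZr mulrA ss !hermE u'u' nw.2 u'w wu'; field.
  - by apply: herm0C; rewrite /m hermZl hermBl u'q wq subr0 mulr0.
move=> v nv vn; split=> //; have e := stdbasis_expand v S.
have vn' : herm v (unitize n) = 0 by apply: unitize_orth.
rewrite vn' scale0r addr0 in e.
exists ((herm v w + herm v u') / (2 * s)), (herm v q), ((herm v w - herm v u') / (2 * s)).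
move: (herm v w) (herm v q) (herm v u') e => al b be ->; rewrite /p /m.
apply/matrixP=> i j; rewrite !mxE; by field.
Qed.

(** Eigenvectors for l1 are null because |l1| is not one, hence fixed points; the eigenvalue rules
    out [fr_r F]. *)
Lemma eigdata_a_unique A F l1 l2 l3 v : SU31 A -> nullframe F -> eigdata A F l1 l2 l3 ->
  A *m v = l1 *: v -> exists k, v = k *: fr_a F.
Proof.
move=> hA nF hD hv; have [->|v0] := eqVneq v 0; first by exists 0; rewrite scale0r.
have vv := isometry_orth hA hv hv (eigdata_l11 hD).
have [||[k _ ->]|sr] := eigdata_fixed hA nF hD v0; rewrite ?vv //.
- by exists l1.
- by exists k.
have [k k0 e] := sr; have [_ _ _ _ [_ hr _ _]] := hD.
have : A *m v = (l1^*)^-1 *: v by rewrite e -scalemxAr hr !scalerA mulrC.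
move/(eig_unique v0 hv)=> e1; have := eigdata_l11 hD.
by rewrite {1}e1 mulVf ?eqxx // conjC_eq0; have [] := eigdata_rel hD.
Qed.

Lemma eigdata_r_unique A F l1 l2 l3 v : SU31 A -> nullframe F -> eigdata A F l1 l2 l3 ->
  A *m v = (l1^*)^-1 *: v -> exists k, v = k *: fr_r F.
Proof.
move=> hA nF hD hv; have [->|v0] := eqVneq v 0; first by exists 0; rewrite scale0r.
have [l10 _] := eigdata_rel hD.
have l11 : (l1^*)^-1 * ((l1^*)^-1)^* != 1.
  by rewrite -normCK normfV norm_conjC exprVn invr_eq1 normCK (eigdata_l11 hD).
have vv := isometry_orth hA hv hv l11.
have [||sa|[k _ ->]] := eigdata_fixed hA nF hD v0; rewrite ?vv //.
- by exists (l1^*)^-1.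
- have [k k0 e] := sa; have [_ _ _ _ [ha _ _ _]] := hD.
  have : A *m v = l1 *: v by rewrite e -scalemxAr ha !scalerA mulrC.
  move/(eig_unique v0 hv)=> e1; have := eigdata_l11 hD.
  by rewrite -{1}e1 mulVf ?eqxx // conjC_eq0.
by exists k.
Qed.

Definition basis_pair F F' : Prop :=
  [/\ mx4 (fr_a F) (fr_r F) (fr_a F') (fr_r F') \in unitmx,
   herm (fr_a F) (fr_r F) != 0, herm (fr_a F') (fr_r F') != 0 &
   [/\ herm (fr_a F) (fr_a F') != 0, herm (fr_a F) (fr_r F') != 0,
       herm (fr_r F) (fr_a F') != 0 & herm (fr_r F) (fr_r F') != 0]].

Lemma no_common_distinct A B u v : no_common_fixpoint A B ->
  fixes A u -> fixes B v -> null u -> null v -> herm u v != 0.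
Proof.
move=> h fu fv nu nv; apply: distinct_null_herm => // e.
have fu' := fixes_same_point e fv.
by apply: (h u nu.1) => //; rewrite nu.2.
Qed.

(** If the determinant vanished, some non-zero vector would be orthogonal to all four fixed points,
    and the chain polar to it would contain them, against condition (ii) of non-singularity. *)
Lemma nonsingular_basis A B F F' l1 l2 l3 m1 m2 m3 : nonsingular A B ->
  nullframe F -> eigdata A F l1 l2 l3 -> nullframe F' -> eigdata B F' m1 m2 m3 ->
  basis_pair F F'.
Proof.
move=> [[lA lB] hcom hch _] nF hD nF' hD'.
have [hA _ _] := lA; have [hB _ _] := lB.
have [fa fr _ _] := eigdata_fixes hD; have [fa' fr' _ _] := eigdata_fixes hD'.
have [na nr _] := nF; have [na' nr' _] := nF'.
have h1 := eigdata_ar nF hD; have h2 := eigdata_ar nF' hD'.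
split=> //; last by split; apply: (no_common_distinct hcom).
rewrite unitmxE unitfE; apply/eqP=> /singular_orth[n n0 hn].
have e1 := hn ix1; have e2 := hn ix2; have e3 := hn ix3; have e4 := hn ix4.
rewrite !col_mx4 in e1 e2 e3 e4.
have [X cX hX] := chain_of_normal na nr h1 e1 e2 n0.
apply: hch; exists X => //; split=> v fv; apply: hX; case: (fv) => // _ _.
  have [[k _ ->]|[k _ ->]] := (eigdata_fixpoints hA nF hD v).1 fv;
    by rewrite hermZl ?e1 ?e2 mulr0.
have [[k _ ->]|[k _ ->]] := (eigdata_fixpoints hB nF' hD' v).1 fv;
  by rewrite hermZl ?e3 ?e4 mulr0.
Qed.

Lemma basis_pair_orth F F' q : basis_pair F F' -> herm (fr_a F) q = 0 ->
  herm (fr_r F) q = 0 -> herm (fr_a F') q = 0 -> herm (fr_r F') q = 0 -> q = 0.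
Proof.
move=> [u _ _ _] h1 h2 h3 h4; apply: (orth_basis0 u) => j.
by case: (ord4P j) => ->; rewrite col_mx4.
Qed.

(** An element commuting with both multiplies the four fixed vectors by scalars z_i. All mixed
    products are non-zero, so z_i z_j^* = 1 for all i different from j, and with more than two
    indices this makes the z_i equal. *)
Lemma centralizer_scalar A B F F' l1 l2 l3 m1 m2 m3 Z : SU31 A -> SU31 B ->
  nullframe F -> eigdata A F l1 l2 l3 -> nullframe F' -> eigdata B F' m1 m2 m3 ->
  basis_pair F F' -> SU31 Z -> Z *m A = A *m Z -> Z *m B = B *m Z ->
  exists k, Z = k%:M.
Proof.
move=> hA hB nF hD nF' hD' [uP h12 h34 [h13 h14 h23 h24]] hZ cA cB.
have comm (T : M) v k : Z *m T = T *m Z -> T *m v = k *: v -> T *m (Z *m v) = k *: (Z *m v).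
  by move=> c e; rewrite mulmxA -c -mulmxA e -scalemxAr.
have [_ _ _ _ [ha hr _ _]] := hD; have [_ _ _ _ [ha' hr' _ _]] := hD'.
have [z1 e1] := eigdata_a_unique hA nF hD (comm _ _ _ cA ha).
have [z2 e2] := eigdata_r_unique hA nF hD (comm _ _ _ cA hr).
have [z3 e3] := eigdata_a_unique hB nF' hD' (comm _ _ _ cB ha').
have [z4 e4] := eigdata_r_unique hB nF' hD' (comm _ _ _ cB hr').
have k12 := isometry_eig hZ e1 e2 h12; have k13 := isometry_eig hZ e1 e3 h13.
have k14 := isometry_eig hZ e1 e4 h14; have k23 := isometry_eig hZ e2 e3 h23.
have k24 := isometry_eig hZ e2 e4 h24; have k34 := isometry_eig hZ e3 e4 h34.
have uq (a b c : C) : a * c^* = 1 -> b * c^* = 1 -> a = b.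
  move=> ac bc; have c0 : c^* != 0 by apply/eqP=> z; move/eqP: ac; rewrite z mulr0 eq_sym oner_eq0.
  by apply: (mulIf c0); rewrite ac bc.
have e13 : z3 = z1 := uq _ _ _ k34 k14; have e12 : z2 = z1 := uq _ _ _ k24 k14.
have k42 : z4 * z2^* = 1 by rewrite -conjC1 -k24 rmorphM /= conjCK mulrC.
have e14 : z4 = z1 := uq _ _ _ k42 k12.
exists z1; apply: (eq_on_basis uP) => j; rewrite mul_scalar_mx.
by case: (ord4P j) => ->; rewrite col_mx4 ?e1 ?e2 ?e3 ?e4 ?e12 ?e13 ?e14.
Qed.

(** Separability enters through l2 != l3: it forces [Z] to preserve the lines of x and y instead of
    mixing them, so that [Z] is diagonal in the columns of [Q]. *)
Lemma diagonalizes_commutant lab A Q Z : SU31 A -> diagonalizes lab A Q ->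
  separable_poly (char_poly A) -> SU31 Z -> Z *m A = A *m Z ->
  exists kp : C * R, [/\ is_angle (complex.Im kp.1), is_angle kp.2 &
    Z = cj Q (Emx kp.1 kp.2)].
Proof.
move=> hA [hQ [F [/eigenframeP[nF [l1 [l2 [l3 hD]]]] _] [s1 s2 s3 s4]] _] sep hZ cA.
have l23 : l2 != l3.
  move: sep; rewrite (eigdata_char_poly hA nF hD).
  rewrite (_ : _ * _ * _ * _ = \prod_(z <- [:: l1; l2; l3; (l1^*)^-1]) ('X - z%:P)); last first.
    by rewrite !big_cons big_nil mulr1 !mulrA.
  by rewrite separable_prod_XsubC /= !inE !negb_or => /andP[_ /andP[/andP[]]].
have comm v k : A *m v = k *: v -> A *m (Z *m v) = k *: (Z *m v).
  by move=> e; rewrite mulmxA -cA -mulmxA e -scalemxAr.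
have [n1 n2 n3 hd [ha hr hx hy]] := hD.
have [_ [c2 c3 l20 l30 _]] := eigdata_rel hD.
have [z1 e1] := eigdata_a_unique hA nF hD (comm _ _ ha).
have [z4 e4] := eigdata_r_unique hA nF hD (comm _ _ hr).
have oo v k : `|k| = 1 -> A *m v = k *: v -> herm v (fr_a F) = 0 /\ herm v (fr_r F) = 0.
  move=> k1 hv; split; apply: (isometry_orth hA hv).
  - exact: ha.
  - by apply/eqP=> /(congr1 Num.norm); rewrite normrM norm_conjC k1 mul1r normr1 => e; rewrite e ltxx in n1.
  - exact: hr.
  - apply/eqP=> /(congr1 Num.norm); rewrite normrM norm_conjC normfV norm_conjC k1 mul1r normr1.
    by move/eqP; rewrite invr_eq1 => /eqP e; rewrite e ltxx in n1.
have [_ _ [xx yy _]] := nF.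
have Zx : exists k, Z *m fr_x F = k *: fr_x F.
  exists (herm (Z *m fr_x F) (fr_x F)); have hv := comm _ _ hx; have [va vr] := oo _ _ n2 hv.
  rewrite {1}(eigdata_orth_ar hA nF hD va vr) (isometry_orth hA hv hy) ?scale0r ?addr0 // c3.
  by apply: contra l23 => /eqP e; rewrite -[l2](mulfVK l30) e mul1r.
have Zy : exists k, Z *m fr_y F = k *: fr_y F.
  exists (herm (Z *m fr_y F) (fr_y F)); have hv := comm _ _ hy; have [va vr] := oo _ _ n3 hv.
  rewrite {1}(eigdata_orth_ar hA nF hD va vr) (isometry_orth hA hv hx) ?scale0r ?add0r // c2.
  by apply: contra l23 => /eqP e; rewrite -[l3](mulfVK l20) e mul1r.
have [z2 e2] := Zx; have [z3 e3] := Zy.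
have m2 : `|z2| = 1 := isometry_unit_eig hZ xx e2.
have k14 := isometry_eig hZ e1 e4 (eigdata_ar nF hD).
have z10 : z1 != 0 by apply/eqP=> z; move/eqP: k14; rewrite z mul0r eq_sym oner_eq0.
have e4' : z4 = (z1^*)^-1.
  have z1c : z1^* != 0 by rewrite conjC_eq0.
  by apply: (mulfI z1c); rewrite mulfV // -conjC1 -k14 rmorphM /= conjCK.
have scaleE T (v w : V) k : same_point w v -> T *m v = k *: v -> T *m w = k *: w.
  by case=> c _ ->; move=> e; rewrite -scalemxAr e !scalerA mulrC.
have uQ := SU31_unit hQ.
have hZQ : Z *m Q = Q *m diag_mx (\row_j [:: z1; z2; z3; (z1^*)^-1]`_j).
  apply: mx4P => j.
  have -> : forall D, col j (Q *m diag_mx D) = D 0 j *: col j Q.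
    by move=> D; apply/matrixP=> i k; rewrite mul_mx_diag !mxE mulrC.
  rewrite colE -mulmxA -colE mxE.
  case: (ord4P j) => ->; rewrite inordK //= -?e4'.
  - exact: scaleE s1 e1.
  - exact: scaleE s2 e2.
  - exact: scaleE s3 e3.
  - exact: scaleE s4 e4.
have hd' : z1 * z2 * z3 = z1^*.
  have := congr1 determinant hZQ; rewrite !det_mulmx hZ.1 hQ.1 !mul1r det_diag prod4 !mxE !inordK //= => e.
  by apply: (mulIf (_ : (z1^*)^-1 != 0)); rewrite ?invr_eq0 ?conjC_eq0 // -e mulfV ?conjC_eq0.
have [l [phi [h1 h2 _ h4]]] := Emx_diag z10 m2 hd'.
by exists (l, phi); split=> //=; rewrite /cj h4 -hZQ mulmxK.
Qed.

Lemma cross_ratio_scale k1 k2 k3 k4 u v w z : k1 != 0 -> k2 != 0 -> k3 != 0 -> k4 != 0 ->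
  cross_ratio (k1 *: u) (k2 *: v) (k3 *: w) (k4 *: z) = cross_ratio u v w z.
Proof.
move=> h1 h2 h3 h4; rewrite /cross_ratio !hermE.
have hK : k1^* * k2^* * k3 * k4 != 0 by rewrite !mulf_neq0 ?conjC_eq0.
rewrite [X in X / _](_ : _ = (k1^* * k2^* * k3 * k4) * (herm w u * herm z v)); last by ring.
rewrite [X in _ / X](_ : _ = (k1^* * k2^* * k3 * k4) * (herm z u * herm w v)); last by ring.
by rewrite -mulf_div divff ?mul1r.
Qed.

Lemma cross_ratio_same u v w z u' v' w' z' : same_point u u' -> same_point v v' ->
  same_point w w' -> same_point z z' -> cross_ratio u v w z = cross_ratio u' v' w' z'.
Proof. by move=> [k1 h1 ->] [k2 h2 ->] [k3 h3 ->] [k4 h4 ->]; apply: cross_ratio_scale. Qed.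

Lemma cross_ratio_SU31 g u v w z : SU31 g ->
  cross_ratio (g *m u) (g *m v) (g *m w) (g *m z) = cross_ratio u v w z.
Proof. by move=> [_ hg]; rewrite /cross_ratio !hg. Qed.

(** On the plane orthogonal to a and r, the products with b and s are coordinates. The cross-ratio
    is their quotient up to a factor independent of z, so it determines the point of the projective
    line. *)
Lemma prop_of_ratio a r b s z z' : herm a z = 0 -> herm r z = 0 -> herm a z' = 0 -> herm r z' = 0 ->
  (forall q, herm a q = 0 -> herm r q = 0 -> herm b q = 0 -> herm s q = 0 -> q = 0) ->
  cross_ratio s b z a = cross_ratio s b z' a -> cross_ratio s b z a != 0 ->
  same_point z z'.
Proof.
move=> az rz az' rz' hq e n0; have n0' := n0; rewrite e in n0'.
move: n0 n0' e; rewrite /cross_ratio !mulf_eq0 !invr_eq0 !mulf_eq0 !negb_or.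
move=> /andP[/andP[zs ab] /andP[as' zb]] /andP[/andP[z's _] /andP[_ z'b]].
move=> e; have e' : herm z s * herm z' b = herm z' s * herm z b.
  move: e => /eqP; rewrite eqr_div ?mulf_neq0 // => /eqP e.
  by apply: (mulIf (mulf_neq0 ab as')); transitivity (herm z s * herm a b * (herm a s * herm z' b)); [ring | rewrite e; ring].
exists (herm z b / herm z' b); first by rewrite mulf_neq0 ?invr_eq0.
apply/eqP; rewrite -subr_eq0; apply/eqP/hq.
- by rewrite !hermE az az' mulr0 subr0.
- by rewrite !hermE rz rz' mulr0 subr0.
- by apply: herm0C; rewrite !hermE divfK ?subrr.
- by apply: herm0C; rewrite !hermE; apply: (mulIf z'b); rewrite mulrBl mul0r mulrAC divfK // e' mulrC subrr.
Qed.

(** Let q be the component of w orthogonal to u and v. Then T + T^* equals minus |<u, v>|^2 times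
    <q, q>, and q is either positive or zero. *)
Lemma triple_real_part u v w : null u -> null v -> null w -> herm u v != 0 ->
  let T := herm u v * herm v w * herm w u in
  T + T^* <= 0 /\ (T + T^* = 0 -> exists al be, w = al *: u + be *: v).
Proof.
move=> nu nv nw uv T; have vu : herm v u != 0 by rewrite -hermC conjC_eq0.
pose q := w - (herm w v / herm u v) *: u - (herm w u / herm v u) *: v.
have qu : herm q u = 0 by rewrite !hermE nu.2 mulr0 subr0 divfK // subrr.
have qv : herm q v = 0 by rewrite !hermE nv.2 mulr0 subr0 divfK // subrr.
have eT : - (T + T^*) = `|herm u v| ^+ 2 * herm q q.
  have -> : herm q q = herm q w by rewrite {2}/q !hermBr !hermZr qu qv !mulr0 !subr0.
  rewrite normCK hermC /q !hermE nw.2 /T !rmorphM /= !hermC.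
  by field; rewrite uv vu.
have n2 : 0 < `|herm u v| ^+ 2 by rewrite exprn_gt0 ?normr_gt0.
have [q0|q0] := eqVneq q 0.
  split=> [|_]; first by rewrite -oppr_ge0 eT q0 herm0l mulr0.
  exists (herm w v / herm u v), (herm w u / herm v u).
  by apply/eqP; rewrite -subr_eq0 opprD addrA; apply/eqP.
have qq := orth_pair_pos nu.2 nv.2 uv (herm0C qu) (herm0C qv) q0.
split; first by rewrite -oppr_ge0 eT mulr_ge0 // ltW.
move=> T0; exfalso; move: eT; rewrite T0 oppr0 => /esym/eqP.
by rewrite mulf_eq0 !gt_eqF.
Qed.

(** The normalized entries [w i j] change under rescaling of the vectors only by the common factor
    |d_1|^-2. The cross-ratios are quotients of them, so that w = t w' with a single t. It remains
    to see that t is real and positive and to take |d_1|^2 = t. *)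
Lemma gram_match (p p' : 'I_4 -> V) :
  (forall i, null (p i)) -> (forall i, null (p' i)) ->
  (forall i j, i != j -> herm (p i) (p j) != 0) ->
  (forall i j, i != j -> herm (p' i) (p' j) != 0) ->
  (forall q, (forall i, herm (p' i) q = 0) -> q = 0) ->
  (forall q, (forall i, herm (p i) q = 0) -> q = 0) ->
  let X1 (p : 'I_4 -> V) := cross_ratio (p ix3) (p ix1) (p ix2) (p ix4) in
  let X2 (p : 'I_4 -> V) := cross_ratio (p ix3) (p ix2) (p ix1) (p ix4) in
  let X3 (p : 'I_4 -> V) := cross_ratio (p ix1) (p ix2) (p ix3) (p ix4) in
  X1 p = X1 p' -> X2 p = X2 p' -> X3 p = X3 p' ->
  exists d : 'I_4 -> C, (forall i, d i != 0) /\
    forall i j, herm (d i *: p i) (d j *: p j) = herm (p' i) (p' j).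
Proof.
move=> np np' g0 h0 bas' bas X1 X2 X3; rewrite /X1 /X2 /X3 /cross_ratio => {X1 X2 X3} e1 e2 e3.
pose g i j := herm (p i) (p j); pose h i j := herm (p' i) (p' j).
have gC i j : g j i = (g i j)^* by rewrite /g hermC.
have hC i j : h j i = (h i j)^* by rewrite /h hermC.
pose w i j := g i j / (g i ix1 * g ix1 j); pose w' i j := h i j / (h i ix1 * h ix1 j).
have g1 i : i != ix1 -> g ix1 i != 0 by move=> ?; rewrite g0 // eq_sym.
have g1' i : i != ix1 -> g i ix1 != 0 by exact: g0.
have h1 i : i != ix1 -> h ix1 i != 0 by move=> ?; rewrite h0 // eq_sym.
have h1' i : i != ix1 -> h i ix1 != 0 by exact: h0.
have wC i j : w j i = (w i j)^*.
  by rewrite /w fmorph_div rmorphM /= -!gC mulrC [g j ix1 * _]mulrC mulrC.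
have wC' i j : w' j i = (w' i j)^*.
  by rewrite /w' fmorph_div rmorphM /= -!hC mulrC [h j ix1 * _]mulrC mulrC.
have wn i j : i != ix1 -> j != ix1 -> i != j -> w i j != 0.
  by move=> i1 j1 ij; rewrite /w mulf_neq0 ?invr_eq0 ?mulf_neq0 ?g1 ?g1' ?g0.
have wn' i j : i != ix1 -> j != ix1 -> i != j -> w' i j != 0.
  by move=> i1 j1 ij; rewrite /w' mulf_neq0 ?invr_eq0 ?mulf_neq0 ?h1 ?h1' ?h0.
have E1 : w ix2 ix3 / w ix4 ix3 = w' ix2 ix3 / w' ix4 ix3.
  transitivity (g ix2 ix3 * g ix4 ix1 / (g ix4 ix3 * g ix2 ix1)).
    by rewrite /w; field; rewrite !(g1, g1', g0) ?ix_neq.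
  by rewrite [LHS]e1 /w' -/(h _ _) -/(h _ _) -/(h _ _) -/(h _ _); field; rewrite !(h1, h1', h0) ?ix_neq.
have E2 : w ix4 ix2 / w ix4 ix3 = w' ix4 ix2 / w' ix4 ix3.
  transitivity (g ix1 ix3 * g ix4 ix2 / (g ix4 ix3 * g ix1 ix2)).
    by rewrite /w; field; rewrite !(g1, g1', g0) ?ix_neq.
  by rewrite [LHS]e2 /w' -/(h _ _) -/(h _ _) -/(h _ _) -/(h _ _); field; rewrite !(h1, h1', h0) ?ix_neq.
have E3 : w ix4 ix2 / w ix3 ix2 = w' ix4 ix2 / w' ix3 ix2.
  transitivity (g ix3 ix1 * g ix4 ix2 / (g ix4 ix1 * g ix3 ix2)).
    by rewrite /w; field; rewrite !(g1, g1', g0) ?ix_neq.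
  by rewrite [LHS]e3 /w' -/(h _ _) -/(h _ _) -/(h _ _) -/(h _ _); field; rewrite !(h1, h1', h0) ?ix_neq.
pose t := w ix4 ix3 / w' ix4 ix3.
have n43 := wn ix4 ix3; have n43' := wn' ix4 ix3; have n23' := wn' ix2 ix3; have n42' := wn' ix4 ix2.
have n32 := wn ix3 ix2; have n32' := wn' ix3 ix2.
rewrite !ix_neq in n43 n43' n23' n42' n32 n32'.
have {}n43 := n43 isT isT isT; have {}n43' := n43' isT isT isT; have {}n23' := n23' isT isT isT.
have {}n42' := n42' isT isT isT; have {}n32' := n32' isT isT isT; have {}n32 := n32 isT isT isT.
have t0 : t != 0 by rewrite mulf_neq0 ?invr_eq0.
have w43 : w ix4 ix3 = t * w' ix4 ix3 by rewrite divfK.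
have w23 : w ix2 ix3 = t * w' ix2 ix3.
  by rewrite -[w ix2 ix3](divfK n43) E1 w43; field.
have w42 : w ix4 ix2 = t * w' ix4 ix2.
  by rewrite -[w ix4 ix2](divfK n43) E2 w43; field.
(* The entry (3, 2) is computed twice, from the third cross-ratio and as the conjugate of the entry
   (2, 3). *)
have treal : t^* = t.
  have w32 : w ix3 ix2 = t * w' ix3 ix2.
    have -> : w ix3 ix2 = w ix4 ix2 * w' ix3 ix2 / w' ix4 ix2.
      apply: (mulIf n42'); rewrite divfK //.
      by move: E3 => /eqP; rewrite eqr_div // => /eqP ->; rewrite mulrC.
    by rewrite w42; field.
  have : w ix3 ix2 = t^* * w' ix3 ix2 by rewrite wC w23 rmorphM /= -wC'.
  by rewrite w32 => /(mulIf n32').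
have tr3 (s : 'I_4 -> V) (ns : forall i, null (s i)) (ns0 : forall i j, i != j -> herm (s i) (s j) != 0) i j :
    i != ix1 -> j != ix1 -> i != j ->
    let z := herm (s i) (s j) / (herm (s i) (s ix1) * herm (s ix1) (s j)) in
    z + z^* <= 0 /\ (z + z^* = 0 -> exists al be, s j = al *: s ix1 + be *: s i).
  move=> i1 j1 ij z; have n1i : herm (s ix1) (s i) != 0 by rewrite ns0 // eq_sym.
  have n1j : herm (s ix1) (s j) != 0 by rewrite ns0 // eq_sym.
  have [h1T h2T] := triple_real_part (ns ix1) (ns i) (ns j) n1i.
  have k0 : 0 < `|herm (s ix1) (s i)| ^+ 2 * `|herm (s ix1) (s j)| ^+ 2.
    by rewrite mulr_gt0 ?exprn_gt0 ?normr_gt0.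
  have eT : herm (s ix1) (s i) * herm (s i) (s j) * herm (s j) (s ix1)
    = `|herm (s ix1) (s i)| ^+ 2 * `|herm (s ix1) (s j)| ^+ 2 * z.
    by rewrite !normCK !hermC /z; field; rewrite n1j ns0.
  have kr : (`|herm (s ix1) (s i)| ^+ 2 * `|herm (s ix1) (s j)| ^+ 2)^*
    = `|herm (s ix1) (s i)| ^+ 2 * `|herm (s ix1) (s j)| ^+ 2.
    by apply/CrealP; rewrite realM ?realX ?normr_real.
  move: h1T h2T; rewrite eT rmorphM /= kr -mulrDr pmulr_rle0 // => h1T h2T.
  by split=> // z0; apply: h2T; rewrite z0 mulr0.
have tpos : 0 < t.
  have tR : t \is Num.real by apply/CrealP.
  rewrite real_ltNge ?real0 //; apply/negP=> tneg.
  have tneg' : t < 0 by rewrite lt_neqAle t0.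
  (* If t were negative, the sign condition of [triple_real_part] for p and for p' would be
     opposite, hence an equality. This puts p_3 and p_4 in the span of p_1 and p_2, and the four
     vectors could not form a basis. *)
  have key i j : i != ix1 -> j != ix1 -> i != j -> w i j = t * w' i j ->
      exists al be, p j = al *: p ix1 + be *: p i.
    move=> i1 j1 ij e; have [_ ] := tr3 p np g0 i j i1 j1 ij; apply.
    have [h1T _] := tr3 p np g0 i j i1 j1 ij; have [h2T _] := tr3 p' np' h0 i j i1 j1 ij.
    apply/le_anti; rewrite h1T /= -/(w i j) e rmorphM /= treal -mulrDr.
    by rewrite nmulr_rge0.
  have w24 : w ix2 ix4 = t * w' ix2 ix4 by rewrite wC w42 rmorphM /= treal -wC'.
  have [al [be e3p]] := key ix2 ix3 ltac:(by rewrite ix_neq) ltac:(by rewrite ix_neq) ltac:(by rewrite ix_neq) w23.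
  have [ga [de e4p]] := key ix2 ix4 ltac:(by rewrite ix_neq) ltac:(by rewrite ix_neq) ltac:(by rewrite ix_neq) w24.
  have [q [q0 q1 q2 _]] := exists_orth (p ix1) (p ix2) 0.
  move/eqP: q0; apply; apply: bas => i.
  by case: (ord4P i) => -> //; rewrite ?e3p ?e4p !hermE q1 q2 !mulr0 addr0.
pose s := sqrtC t; have ss : s * s = t by rewrite -expr2 sqrtCK.
have s_gt0 : 0 < s by rewrite sqrtC_gt0.
have sC : s^* = s by apply/CrealP/ger0_real/ltW.
have s0 : s != 0 by rewrite gt_eqF.
(* Once d_1 = sqrt t is chosen real, the other factors are forced by the products with the first
   vector. *)
pose d i : C := if i == ix1 then s else (h i ix1) / (s * g i ix1).
have d1 : d ix1 = s by rewrite /d eqxx.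
have dn i : i != ix1 -> d i = (h i ix1) / (s * g i ix1) by move=> i1; rewrite /d (negPf i1).
exists d; split=> [i|i j].
  have [->|i1] := eqVneq i ix1; first by rewrite d1.
  rewrite dn //; apply: mulf_neq0; first exact: h1'.
  by rewrite invr_eq0; apply: mulf_neq0; [exact: s0 | exact: g1'].
rewrite hermZl hermZr mulrA -/(g _ _) -/(h _ _).
have E1j (k : 'I_4) : k != ix1 -> d k * (d ix1)^* * g k ix1 = h k ix1.
  by move=> k1; rewrite d1 dn // sC; field; rewrite s0 g1'.
have Eij (k l : 'I_4) : k != ix1 -> l != ix1 -> k != l -> w k l = t * w' k l -> d k * (d l)^* * g k l = h k l.
  move=> k1 l1 kl; rewrite /w /w' => e; rewrite !dn //.
  have -> : (h l ix1 / (s * g l ix1))^* = h ix1 l / (s * g ix1 l).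
    by rewrite fmorph_div rmorphM /= sC -gC -hC.
  have -> : g k l = g k l / (g k ix1 * g ix1 l) * (g k ix1 * g ix1 l).
    by rewrite divfK // mulf_neq0 ?g1 ?g1'.
  by rewrite e -ss; field; rewrite s0 !(g1, g1', h1, h1').
have Esym (k l : 'I_4) : d k * (d l)^* * g k l = h k l -> d l * (d k)^* * g l k = h l k.
  move=> e; have := congr1 Num.conj e; rewrite !rmorphM /= conjCK -gC -hC => <-; ring.
have E43 := Eij ix4 ix3 ltac:(by rewrite ix_neq) ltac:(by rewrite ix_neq) ltac:(by rewrite ix_neq) w43.
have E42 := Eij ix4 ix2 ltac:(by rewrite ix_neq) ltac:(by rewrite ix_neq) ltac:(by rewrite ix_neq) w42.
have E23 := Eij ix2 ix3 ltac:(by rewrite ix_neq) ltac:(by rewrite ix_neq) ltac:(by rewrite ix_neq) w23.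
have E21 := E1j ix2 ltac:(by rewrite ix_neq); have E31 := E1j ix3 ltac:(by rewrite ix_neq); have E41 := E1j ix4 ltac:(by rewrite ix_neq).
have Ed (k : 'I_4) : d k * (d k)^* * g k k = h k k by rewrite /g /h (np k).2 (np' k).2 mulr0.
by case: (ord4P i) => ->; case: (ord4P j) => ->; (exact: Ed || done || exact: Esym).
Qed.
End Pieces.

(** * A non-singular pair and its coordinates *)

Section PieceTheorem.
Variable R : realType.
Notation C := R[i].
Notation V := 'cV[C]_4.
Notation M := 'M[C]_4.
Implicit Types (A B g h P Q Z : M) (a x y r u v w z n q : V) (k l : C) (F : frame R).

(** The remaining eigenvector is forced up to a scalar by orthogonality to the other three. *)
Lemma frames_agree_x A B F F' l1 l2 l3 : SU31 A -> SU31 B ->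
  nullframe F -> nullframe F' -> eigdata A F l1 l2 l3 -> eigdata B F' l1 l2 l3 ->
  same_point (fr_a F) (fr_a F') -> same_point (fr_r F) (fr_r F') ->
  same_point (fr_x F) (fr_x F') -> A = B.
Proof.
move=> hA hB nF nF' hD hD' sa sr sx.
have [_ _ [xx yy xy]] := nF.
have [ax ay rx ry] := eigdata_orth hA hD.
have sy : same_point (fr_y F) (fr_y F').
  have [k k0 ea] := sa; have [l l0 er] := sr; have [m m0 ex] := sx.
  have inj (c : C) u v w : c != 0 -> u = c *: v -> herm u w = 0 -> herm w v = 0.
    move=> c0 e h; apply: herm0C; apply/eqP; move/eqP: h.
    by rewrite e hermZl mulf_eq0 (negPf c0).
  have ya' := inj _ _ _ _ k0 ea ay; have yr' := inj _ _ _ _ l0 er ry.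
  have yx' := inj _ _ _ _ m0 ex xy.
  have e := eigdata_orth_ar hB nF' hD' ya' yr'; rewrite yx' scale0r add0r in e.
  exists (herm (fr_y F) (fr_y F')) => //; apply/eqP=> z; rewrite z scale0r in e.
  by move/eqP: yy; rewrite e herm0l eq_sym oner_eq0.
have [_ _ _ _ [ha hr hx hy]] := hD; have [_ _ _ _ [ha' hr' hx' hy']] := hD'.
have scaleE T (v w : V) k : same_point v w -> T *m v = k *: v -> T *m w = k *: w.
  by move=> /same_point_sym [c _ ->]; move=> e; rewrite -scalemxAr e !scalerA mulrC.
apply: (eq_on_basis (eigdata_basis hB nF' hD')) => j.
case: (ord4P j) => ->; rewrite !col_mx4.
- by rewrite ha' (scaleE _ _ _ _ sa ha).
- by rewrite hx' (scaleE _ _ _ _ sx hx).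
- by rewrite hy' (scaleE _ _ _ _ sy hy).
- by rewrite hr' (scaleE _ _ _ _ sr hr).
Qed.

Lemma frames_agree (b : bool) A B F F' l1 l2 l3 : SU31 A -> SU31 B ->
  nullframe F -> nullframe F' -> eigdata A F l1 l2 l3 -> eigdata B F' l1 l2 l3 ->
  same_point (fr_a F) (fr_a F') -> same_point (fr_r F) (fr_r F') ->
  same_point (if b then fr_y F else fr_x F) (if b then fr_y F' else fr_x F') -> A = B.
Proof.
move=> hA hB nF nF' hD hD' sa sr; case: b => sx; last first.
  exact: (frames_agree_x hA hB nF nF' hD hD').
have [nG hG] := swap_eigdata nF hD; have [nG' hG'] := swap_eigdata nF' hD'.
exact: (frames_agree_x hA hB nG nG' hG hG').
Qed.

Lemma basis_pair_null_gram F F' G G' : nullframe F -> nullframe F' ->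
  nullframe G -> nullframe G' -> basis_pair F F' -> basis_pair G G' ->
  X_inv F F' = X_inv G G' ->
  exists g, [/\ SU31 g, same_point (g *m fr_a F) (fr_a G), same_point (g *m fr_r F) (fr_r G),
    same_point (g *m fr_a F') (fr_a G') & same_point (g *m fr_r F') (fr_r G')].
Proof.
move=> [na nr _] [na' nr' _] [ma mr _] [ma' mr' _] bF bG eX.
pose P := mx4 (fr_a F) (fr_r F) (fr_a F') (fr_r F').
pose P' := mx4 (fr_a G) (fr_r G) (fr_a G') (fr_r G').
have neq (F1 F2 : frame R) : basis_pair F1 F2 -> forall i j, i != j ->
    herm (col i (mx4 (fr_a F1) (fr_r F1) (fr_a F2) (fr_r F2)))
      (col j (mx4 (fr_a F1) (fr_r F1) (fr_a F2) (fr_r F2))) != 0.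
  move=> [_ h12 h34 [h13 h14 h23 h24]].
  have cj0 (u v : V) : herm u v != 0 -> herm v u != 0 by rewrite -[herm v u]hermC conjC_eq0.
  move=> i j; case: (ord4P i) => ->; case: (ord4P j) => ->; rewrite ?eqxx // => _;
    rewrite !col_mx4 //; exact: cj0.
have uP : P \in unitmx by case: bF. have uP' : P' \in unitmx by case: bG.
have [|||||||||d [d0 hd]] := @gram_match R (fun i => col i P) (fun i => col i P').
- by move=> i; case: (ord4P i) => ->; rewrite col_mx4.
- by move=> i; case: (ord4P i) => ->; rewrite col_mx4.
- exact: neq.
- exact: neq.
- by move=> q hq; apply: (orth_basis0 uP').
- by move=> q hq; apply: (orth_basis0 uP).
- by rewrite !col_mx4; case: eX.
- by rewrite !col_mx4; case: eX.
- by rewrite !col_mx4; case: eX.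
pose P0 : M := mx4 (d ix1 *: fr_a F) (d ix2 *: fr_r F) (d ix3 *: fr_a F') (d ix4 *: fr_r F').
have cP0 i : col i P0 = d i *: col i P by case: (ord4P i) => ->; rewrite !col_mx4.
have gP : gram P0 P0 = gram P' P' by apply/matrixP=> i j; rewrite !gramE !cP0 hd.
have uP0 : P0 \in unitmx.
  by apply: (@gram_unit _ _ P0); rewrite gP !unitmx_mul unitmx_tr uP' Jm_unit map_unitmx uP'.
have [g [s [hg ss e]]] := isometry_of_gram uP0 gP.
have s0 : s != 0 by apply/eqP=> z; move/eqP: ss; rewrite z mul0r eq_sym oner_eq0.
have key i : same_point (g *m col i P) (col i P').
  exists ((d i)^-1 * s); first by rewrite mulf_neq0 ?invr_eq0.
  have := congr1 (fun T : M => col i T) e.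
  rewrite colE -mulmxA -colE cP0 -scalemxAr => e1.
  rewrite -scalerA -[g *m _]scale1r -(mulVf (d0 i)) -scalerA e1.
  by rewrite colE -scalemxAl -colE.
by exists g; split=> //; [have := key ix1|have := key ix2|have := key ix3|have := key ix4]; rewrite !col_mx4.
Qed.

Lemma piece_conj2 lab (p p' : M * M) c : nonsingular p.1 p.2 -> nonsingular p'.1 p'.2 ->
  piece_coord_of lab p c -> piece_coord_of lab p' c -> conj2 p p'.
Proof.
case: p p' => [A B] [A' B'] /= ns ns' [/= [tA tB] [sA sB] [al0 be0] [FA [FB [lA lB eX eal ebe]]]].
move=> [/= [tA' tB'] [sA' sB'] _ [FA' [FB' [lA' lB' eX' eal' ebe']]]].
have [[xA xB] _ _ _] := ns; have [[xA' xB'] _ _ _] := ns'.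
have [nA nA' [l1 [l2 [l3 [dA dA']]]]] :=
  labelled_same_data xA xA' (etrans tA (esym tA')) (etrans sA (esym sA')) lA lA'.
have [nB nB' [m1 [m2 [m3 [dB dB']]]]] :=
  labelled_same_data xB xB' (etrans tB (esym tB')) (etrans sB (esym sB')) lB lB'.
have bF := nonsingular_basis ns nA dA nB dB.
have bF' := nonsingular_basis ns' nA' dA' nB' dB'.
have [g [hg sa sr sa' sr']] := basis_pair_null_gram nA nB nA' nB' bF bF' (etrans eX (esym eX')).
have [hA _ _] := xA; have [hB _ _] := xB; have [hA' _ _] := xA'; have [hB' _ _] := xB'.
have [nA1 dA1] := eigdata_push hg nA dA; have [nB1 dB1] := eigdata_push hg nB dB.
have refl (u : V) : same_point u u by exists 1; rewrite ?oner_eq0 ?scale1r.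
have orthz (b : bool) (F : frame R) A0 k1 k2 k3 : SU31 A0 -> eigdata A0 F k1 k2 k3 ->
    herm (fr_a F) (if b then fr_y F else fr_x F) = 0 /\
    herm (fr_r F) (if b then fr_y F else fr_x F) = 0.
  by move=> h /(eigdata_orth h) [? ? ? ?]; case: b.
have orths (u v w : V) : same_point u v -> herm u w = 0 -> herm v w = 0.
  by move=> /same_point_sym [k _ ->] h; rewrite hermZl h mulr0.
have pushz (b : bool) F : (if b then fr_y (push g F) else fr_x (push g F))
    = g *m (if b then fr_y F else fr_x F) by case: b.
(* After moving by [g] the fixed points of both pairs agree. The beta-invariant then locates one
   positive eigenvector of the first element, the alpha-invariant one of the second. *)
exists g => //=; split; apply/esym.
  apply: (@frames_agree (pc_bkind c) _ _ _ _ _ _ _ (SU31_cj hg hA) hA' nA1 nA' dA1 dA') => //.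
  have [ho1 ho2] := orthz (pc_bkind c) _ _ _ _ _ (SU31_cj hg hA) dA1.
  have [ho3 ho4] := orthz (pc_bkind c) _ _ _ _ _ hA' dA'.
  have e : cross_ratio (fr_r FB') (fr_a FB') (if pc_bkind c then fr_y (push g FA) else fr_x (push g FA)) (fr_a FA')
      = pc_beta c.
    rewrite -ebe /beta_inv -[RHS](cross_ratio_SU31 _ _ _ _ hg) pushz.
    by apply: cross_ratio_same => //; apply: same_point_sym.
  apply: (@prop_of_ratio _ (fr_a FA') (fr_r FA') (fr_a FB') (fr_r FB')) => //.
  - exact: orths sa ho1.
  - exact: orths sr ho2.
  - by move=> q *; apply: (basis_pair_orth bF').
  - by rewrite e -ebe'.
  - by rewrite e.
apply: (@frames_agree (pc_akind c) _ _ _ _ _ _ _ (SU31_cj hg hB) hB' nB1 nB' dB1 dB') => //.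
have [ho1 ho2] := orthz (pc_akind c) _ _ _ _ _ (SU31_cj hg hB) dB1.
have [ho3 ho4] := orthz (pc_akind c) _ _ _ _ _ hB' dB'.
have e : cross_ratio (fr_r FA') (fr_a FA') (if pc_akind c then fr_y (push g FB) else fr_x (push g FB)) (fr_a FB')
    = pc_alpha c.
  rewrite -eal /alpha_inv -[RHS](cross_ratio_SU31 _ _ _ _ hg) pushz.
  by apply: cross_ratio_same => //; apply: same_point_sym.
apply: (@prop_of_ratio _ (fr_a FB') (fr_r FB') (fr_a FA') (fr_r FA')) => //.
- exact: orths sa' ho1.
- exact: orths sr' ho2.
- by move=> q *; apply: (basis_pair_orth bF').
- by rewrite e -eal'.
- by rewrite e.
Qed.

Lemma piece_coord_cj lab g (p : M * M) c : SU31 g -> piece_coord_of lab p c ->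
  piece_coord_of lab (cj g p.1, cj g p.2) c.
Proof.
move=> hg [tr sg nz [FA [FB [lA lB eX eal ebe]]]]; split=> //=.
- by rewrite !trace_cj.
- by rewrite !sigma_cj.
exists (push g FA), (push g FB); split=> //.
- exact: labelled_push.
- exact: labelled_push.
- by rewrite -eX /X_inv /= !cross_ratio_SU31.
- by rewrite -eal /alpha_inv /=; case: ifP => _; rewrite cross_ratio_SU31.
- by rewrite -ebe /beta_inv /=; case: ifP => _; rewrite cross_ratio_SU31.
Qed.

Lemma ratio_neq0 a r b z : herm a b != 0 -> herm r b != 0 ->
  herm a z != 0 -> herm r z != 0 -> cross_ratio r a z b != 0.
Proof.
move=> ab rb az rz; rewrite /cross_ratio -(hermC a z) -(hermC r z) -(hermC a b) -(hermC r b).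
by rewrite mulf_neq0 ?invr_eq0 ?mulf_neq0 ?conjC_eq0.
Qed.

(** The frames provided by non-singularity need not be labelled. Exchanging x and y makes them so,
    and the boolean kind of the invariant records which of the two polar chains avoids the fixed
    points. *)
Lemma piece_coord_exists lab (hlab : labelling lab) (p : M * M) : nonsingular p.1 p.2 ->
  exists c, piece_coord_of lab p c.
Proof.
move=> ns; have [[lA lB] hcom _ [FA [FB [eA eB dA dB]]]] := ns.
have [GA [hGA zA]] : exists GA, labelled lab p.1 GA /\
    exists k : bool, fixpoints p.2 `&` polar_chain (if k then fr_y GA else fr_x GA) = set0.
  case: (labelled_or_swap hlab lA eA) => h; [exists FA|exists (swap_xy FA)]; split=> //;
    case: dB => d; by [exists false|exists true].
have [GB [hGB zB]] : exists GB, labelled lab p.2 GB /\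
    exists k : bool, fixpoints p.1 `&` polar_chain (if k then fr_y GB else fr_x GB) = set0.
  case: (labelled_or_swap hlab lB eB) => h; [exists FB|exists (swap_xy FB)]; split=> //;
    case: dA => d; by [exists false|exists true].
have [kb hb] := zA; have [ka ha] := zB.
have [/eigenframeP[nA [l1 [l2 [l3 dA']]]] _] := hGA.
have [/eigenframeP[nB [m1 [m2 [m3 dB']]]] _] := hGB.
have [_ _ _ [h13 h14 h23 h24]] := nonsingular_basis ns nA dA' nB dB'.
have [hA _ _] := lA; have [hB _ _] := lB.
have off T v z : fixpoints T `&` polar_chain z = set0 -> fixpoints T v -> herm v z != 0.
  move=> e fv; apply/eqP=> vz; have : (fixpoints T `&` polar_chain z) v.
    by split=> //; split=> //; case: fv.
  by rewrite e.
have refl (u : V) : same_point u u by exists 1; rewrite ?oner_eq0 ?scale1r.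
have fA v : v = fr_a GA \/ v = fr_r GA -> fixpoints p.1 v.
  by move=> h; apply/(eigdata_fixpoints hA nA dA'); case: h => ->; [left|right].
have fB v : v = fr_a GB \/ v = fr_r GB -> fixpoints p.2 v.
  by move=> h; apply/(eigdata_fixpoints hB nB dB'); case: h => ->; [left|right].
have [na nr _] := nA; have [na' nr' _] := nB.
exists (@PieceCoord R (\tr p.1) (\tr p.2) (complex.Re (sigma p.1)) (complex.Re (sigma p.2))
  (X_inv GA GB) ka (alpha_inv ka GA GB) kb (beta_inv kb GA GB)); split=> //=.
- by rewrite !sigmaRe.
- split; apply: ratio_neq0 => //.
  + by apply: (off _ _ _ ha); apply: fA; left.
  + by apply: (off _ _ _ ha); apply: fA; right.
  + by rewrite -hermC conjC_eq0.
  + by rewrite -hermC conjC_eq0.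
  + by apply: (off _ _ _ hb); apply: fB; left.
  + by apply: (off _ _ _ hb); apply: fB; right.
by exists GA, GB.
Qed.
End PieceTheorem.

(** * The cross-ratio variety and the count of parameters *)

Section Variety.
Variable R : realType.
Notation C := R[i].
Notation V := 'cV[C]_4.
Notation M := 'M[C]_4.
Implicit Types (A B g h P Q Z : M) (u v w z : V) (k l : C) (F : frame R).

Lemma variety_norm (t : C * C * C) : cross_ratio_variety t ->
  `|t.1.2| = `|t.1.1| * `|t.2|.
Proof.
case=> A [B [FA [FB [lA lB hcom [/eigenframeP[nA [l1 [l2 [l3 dA]]]] /eigenframeP[nB [m1 [m2 [m3 dB]]]]] ->]]]].
have [fa fr _ _] := eigdata_fixes dA; have [fa' fr' _ _] := eigdata_fixes dB.
have [na nr _] := nA; have [na' nr' _] := nB.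
have h13 := no_common_distinct hcom fa fa' na na'.
have h14 := no_common_distinct hcom fa fr' na nr'.
have h23 := no_common_distinct hcom fr fa' nr na'.
have nC u v : `|herm u v| = `|herm v u| by rewrite -hermC norm_conjC.
rewrite /X_inv /cross_ratio /= !(normrM, normfV) !invfM.
rewrite (nC (fr_a FB) (fr_a FA)) (nC (fr_r FB) (fr_a FA)) (nC (fr_r FB) (fr_r FA))
  (nC (fr_r FA) (fr_a FA)) (nC (fr_a FB) (fr_r FA)) (nC (fr_r FB) (fr_a FB)).
have aux (a b c d e f : C) : c != 0 -> d != 0 -> e != 0 -> f != 0 ->
    a * b * (c^-1 / d) = e * f * (c^-1 / d) * (a * b * (f^-1 / e)).
  by move=> c0 d0 e0 f0; field; rewrite c0 d0 e0 f0.
by apply: aux; rewrite normr_eq0 // ?(eigdata_ar nA dA) ?(eigdata_ar nB dB).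
Qed.

Lemma arg_norm_inj (z z' : C) : `|z| = `|z'| -> arg z = arg z' -> z = z'.
Proof.
by move=> n a; have [_ ->] := argP z; have [_ ->] := argP z'; rewrite n a.
Qed.

Lemma complexP (z z' : C) : complex.Re z = complex.Re z' -> complex.Im z = complex.Im z' ->
  z = z'.
Proof. by case: z => a b; case: z' => c d /= -> ->. Qed.

(** The argument of X2 is enough to recover X2, because [variety_norm] gives its modulus from X1 and
    X3. *)
Lemma real_coord_inj (m : nat) (c c' : fn_coord R m) : admissible c -> admissible c' ->
  same_kinds c c' -> (forall i, real_coord c i = real_coord c' i) -> c = c'.
Proof.
move=> hc hc' hk h.
have hp : fn_piece c = fn_piece c'.
  apply: functional_extensionality_dep => v.
  have [ka kb] := hk v; have := hc v; have := hc' v.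
  have trA : pc_trA (fn_piece c v) = pc_trA (fn_piece c' v).
    by apply: complexP; [exact: (h (inl (inl (inl (inl (inl (v, false, false)))))))
      | exact: (h (inl (inl (inl (inl (inl (v, false, true)))))))].
  have trB : pc_trB (fn_piece c v) = pc_trB (fn_piece c' v).
    by apply: complexP; [exact: (h (inl (inl (inl (inl (inl (v, true, false)))))))
      | exact: (h (inl (inl (inl (inl (inl (v, true, true)))))))].
  have sA := h (inl (inl (inl (inl (inr (v, false)))))).
  have sB := h (inl (inl (inl (inl (inr (v, true)))))).
  have al : pc_alpha (fn_piece c v) = pc_alpha (fn_piece c' v).
    by apply: complexP; [exact: (h (inl (inl (inr (v, false))))) | exact: (h (inl (inl (inr (v, true)))))].
  have be : pc_beta (fn_piece c v) = pc_beta (fn_piece c' v).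
    by apply: complexP; [exact: (h (inl (inr (v, false)))) | exact: (h (inl (inr (v, true))))].
  have hX (k : 'I_5) := h (inl (inl (inl (inr (v, k))))).
  have x0 := hX (inord 0); have x1 := hX (inord 1); have x2 := hX (inord 2).
  have x3 := hX (inord 3); have x4 := hX (inord 4).
  move: x0 x1 x2 x3 x4 trA trB sA sB al be ka kb {hX}.
  rewrite /real_coord /xr_coord !inordK //=.
  case: (fn_piece c v) => [a1 a2 a3 a4 [[X1 X2] X3] a6 a7 a8 a9].
  case: (fn_piece c' v) => [b1 b2 b3 b4 [[Y1 Y2] Y3] b6 b7 b8 b9] /=.
  move=> x0 x1 x2 x3 x4 -> -> -> -> -> -> -> -> /variety_norm /= nY /variety_norm /= nX.
  have e1 : X1 = Y1 by apply: complexP.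
  have e3 : X3 = Y3 by apply: complexP.
  have e2 : X2 = Y2 by apply: arg_norm_inj => //; rewrite nX nY e1 e3.
  by rewrite e1 e2 e3.
have ht : fn_twist c = fn_twist c'.
  apply: functional_extensionality_dep => j.
  have hX (k : 'I_3) := h (inr (j, k)).
  have := hX (inord 0); have := hX (inord 1); have := hX (inord 2) => {hX}.
  rewrite /real_coord !inordK //=.
  case: (fn_twist c j) => [a b]; case: (fn_twist c' j) => [a' b'] /= -> ia ra.
  by rewrite (complexP ra ia).
by move: hp ht; case: c {hc hk h} => [p t]; case: c' {hc'} => [p' t'] /= -> ->.
Qed.

(** The six summands are 8, 4, 10, 4, 4 and 9 times m - 1, in all 39 (m - 1), against 9 (m - 1)
    constraints. *)
Lemma card_real_index (m : nat) : (2 <= m)%N ->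
  (#|real_index m| = 30 * m - 30 + #|constraint_index m|)%N.
Proof.
move=> m2; rewrite /real_index /constraint_index /trace_index /sigma_index.
rewrite /xr_index /alpha_index /beta_index /twist_index.
rewrite !card_sum !card_prod !card_ord !card_bool.
lia.
Qed.

Lemma gram_quotient P Q : P \in unitmx -> gram P P = gram Q Q ->
  gram (Q *m invmx P) (Q *m invmx P) = Jm R.
Proof.
move=> uP ePQ; rewrite gram_mul -ePQ -gram11 -(mulmxV uP) gram_mul.
by rewrite -[gram P P]/(gram P P) ?mulmxA.
Qed.

Lemma mx4_scale (k1 k2 k3 k4 : C) (a b c d : V) : mx4 (k1 *: a) (k2 *: b) (k3 *: c) (k4 *: d)
  = mx4 a b c d *m diag_mx (\row_j [:: k1; k2; k3; k4]`_j).
Proof.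
apply/matrixP=> i j; rewrite mul_mx_diag !mxE.
by case: (ord4P j) => ->; rewrite !inordK //= mxE mulrC.
Qed.

Lemma mx4_quotient (a b c d a' b' c' d' : V) : mx4 a b c d \in unitmx ->
  let A := mx4 a' b' c' d' *m invmx (mx4 a b c d) in
  [/\ A *m a = a', A *m b = b', A *m c = c' & A *m d = d'].
Proof.
move=> uP A; have AP : A *m mx4 a b c d = mx4 a' b' c' d' by rewrite mulmxKV.
move: A AP => A AP.
have h j : A *m col j (mx4 a b c d) = col j (mx4 a' b' c' d') by rewrite mul_col AP.
by split; [have := h ix1|have := h ix2|have := h ix3|have := h ix4]; rewrite !col_mx4.
Qed.

(** The element multiplies u by 2 and w by 1/2 and fixes their orthogonal complement. It is the
    quotient of two standard bases, hence an isometry. *)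
Lemma lox_with_axis u w : null u -> null w -> herm u w != 0 ->
  exists A F, [/\ loxodromic A, eigenframe A F, fr_a F = u & fr_r F = w].
Proof.
move=> nu nw uw.
have [x [xx ux wx _]] := exists_orth_unit 0 nu.2 nw.2 uw.
have [y [yy uy wy xy]] := exists_orth_unit x nu.2 nw.2 uw.
have std c : c != 0 -> stdbasis (c *: ((herm u w)^-1 *: u)) (1 *: x) (1 *: y) ((c^*)^-1 *: w).
  move=> c0; rewrite !scale1r; split; last (split; last split);
    rewrite ?hermZl ?hermZr ?nu.2 ?nw.2 ?ux ?uy ?wx ?wy ?mulr0 //.
  by rewrite fmorphV /= conjCK; field; rewrite uw c0.
have n2 : (2 : C) != 0 by rewrite pnatr_eq0.
have c2 : (2 : C)^* = 2 by rewrite conjC_nat.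
have S1 : stdbasis ((herm u w)^-1 *: u) x y w.
  by have := std 1 (oner_neq0 _); rewrite !scale1r rmorph1 invr1 scale1r.
have uP := stdbasis_unit S1; have S2 := std 2 n2; rewrite c2 in S2.
have gA := gram_quotient uP (etrans (stdbasis_gram S1) (esym (stdbasis_gram S2))).
have dA : \det (mx4 (2 *: ((herm u w)^-1 *: u)) (1 *: x) (1 *: y) (2^-1 *: w)
   *m invmx (mx4 ((herm u w)^-1 *: u) x y w)) = 1.
  rewrite mx4_scale !det_mulmx mulrAC -det_mulmx mulmxV // det1 mul1r det_diag prod4.
  by rewrite !mxE !inordK //= !mulr1 divff.
have [Au Ax Ay Aw] := mx4_quotient (2 *: ((herm u w)^-1 *: u)) (1 *: x) (1 *: y) (2^-1 *: w) uP.
move: (_ *m invmx _) gA dA Au Ax Ay Aw => A gA dA Au0 Ax Ay Aw.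
have Au : A *m u = 2 *: u.
  have h0 : (herm u w)^-1 != 0 by rewrite invr_eq0.
  move: Au0; rewrite -scalemxAr scalerA mulrC -scalerA.
  exact: (scalerI h0).
have hA : SU31 A by split; last by apply/isometryP.
pose F := Frame u x y w.
have nF : nullframe F by split.
have hD : eigdata A F 2 1 1.
  by split; rewrite ?normr1 ?c2 ?mulr1 ?normr_nat ?ltr1n //; split=> //=; rewrite c2.
exists A, F; split=> //; first exact: eigdata_lox hA nF hD.
by apply/eigenframeP; split=> //; exists 2, 1, 1.
Qed.

(** A common fixed vector of non-positive type would be an end of both axes, which would make a
    product between the two axes vanish. *)
Lemma variety_of_nulls (p1 p2 p3 p4 : V) :
  null p1 -> null p2 -> null p3 -> null p4 ->
  herm p1 p2 != 0 -> herm p3 p4 != 0 -> herm p1 p3 != 0 -> herm p1 p4 != 0 ->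
  herm p2 p3 != 0 -> herm p2 p4 != 0 ->
  cross_ratio_variety (cross_ratio p3 p1 p2 p4, cross_ratio p3 p2 p1 p4, cross_ratio p1 p2 p3 p4).
Proof.
move=> n1 n2 n3 n4 h12 h34 h13 h14 h23 h24.
have [A [FA [lA eA a1 r2]]] := lox_with_axis n1 n2 h12.
have [B [FB [lB eB a3 r4]]] := lox_with_axis n3 n4 h34.
exists A, B, FA, FB; split=> //; last by rewrite /X_inv a1 r2 a3 r4.
move=> v v0 hv [fA fB].
have [hA _ _] := lA; have [hB _ _] := lB.
have /eigenframeP[nA [l1 [l2 [l3 dA]]]] := eA.
have /eigenframeP[nB [m1 [m2 [m3 dB]]]] := eB.
have contra (p q : V) : null p -> null q -> herm p q != 0 -> same_point v p -> same_point v q -> False.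
  move=> np nq pq sp sq; have [k k0 e] := same_point_trans (same_point_sym sp) sq.
  by move: pq; rewrite e hermZl nq.2 mulr0 eqxx.
have := eigdata_fixed hA nA dA v0 hv fA; have := eigdata_fixed hB nB dB v0 hv fB.
rewrite a1 r2 a3 r4 => -[] sB [] sA.
- exact: contra n1 n3 h13 sA sB.
- exact: contra n2 n3 h23 sA sB.
- exact: contra n1 n4 h14 sA sB.
- exact: contra n2 n4 h24 sA sB.
Qed.

Lemma norm_le_coord (a b e : R) : `|a| <= e -> `|b| <= e -> `|a +i* b| <= (e + e)%:C.
Proof.
move=> ha hb; have -> : a +i* b = a%:C + 'i * b%:C.
  by apply/eqP; rewrite eq_complex /=; apply/andP; split; apply/eqP; ring.
apply: le_trans (ler_normD _ _) _; rewrite rmorphD /= lerD //.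
  by rewrite normc_def /= expr0n /= addr0 sqrtr_sqr lecR.
rewrite normrM [X in X * _](_ : _ = 1); last by rewrite normc_def /= expr0n expr1n add0r sqrtr1.
by rewrite mul1r normc_def /= expr0n /= addr0 sqrtr_sqr lecR.
Qed.

Definition vec4 (a b c d : C) : V := \col_i [:: a; b; c; d]`_i.

Lemma herm_vec4 a b c d a' b' c' d' : herm (vec4 a b c d) (vec4 a' b' c' d')
  = a * d'^* + b * b'^* + c * c'^* + d * a'^*.
Proof. by rewrite /herm !mxE !inordK. Qed.

(* With [p1 = e1], [p2 = e4] and [al] of norm one such that [al ^+ 2] has the
   phase of [X2 / (X1 X3)], the vectors [p3 = (al, s, 0, 1)] and
   [p4 = (X3 al, de, ep, 1)] realize the cross-ratios as soon as real positive
   [s ^+ 2] and [ep ^+ 2] make them null. *)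
Lemma variety_point (X1 X3 al : C) : X1 != 0 -> X3 != 0 -> `|al| = 1 ->
  al + al^* < 0 ->
  `|al^* / X1 - X3 * al - al^*| ^+ 2 <= (al + al^*) * (X3 * al + (X3 * al)^*) ->
  cross_ratio_variety (X1, X1 * X3 * al ^+ 2, X3).
Proof.
move=> X10 X30 nal hal hde.
have al0 : al != 0 by rewrite -normr_eq0 nal oner_eq0.
have alC : al * al^* = 1 by rewrite -normCK nal expr1n.
have alC0 : al^* != 0 by rewrite conjC_eq0.
pose ga := X3 * al; pose t := - (al + al^*); pose s := sqrtC t.
have t0 : 0 < t by rewrite oppr_gt0.
have s0 : 0 < s by rewrite sqrtC_gt0.
have sC : s^* = s by apply/CrealP/ger0_real/ltW.
have ss : s * s = t by rewrite -expr2 sqrtCK.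
pose de := (al^* / X1 - ga - al^*) / s.
pose e := - (ga + ga^*) - `|de| ^+ 2.
have e0 : 0 <= e.
  rewrite /e subr_ge0 /de normrM exprMn normfV (ger0_norm (ltW s0)) exprVn sqrtCK.
  rewrite ler_pdivrMr // /t mulrNN [X in _ <= X]mulrC; exact: hde.
pose ep := sqrtC e.
have ep0 : 0 <= ep by rewrite sqrtC_ge0.
have epC : ep^* = ep by apply/CrealP/ger0_real.
have epep : ep * ep = e by rewrite -expr2 sqrtCK.
pose p1 := vec4 1 0 0 0; pose p2 := vec4 0 0 0 1.
pose p3 := vec4 al s 0 1; pose p4 := vec4 ga de ep 1.
have v0 (i : 'I_4) (v : V) : v i 0 != 0 -> v != 0.
  by apply: contraNneq => ->; rewrite mxE.
have n1 : null p1.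
  split; first by apply: (v0 ix1); rewrite mxE inordK //= oner_neq0.
  by rewrite herm_vec4 !conjC0 !conjC1; ring.
have n2 : null p2.
  split; first by apply: (v0 ix4); rewrite mxE inordK //= oner_neq0.
  by rewrite herm_vec4 !conjC0 !conjC1; ring.
have n3 : null p3.
  split; first by apply: (v0 ix4); rewrite mxE inordK //= oner_neq0.
  by rewrite herm_vec4 !conjC0 !conjC1 sC ss /t; ring.
have n4 : null p4.
  split; first by apply: (v0 ix4); rewrite mxE inordK //= oner_neq0.
  by rewrite herm_vec4 !conjC1 epC epep /e normCK; ring.
have ga0 : ga != 0 by rewrite mulf_neq0.
have h12 : herm p1 p2 = 1 by rewrite herm_vec4 !conjC0 !conjC1; ring.
have h13 : herm p1 p3 = 1 by rewrite herm_vec4 !conjC0 !conjC1; ring.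
have h14 : herm p1 p4 = 1 by rewrite herm_vec4 !conjC1; ring.
have h23 : herm p2 p3 = al^* by rewrite herm_vec4 !conjC0 !conjC1; ring.
have h24 : herm p2 p4 = ga^* by rewrite herm_vec4 !conjC1; ring.
have h43 : herm p4 p3 = al^* / X1.
  rewrite herm_vec4 !conjC0 !conjC1 sC /de divfK ?gt_eqF //; ring.
have h34 : herm p3 p4 != 0 by rewrite -hermC conjC_eq0 h43 mulf_neq0 // invr_eq0.
have := variety_of_nulls n1 n2 n3 n4; rewrite h12 h13 h14 h23 h24 oner_neq0 !conjC_eq0 al0 ga0.
move=> /(_ isT h34 isT isT isT isT).
rewrite /cross_ratio -(hermC p1 p2) -(hermC p1 p3) -(hermC p1 p4) -(hermC p2 p3) -(hermC p2 p4).
rewrite h12 h13 h14 h23 h24 h43 !conjCK !rmorph1 !mul1r !mulr1.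
rewrite (_ : al^* / (al^* / X1) = X1); last by field; rewrite X10 alC0.
rewrite (_ : ga / (al^* / X1) = X1 * X3 * al ^+ 2); last first.
  by rewrite -[LHS]mulr1 -[in LHS]alC /ga; field; rewrite X10 alC0.
by rewrite (_ : ga / al = X3) //; rewrite /ga mulfK.
Qed.

(** The coordinates stay near X1 = 1/2, X3 = 1 and argument 0. At that point al = -1, and the last
    hypothesis of [variety_point] reads 0 <= 4, so it persists nearby. The constants below leave
    (8/5)^2 on the left against 4 (9/10) (17/20) on the right. *)
Lemma variety_near (y0 y1 th y3 y4 : R) :
  49 / 100 <= y0 <= 51 / 100 -> `|y1| <= 1 / 100 -> is_angle th -> 9 / 10 <= cos th ->
  99 / 100 <= y3 <= 101 / 100 -> `|y4| <= 1 / 100 ->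
  exists X2, cross_ratio_variety (y0 +i* y1, X2, y3 +i* y4) /\ arg X2 = th.
Proof.
move=> /andP[b0 b0'] b1 hth cth /andP[b3 b3'] b4.
have n0' : `|y0| <= 51 / 100 by rewrite ler_norml; apply/andP; split; clear -b0 b0'; lra.
have n3' : `|y3| <= 101 / 100 by rewrite ler_norml; apply/andP; split; clear -b3 b3'; lra.
have [p ep] : exists p, p = y0 * y3 - y1 * y4 by exists (y0 * y3 - y1 * y4).
have [q eq] : exists q, q = y0 * y4 + y1 * y3 by exists (y0 * y4 + y1 * y3).
have hp : 12 / 25 <= p.
  have h1 : 49 / 100 * (99 / 100) <= y0 * y3 by apply: ler_pM => //; clear; lra.
  have h2 : `|y1 * y4| <= 1 / 100 * (1 / 100) by rewrite normrM; apply: ler_pM.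
  move: h2; rewrite ep ler_norml => /andP[_ h2]; clear -h1 h2; lra.
have qn : `|q| <= 1 / 50.
  have h1 : `|y0 * y4| <= 51 / 100 * (1 / 100) by rewrite normrM; apply: ler_pM.
  have h2 : `|y1 * y3| <= 1 / 100 * (101 / 100) by rewrite normrM; apply: ler_pM.
  rewrite eq; apply: le_trans (ler_normD _ _) _; clear -h1 h2; lra.
pose X1 : C := y0 +i* y1; pose X3 : C := y3 +i* y4.
have eZ : X1 * X3 = p +i* q by rewrite ep eq.
have X10 : X1 != 0 by apply/eqP=> /(congr1 (@complex.Re R)) /= z; clear -b0 z; lra.
have X30 : X3 != 0 by apply/eqP=> /(congr1 (@complex.Re R)) /= z; clear -b3 z; lra.
pose Z := X1 * X3; have Z0 : Z != 0 by rewrite mulf_neq0.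
have nZ0 : `|Z| != 0 by rewrite normr_eq0.
have [ta hta eta] : exists2 ta, is_angle ta & cis th * (`|Z| / Z) = cis ta.
  by apply: cis_exists; rewrite normrM norm_cis mul1r normrM normfV normr_id divff.
(* Of the two square roots of [cis ta], this is the one with negative real part, as [variety_point]
   demands. *)
pose al : C := - cis (ta / 2).
have al2 : al ^+ 2 = cis ta by rewrite /al sqrrN expr2 -cisD -splitr.
have nal : `|al| = 1 by rewrite normrN norm_cis.
have X2E : X1 * X3 * al ^+ 2 = `|Z| * cis th.
  by rewrite al2 -eta -/Z; field; rewrite Z0.
pose n := Num.sqrt (p ^+ 2 + q ^+ 2).
have nZ : `|Z| = n%:C by rewrite /Z eZ normc_def.
have n0 : 0 < n by rewrite -ltcR -nZ normr_gt0.
have n2 : n ^+ 2 = p ^+ 2 + q ^+ 2 by rewrite sqr_sqrtr // addr_ge0 // sqr_ge0.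
have npq : n <= p + `|q|.
  rewrite -(@ler_sqr _ n) ?nnegrE ?(ltW n0) // ?addr_ge0 ?normr_ge0 //; last by clear -hp; lra.
  rewrite n2 sqrrD real_normK ?num_real // lerD2r lerDl mulrn_wge0 // mulr_ge0 //; clear -hp; lra.
have cta : cos ta * n = cos th * p + sin th * q.
  have : cis ta * `|Z| = cis th * Z^*.
    rewrite -eta; transitivity (cis th * (`|Z| ^+ 2 / Z)); first by rewrite expr2; field; rewrite Z0.
    by rewrite normCK mulrAC divff // mul1r.
  by rewrite nZ /Z eZ => /(congr1 (@complex.Re R)) /=; rewrite mulr0 subr0 mulrN opprK.
have sth : `|sin th * q| <= `|q|.
  by rewrite normrM ler_piMl // ler_norml sin_geN1 sin_le1.
have hcta : 4 / 5 <= cos ta.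
  rewrite leNgt; apply/negP=> lt98.
  have h1 : cos ta * n < 4 / 5 * n by rewrite ltr_pM2r.
  have h2 : 9 / 10 * p <= cos th * p by rewrite ler_wpM2r //; clear -hp; lra.
  have h3 : - `|q| <= sin th * q by move: sth; rewrite ler_norml => /andP[].
  clear -cta h1 h2 h3 npq qn hp; lra.
pose u := cos (ta / 2); pose v := sin (ta / 2).
have uv1 : u ^+ 2 + v ^+ 2 = 1 by exact: cos2Dsin2.
have uv2 : u ^+ 2 - v ^+ 2 = cos ta.
  by rewrite [in RHS](splitr ta) cosD -!expr2.
have u_ge0 : 0 <= u.
  by case: hta => a b; apply: cos_ge0_pihalf; apply/andP; split; clear -a b; lra.
have u1 : u <= 1 by exact: cos_le1.
have hu : 9 / 10 <= u by clear -uv1 uv2 u_ge0 u1 hcta; nra.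
have hv : `|v| <= 1 / 3.
  rewrite ler_norml; apply/andP.
  by split; clear -uv1 uv2 hcta; nra.
have eal : al = (- u) +i* (- v) by [].
have ealC : al^* = (- u) +i* v by rewrite eal; apply/eqP; rewrite eq_complex /= opprK !eqxx.
have sal : al + al^* = (- (2 * u))%:C.
  by rewrite eal ealC; apply/eqP; rewrite eq_complex /=; apply/andP; split; apply/eqP; ring.
have hV : cross_ratio_variety (X1, X1 * X3 * al ^+ 2, X3).
  apply: variety_point => //; first by rewrite sal (ltcR _ 0); clear -hu; lra.
  have -> : (al + al^*) * (X3 * al + (X3 * al)^*) = (4 * u * (y3 * u - y4 * v))%:C.
    rewrite sal eal /X3; apply/eqP; rewrite eq_complex /=; apply/andP; split; apply/eqP; ring.
  have E1 : `|X1^-1 - 2| <= (1 / 10)%:C.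
    have -> : X1^-1 - 2 = (1 - 2 * X1) / X1 by field.
    rewrite normrM normfV ler_pdivrMr ?normr_gt0 //.
    apply: (@le_trans _ _ (1 / 25)%:C).
      have -> : 1 - 2 * X1 = (1 - 2 * y0) +i* (- (2 * y1)).
        by apply/eqP; rewrite eq_complex /=; apply/andP; split; apply/eqP; ring.
      have -> : 1 / 25 = 1 / 50 + 1 / 50 :> R by clear; lra.
      apply: norm_le_coord; rewrite ler_norml; apply/andP.
        by split; clear -b0 b0'; lra.
      by move: b1; rewrite ler_norml => /andP[c1 c2]; split; clear -c1 c2; lra.
    apply: (@le_trans _ _ ((1 / 10)%:C * (complex.Re X1)%:C)).
      by rewrite -rmorphM /= lecR; clear -b0; lra.
    rewrite ler_pM2l; last by rewrite (ltcR 0); clear; lra.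
    by apply: le_trans (normc_ge_Re X1); rewrite lecR ler_norm.
  have E2 : `|al^* - al| <= (4 / 3)%:C.
    have -> : al^* - al = 0 +i* (2 * v).
      by rewrite eal ealC; apply/eqP; rewrite eq_complex /=; apply/andP; split; apply/eqP; ring.
    have -> : 4 / 3 = 2 / 3 + 2 / 3 :> R by clear; lra.
    apply: norm_le_coord; first by rewrite normr0; clear; lra.
    by rewrite normrM ger0_norm //; clear -hv; lra.
  have E3 : `|X3 - 1| <= (1 / 10)%:C.
    have -> : X3 - 1 = (y3 - 1) +i* y4.
      by apply/eqP; rewrite eq_complex /=; apply/andP; split; apply/eqP; ring.
    have -> : 1 / 10 = 1 / 20 + 1 / 20 :> R by clear; lra.
    apply: norm_le_coord; rewrite ler_norml; apply/andP.
      by split; clear -b3 b3'; lra.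
    by move: b4; rewrite ler_norml => /andP[c1 c2]; split; clear -c1 c2; lra.
  have E : `|al^* / X1 - X3 * al - al^*| <= (8 / 5)%:C.
    (* Each of the three terms vanishes at the central configuration and is bounded separately. *)
    have -> : al^* / X1 - X3 * al - al^* = al^* * (X1^-1 - 2) + (al^* - al) - (X3 - 1) * al by field.
    apply: (@le_trans _ _ (1 / 10 + 4 / 3 + 1 / 10)%:C); last by rewrite lecR; clear; lra.
    have -> : (1 / 10 + 4 / 3 + 1 / 10)%:C = (1 / 10)%:C + (4 / 3)%:C + (1 / 10)%:C :> C.
      by rewrite !rmorphD.
    apply: le_trans (ler_normB _ _) _; rewrite lerD //.
      apply: le_trans (ler_normD _ _) _; rewrite lerD //.
      by rewrite normrM norm_conjC nal [X in X <= _]mul1r.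
    by rewrite normrM nal [X in X <= _]mulr1.
  apply: (@le_trans _ _ ((8 / 5)%:C ^+ 2)).
    by rewrite ler_sqr ?nnegrE ?normr_ge0 // ler0c; clear; lra.
  rewrite -rmorphXn /= lecR.
  move: hv b4 => hv b4; move: hv b4; rewrite !ler_norml => /andP[hv1 hv2] /andP[hy hy'].
  have k1 : 17 / 20 <= y3 * u - y4 * v.
    have h1 : 99 / 100 * (9 / 10) <= y3 * u by apply: ler_pM => //; clear; lra.
    have h2 : y4 * v <= 1 / 100 by clear -hv1 hv2 hy hy'; nra.
    by clear -h1 h2; lra.
  by clear -k1 hu; nra.
exists (X1 * X3 * al ^+ 2); split=> //; apply: arg_unique => //.
  by rewrite X2E mulf_neq0 ?cis_neq0.
have nX2 : `|X1 * X3 * al ^+ 2| = `|Z| by rewrite normrM normrX nal expr1n mulr1.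
by rewrite nX2; exact: X2E.
Qed.

Lemma variety_open : exists (x : 'I_5 -> R) (e : R), 0 < e /\
  forall y : 'I_5 -> R, (forall i, `|y i - x i| < e) ->
    exists2 t, cross_ratio_variety t & forall i, xr_coord t i = y i.
Proof.
have [d d0 hd] : exists2 d : R, 0 < d & forall th : R, `|th| < d -> 9 / 10 <= cos th.
  have := @continuous_cos R 0; rewrite /continuous_at cos0 => /cvgrPdist_lt /(_ (1 / 10)).
  move=> /(_ ltac:(lra)) /nbhs_ballP [d /= d0 hd]; exists d => // th hth.
  have := hd th; rewrite /ball /= sub0r normrN => /(_ hth).
  by rewrite ltr_norml => /andP[]; lra.
pose x (i : 'I_5) : R := [:: 2^-1; 0; 0; 1; 0]`_i.
exists x, (Num.min d (1 / 100)); split; first by rewrite lt_min d0 /=; clear; lra.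
move=> y hy.
have hk (n : nat) : (n < 5)%N -> `|y (inord n) - [:: 2^-1; 0; 0; 1; 0]`_n| < d /\
    `|y (inord n) - [:: 2^-1; 0; 0; 1; 0]`_n| < 1 / 100.
  by move=> n5; have := hy (inord n); rewrite /x inordK // lt_min => /andP.
have := hk 0%N isT; have := hk 1%N isT; have := hk 2%N isT; have := hk 3%N isT; have := hk 4%N isT.
rewrite /= !subr0 => -[_ b4] [_ b3] [bt b2] [_ b1] [_ b0].
have [|||||| X2 [hV aX]] := @variety_near (y (inord 0)) (y (inord 1)) (y (inord 2)) (y (inord 3)) (y (inord 4)).
- by move: b0; rewrite ltr_norml => /andP[p q]; apply/andP; split; clear -p q; lra.
- exact: ltW.
- have := pi_ge2 R; move: b2; rewrite ltr_norml => /andP[p q] r; split; clear -p q r; lra.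
- exact: hd.
- by move: b3; rewrite ltr_norml => /andP[p q]; apply/andP; split; clear -p q; lra.
- exact: ltW.
exists (y (inord 0) +i* y (inord 1), X2, y (inord 3) +i* y (inord 4)) => // i.
rewrite /xr_coord /= aX.
by case: i => [[|[|[|[|[|//]]]]] lt_i] /=; congr y; apply/val_inj; rewrite /= inordK.
Qed.
End Variety.

(** * Paths and local systems *)

Section Continuity.
Variable R : realType.

Lemma withinP (T U : topologicalType) (A : set T) (f : T -> U) :
  {within A, continuous f} <->
  forall x, A x -> forall W, nbhs (f x) W -> nbhs x [set y | A y -> W (f y)].
Proof. by rewrite subspace_continuousP; split=> h x Ax W hW; apply: h. Qed.

Lemma within_comp (T U W : topologicalType) (A : set T) (B : set U)
    (f : T -> U) (g : U -> W) :
  {within A, continuous f} -> (forall x, A x -> B (f x)) ->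
  {within B, continuous g} -> {within A, continuous (g \o f)}.
Proof.
move=> /withinP cf AB /withinP cg; apply/withinP => x Ax V /= hV.
have := cf x Ax _ (cg _ (AB _ Ax) _ hV).
by apply: filterS => y /= h Ay; apply: h => //; apply: AB.
Qed.

Lemma within_pair (T U W : topologicalType) (A : set T) (f : T -> U) (g : T -> W) :
  {within A, continuous f} -> {within A, continuous g} ->
  {within A, continuous (fun x => (f x, g x))}.
Proof.
move=> /withinP cf /withinP cg; apply/withinP => x Ax V [[V1 V2] /= [h1 h2] sub].
apply: (@filterS _ (nbhs x) _ _ _ _ (filterI (cf x Ax _ h1) (cg x Ax _ h2))).
by move=> y [/= a b] Ay; apply: sub; split; [exact: a | exact: b].
Qed.

Lemma within_ext (T U : topologicalType) (A : set T) (f g : T -> U) :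
  (forall x, A x -> f x = g x) -> {within A, continuous f} -> {within A, continuous g}.
Proof.
move=> e; apply: subspace_eq_continuous => x; rewrite inE; exact: e.
Qed.

Lemma within_cst (T U : topologicalType) (A : set T) (c : U) :
  {within A, continuous (fun=> c)}.
Proof. by apply: continuous_subspaceT => x; apply: cvg_cst. Qed.

Lemma within_id (T : topologicalType) (A : set T) : {within A, continuous (fun x => x)}.
Proof. by apply: continuous_subspaceT => x; apply: cvg_id. Qed.

Section RealValued.
Variables (T : topologicalType) (A : set T).
Implicit Types f g : T -> R.

Lemma withinD f g : {within A, continuous f} -> {within A, continuous g} ->
  {within A, continuous (fun x => f x + g x)}.
Proof.
move=> /subspace_continuousP cf /subspace_continuousP cg.
by apply/subspace_continuousP => x Ax; apply: cvgD; [exact: cf | exact: cg].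
Qed.

Lemma withinN f : {within A, continuous f} -> {within A, continuous (fun x => - f x)}.
Proof.
move=> /subspace_continuousP cf.
by apply/subspace_continuousP => x Ax; apply: cvgN; exact: cf.
Qed.

Lemma withinM f g : {within A, continuous f} -> {within A, continuous g} ->
  {within A, continuous (fun x => f x * g x)}.
Proof.
move=> /subspace_continuousP cf /subspace_continuousP cg.
by apply/subspace_continuousP => x Ax; apply: cvgM; [exact: cf | exact: cg].
Qed.

Lemma withinX f n : {within A, continuous f} -> {within A, continuous (fun x => f x ^+ n)}.
Proof.
move=> cf; elim: n => [|n IH].
  have -> : (fun x => f x ^+ 0) = (fun=> 1).
    by apply: functional_extensionality_dep => x; rewrite expr0.
  exact: within_cst.
have -> : (fun x => f x ^+ n.+1) = (fun x => f x * f x ^+ n).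
  by apply: functional_extensionality_dep => x; rewrite exprS.
exact: withinM.
Qed.

Lemma within_real (h : R -> R) f : continuous h -> {within A, continuous f} ->
  {within A, continuous (fun x => h (f x))}.
Proof.
move=> ch cf; apply: (@within_comp _ _ _ A setT f h) => //.
exact: continuous_subspaceT.
Qed.
End RealValued.

Lemma within_fst (T : topologicalType) (U W : topologicalType) (A : set T) (f : T -> U * W) :
  {within A, continuous f} -> {within A, continuous (fun x => (f x).1)}.
Proof.
move=> cf; apply: (@within_comp _ _ _ A setT f fst) => //.
by apply: continuous_subspaceT => x; exact: cvg_fst.
Qed.

Lemma within_snd (T : topologicalType) (U W : topologicalType) (A : set T) (f : T -> U * W) :
  {within A, continuous f} -> {within A, continuous (fun x => (f x).2)}.
Proof.
move=> cf; apply: (@within_comp _ _ _ A setT f snd) => //.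
by apply: continuous_subspaceT => x; exact: cvg_snd.
Qed.
End Continuity.

(* A head symbol for the tactic below: [{within A, continuous f}] is a product
   whose body hides [f] under [from_subspace]. *)
Definition ctn (T U : topologicalType) (A : set T) (f : T -> U) : Prop :=
  {within A, continuous f}.

Lemma ctn_sqrt (R : realType) (T : topologicalType) (A : set T) (f : T -> R) :
  ctn A f -> ctn A (fun x => Num.sqrt (f x)).
Proof. exact: (within_real (@sqrt_continuous _)). Qed.

Lemma ctn_sin (R : realType) (T : topologicalType) (A : set T) (f : T -> R) :
  ctn A f -> ctn A (fun x => sin (f x)).
Proof. exact: (within_real (@continuous_sin _)). Qed.

Lemma ctn_cos (R : realType) (T : topologicalType) (A : set T) (f : T -> R) :
  ctn A f -> ctn A (fun x => cos (f x)).
Proof. exact: (within_real (@continuous_cos _)). Qed.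

Lemma ctn_norm (R : realType) (T : topologicalType) (A : set T) (f : T -> R) :
  ctn A f -> ctn A (fun x => `|f x|).
Proof. exact: (within_real (@norm_continuous _ _)). Qed.

Ltac cont_step :=
  lazymatch goal with
  | |- ctn _ (fun _ => ?c) => exact (@within_cst _ _ _ c)
  | |- ctn _ (fun x => x) => exact (@within_id _ _)
  | |- ctn _ (fun x => (@?f x, @?g x)) => refine (@within_pair _ _ _ _ f g _ _)
  | |- ctn _ (fun x => @Algebra.add _ (@?f x) (@?g x)) => refine (@withinD _ _ _ f g _ _)
  | |- ctn _ (fun x => @Algebra.opp _ (@?f x)) => refine (@withinN _ _ _ f _)
  | |- ctn _ (fun x => @GRing.mul _ (@?f x) (@?g x)) => refine (@withinM _ _ _ f g _ _)
  | |- ctn _ (fun x => @GRing.exp _ (@?f x) ?n) => refine (@withinX _ _ _ f n _)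
  | |- ctn _ (fun x => Num.sqrt (@?f x)) => refine (@ctn_sqrt _ _ _ f _)
  | |- ctn _ (fun x => @Num.norm _ _ (@?f x)) => refine (@ctn_norm _ _ _ f _)
  | |- ctn _ (fun x => sin (@?f x)) => refine (@ctn_sin _ _ _ f _)
  | |- ctn _ (fun x => cos (@?f x)) => refine (@ctn_cos _ _ _ f _)
  | |- ctn _ (fun x => fst (@?f x)) => refine (@within_fst _ _ _ _ f _)
  | |- ctn _ (fun x => snd (@?f x)) => refine (@within_snd _ _ _ _ f _)
  | |- ctn _ fst => refine (@within_fst _ _ _ _ (fun x => x) _)
  | |- ctn _ snd => refine (@within_snd _ _ _ _ (fun x => x) _)
  end.

Lemma ctnI (T U : topologicalType) (A : set T) (f : T -> U) :
  ctn A f -> {within A, continuous f}.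
Proof. by []. Qed.

Ltac cont :=
  lazymatch goal with
  | |- is_path ?f => change (ctn (@I01 _) f)
  | |- ctn _ _ => idtac
  | |- _ => refine (ctnI _)
  end;
  repeat (first [assumption | cont_step | refine (ctnI _); cont_step]; cbv beta).

Section Paths.
Variables (R : realType) (S : topologicalType).
Implicit Types (p q : R -> S) (a b c t : R).

Lemma I01P t : @I01 R t <-> 0 <= t <= 1.
Proof. by rewrite /I01 /= in_itv. Qed.

Lemma I01_0 : @I01 R 0. Proof. by apply/I01P; rewrite lexx ler01. Qed.
Lemma I01_1 : @I01 R 1. Proof. by apply/I01P; rewrite lexx ler01. Qed.
Lemma I01_half : @I01 R 2^-1. Proof. by apply/I01P; apply/andP; split; lra. Qed.

Lemma I01_conv a b t : @I01 R a -> @I01 R b -> @I01 R t -> @I01 R (a + t * (b - a)).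
Proof. by move=> /I01P ha /I01P hb /I01P ht; apply/I01P; apply/andP; split; nra. Qed.

Lemma pcat_path (p q : R -> S) : is_path p -> is_path q -> p 1 = q 0 -> is_path (pcat p q).
Proof.
move=> cp cq e.
rewrite /is_path; have -> : @I01 R = (`[0, 2^-1]%classic `|` `[2^-1, 1]%classic).
  rewrite eqEsubset; split=> t /=.
    move=> /I01P/andP[h1 h2]; case: (leP t 2^-1) => h; [left|right].
      by rewrite in_itv /= h1 h.
    by rewrite in_itv /= h2 (ltW h).
  by case; rewrite in_itv /= => /andP[h1 h2]; apply/I01P; apply/andP; split; lra.
apply: withinU_continuous.
- exact: itv_closed.
- exact: itv_closed.
- apply: (@within_ext _ _ _ (p \o (fun t => 2 * t))).
    by move=> t /=; rewrite in_itv /= /pcat => /andP[_ ->].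
  apply: within_comp cp; first by cont.
  by move=> t /=; rewrite in_itv /= => /andP[h1 h2]; apply/I01P; apply/andP; split; lra.
- apply: (@within_ext _ _ _ (q \o (fun t => 2 * t - 1))).
    move=> t /=; rewrite in_itv /= /pcat => /andP[h1 h2]; case: ifP => // h3.
    have -> : t = 2^-1 by apply/le_anti; rewrite h1 h3.
    by rewrite divff ?pnatr_eq0 // subrr.
  apply: within_comp cq; first by cont.
  by move=> t /=; rewrite in_itv /= => /andP[h1 h2]; apply/I01P; apply/andP; split; lra.
Qed.

Lemma pcat0 (p q : R -> S) : pcat p q 0 = p 0.
Proof. by rewrite /pcat invr_ge0 ler0n mulr0. Qed.

Lemma pcat1 (p q : R -> S) : pcat p q 1 = q 1.
Proof.
rewrite /pcat ifF; first by congr q; lra.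
by apply/negbTE; rewrite -ltNge; lra.
Qed.

Lemma pcat_range (P : S -> Prop) p q : (forall t, @I01 R t -> P (p t)) ->
  (forall t, @I01 R t -> P (q t)) -> forall t, @I01 R t -> P (pcat p q t).
Proof.
move=> hp hq t /I01P/andP[h1 h2]; rewrite /pcat; case: (leP t 2^-1) => h.
  by apply: hp; apply/I01P; apply/andP; split; lra.
by apply: hq; apply/I01P; apply/andP; split; lra.
Qed.

(** The parameters [a] and [b] may come in either order; [sub p 1 0] is the reversed path. *)
Definition sub p a b : R -> S := fun t => p (a + t * (b - a)).

Lemma sub0 p a b : sub p a b 0 = p a.
Proof. by rewrite /sub mul0r addr0. Qed.

Lemma sub1 p a b : sub p a b 1 = p b.
Proof. by rewrite /sub mul1r addrC subrK. Qed.

Lemma sub_path p a b : is_path p -> @I01 R a -> @I01 R b -> is_path (sub p a b).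
Proof.
move=> cp ha hb; apply: (@within_comp _ _ _ _ (@I01 R) (fun t => a + t * (b - a)) p) => //.
  by cont.
by move=> t; apply: I01_conv.
Qed.

Lemma prev_sub p : @Defs.prev R S p = sub p 1 0.
Proof. by apply: functional_extensionality_dep => t; rewrite /Defs.prev /sub; congr p; ring. Qed.

Lemma sub01 p : sub p 0 1 = p.
Proof. by apply: functional_extensionality_dep => t; rewrite /sub subr0 mulr1 add0r. Qed.

Lemma prev_path p : is_path p -> is_path (@Defs.prev R S p).
Proof. by move=> cp; rewrite prev_sub; apply: sub_path => //; [exact: I01_1 | exact: I01_0]. Qed.

Lemma prev0 p : @Defs.prev R S p 0 = p 1. Proof. by rewrite /Defs.prev subr0. Qed.
Lemma prev1 p : @Defs.prev R S p 1 = p 0. Proof. by rewrite /Defs.prev subrr. Qed.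

Lemma cst_path (x : S) : is_path (fun _ : R => x).
Proof. exact: within_cst. Qed.

(* Straight-line homotopy in the parameter space. *)
Lemma convex_homotopy (K : set (R * R)) (f : R * R -> S) (u v : R -> R * R) :
  (forall y z s, K y -> K z -> @I01 R s ->
     K (y.1 + s * (z.1 - y.1), y.2 + s * (z.2 - y.2))) ->
  {within K, continuous f} -> is_path u -> is_path v ->
  (forall t, @I01 R t -> K (u t)) -> (forall t, @I01 R t -> K (v t)) ->
  u 0 = v 0 -> u 1 = v 1 -> path_homotopic (f \o u) (f \o v).
Proof.
move=> convK cf cu cv uK vK e0 e1.
pose h (z : R * R) : R * R :=
  ((u z.2).1 + z.1 * ((v z.2).1 - (u z.2).1), (u z.2).2 + z.1 * ((v z.2).2 - (u z.2).2)).
exists (f \o h); split.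
  have c2 (w : R -> R * R) : is_path w -> {within @square R, continuous (w \o snd)}.
    move=> cw; apply: within_comp cw; first by cont.
    by move=> z [].
  apply: within_comp cf.
    rewrite /h; have := c2 _ cu; have := c2 _ cv; rewrite /comp => cv2 cu2.
    by cont.
  by move=> z [z1 z2]; apply: convK => //; [exact: uK | exact: vK].
move=> t ht; split; rewrite /= /h /=.
- by rewrite !mul0r !addr0 -surjective_pairing.
- by rewrite !mul1r ![_ + (_ - _)]addrC !subrK -surjective_pairing.
- by rewrite e0 !subrr !mulr0 !addr0 -surjective_pairing.
- by rewrite e1 !subrr !mulr0 !addr0 -surjective_pairing.
Qed.

Lemma square_convex (y z : R * R) s : @square R y -> @square R z -> @I01 R s ->
  @square R (y.1 + s * (z.1 - y.1), y.2 + s * (z.2 - y.2)).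
Proof. by move=> [y1 y2] [z1 z2] hs; split; apply: I01_conv. Qed.

Lemma reparam_homotopic p (u v : R -> R) : is_path p -> is_path u -> is_path v ->
  (forall t, @I01 R t -> @I01 R (u t)) -> (forall t, @I01 R t -> @I01 R (v t)) ->
  u 0 = v 0 -> u 1 = v 1 -> path_homotopic (p \o u) (p \o v).
Proof.
move=> cp cu cv hu hv e0 e1.
apply: (@convex_homotopy (@I01 R `*` setT) (p \o fst) (fun t => (u t, 0)) (fun t => (v t, 0))).
- by move=> y z s [y1 _] [z1 _] hs; split=> //; apply: I01_conv.
- by apply: within_comp cp; [cont | move=> z []].
- by apply: within_pair => //; cont.
- by apply: within_pair => //; cont.
- by move=> t ht; split=> //; apply: hu.
- by move=> t ht; split=> //; apply: hv.
- by rewrite e0.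
- by rewrite e1.
Qed.

Lemma path_homotopic_refl p q : is_path p -> (forall t, @I01 R t -> p t = q t) ->
  path_homotopic p q.
Proof.
move=> cp e; exists (p \o snd); split.
  by apply: within_comp cp; [cont | move=> z []].
by move=> t ht; split => //=; exact: e.
Qed.
End Paths.

(** The points of [A] satisfying a locally constant property form a relatively open and closed
    subset. *)
Lemma connected_loc (U : topologicalType) (A : set U) (P : U -> Prop) :
  connected A ->
  (forall x, A x -> nbhs x [set y | A y -> (P y <-> P x)]) ->
  forall x y, A x -> A y -> P x -> P y.
Proof.
move=> cA lc x y Ax Ay Px.
suff e : A `&` P = A by move: Ay; rewrite -e => -[].
apply: cA; first by exists x.
  exists (interior [set y | A y -> P y]); first exact: open_interior.
  rewrite eqEsubset; split=> z [Az hz]; split=> //.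
    by apply: filterS (lc z Az) => w h /h [_]; apply.
  by have := nbhs_singleton hz; apply.
exists (~` interior [set y | A y -> ~ P y]).
  by rewrite closedC; exact: open_interior.
rewrite eqEsubset; split=> z [Az hz]; split=> //.
  by move=> /nbhs_singleton /(_ Az).
apply: contrapT => nP; apply: hz; rewrite /interior /=.
by apply: filterS (lc z Az) => w h /h [h1 _] /h1.
Qed.

(** * Parallel transport and flat sections *)

Section Transport.
Variables (R : realType) (S : topologicalType) (F : Type).

(* [T p] transports the fibre over [p 0] to the fibre over [p 1], all fibres
   being identified with [F]. *)
Definition local_system (T : (R -> S) -> F -> F) : Prop :=
  [/\ forall p q e, is_path p -> is_path q -> path_homotopic p q -> T p e = T q e,
      forall p q e, is_path p -> is_path q -> p 1 = q 0 -> T (pcat p q) e = T q (T p e) &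
      forall x e, T (fun=> x) e = e].

Variable T : (R -> S) -> F -> F.
Hypothesis hT : local_system T.

Lemma ls_hom p q e : is_path p -> is_path q -> path_homotopic p q -> T p e = T q e.
Proof. by case: hT => h _ _; apply: h. Qed.

Lemma ls_cat p q e : is_path p -> is_path q -> p 1 = q 0 -> T (pcat p q) e = T q (T p e).
Proof. by case: hT => _ h _; apply: h. Qed.

Lemma ls_cst x e : T (fun=> x) e = e.
Proof. by case: hT => _ _; apply. Qed.

Lemma ls_ext p q e : is_path p -> (forall t, @I01 R t -> p t = q t) -> T p e = T q e.
Proof.
move=> cp h; apply: ls_hom => //; last exact: path_homotopic_refl.
exact: within_ext cp.
Qed.

(** Both sides follow [p] along paths with common ends in the convex parameter interval. As the
    order of a, b, c is free, the case c = a yields inverses. *)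
Lemma ls_sub p a b c e : is_path p -> @I01 R a -> @I01 R b -> @I01 R c ->
  T (sub p b c) (T (sub p a b) e) = T (sub p a c) e.
Proof.
move=> cp ha hb hc.
rewrite -ls_cat; try exact: sub_path; last by rewrite sub0 sub1.
pose u (x y : R) (t : R) := x + t * (y - x).
have uI x y t : @I01 R x -> @I01 R y -> @I01 R t -> @I01 R (u x y t) by exact: I01_conv.
have cu x y : is_path (u x y) by rewrite /u; cont.
have -> : pcat (sub p a b) (sub p b c) = p \o pcat (u a b) (u b c).
  by apply: functional_extensionality_dep => t; rewrite /pcat /=; case: ifP.
have cc : is_path (pcat (u a b) (u b c)).
  by apply: pcat_path => //; rewrite /u; ring.
have cI : forall t, @I01 R t -> @I01 R (pcat (u a b) (u b c) t).
  by apply: pcat_range => t ht; apply: uI.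
apply: ls_hom; first exact: within_comp cp.
  exact: sub_path.
apply: (@reparam_homotopic _ _ p _ (u a c)) => //.
- by move=> t; apply: uI.
- by rewrite pcat0 /u; ring.
- by rewrite pcat1 /u; ring.
Qed.

Lemma ls_loop p a e : T (sub p a a) e = e.
Proof.
have -> : sub p a a = fun=> p a; last exact: ls_cst.
by apply: functional_extensionality_dep => t; rewrite /sub subrr mulr0 addr0.
Qed.

Lemma ls_prevK p e : is_path p -> T (@Defs.prev R S p) (T p e) = e.
Proof.
move=> cp; rewrite prev_sub -{2}(sub01 p) ls_sub ?ls_loop //.
- exact: I01_0.
- exact: I01_1.
- exact: I01_0.
Qed.

Lemma ls_Kprev p e : is_path p -> T p (T (@Defs.prev R S p) e) = e.
Proof.
move=> cp; rewrite prev_sub -{1}(sub01 p) ls_sub ?ls_loop //.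
- exact: I01_1.
- exact: I01_0.
- exact: I01_1.
Qed.

(** The two ways round the boundary are homotopic because the square is convex. *)
Lemma ls_square (G : R * R -> S) e : {within @square R, continuous G} ->
  T (fun t => G (1, t)) (T (fun s => G (s, 0)) e) =
  T (fun s => G (s, 1)) (T (fun t => G (0, t)) e).
Proof.
move=> cG.
have c (u : R -> R * R) : is_path u -> (forall t, @I01 R t -> @square R (u t)) ->
    is_path (G \o u) by move=> cu hu; apply: within_comp cG.
have [i0 i1] := (@I01_0 R, @I01_1 R).
have c1 : is_path (fun t : R => (1 : R, t)) by cont.
have c2 : is_path (fun s : R => (s, 0 : R)) by cont.
have c3 : is_path (fun s : R => (s, 1 : R)) by cont.
have c4 : is_path (fun t : R => (0 : R, t)) by cont.
have d1 : forall t, @I01 R t -> @square R (1 : R, t) by [].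
have d2 : forall t, @I01 R t -> @square R (t, 0 : R) by [].
have d3 : forall t, @I01 R t -> @square R (t, 1 : R) by [].
have d4 : forall t, @I01 R t -> @square R (0 : R, t) by [].
have ca (p q : R -> R * R) : G \o pcat p q = pcat (G \o p) (G \o q).
  by apply: functional_extensionality_dep => t; rewrite /pcat /=; case: ifP.
rewrite -ls_cat; first last => //; try exact: (c _ _).
rewrite -ls_cat; first last => //; try exact: (c _ _).
rewrite -(ca (fun s => (s, 0)) (fun t => (1, t))) -(ca (fun t => (0, t)) (fun s => (s, 1))).
have p1 := pcat_path c2 c1 erefl; have p2 := pcat_path c4 c3 erefl.
have r1 := pcat_range d2 d1; have r2 := pcat_range d4 d3.
apply: ls_hom; try exact: c.
by apply: (@convex_homotopy _ _ _ G) cG p1 p2 r1 r2 _ _; [exact: square_convex | rewrite !pcat0 | rewrite !pcat1].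
Qed.

(** The set of times up to which [N] agrees with transport from 0 is locally constant, and the
    interval is connected. *)
Lemma flat_path p (N : R -> F) : is_path p ->
  (forall t, @I01 R t -> exists2 d, 0 < d & forall a b, @I01 R a -> @I01 R b ->
     `|t - a| < d -> `|t - b| < d -> T (sub p a b) (N a) = N b) ->
  T p (N 0) = N 1.
Proof.
move=> cp loc; have [i0 i1] := (@I01_0 R, @I01_1 R).
rewrite -[in T p](sub01 p).
apply: (@connected_loc _ (@I01 R) (fun t => T (sub p 0 t) (N 0) = N t)) i0 i1 _; last exact: ls_loop.
  exact: segment_connected.
move=> t it; have [d d0 hd] := loc t it.
apply/nbhs_ballP; exists d => //= y hy iy; rewrite -(@ls_sub p 0 t y) //; last exact: I01_0.
have tt : `|t - t| < d by rewrite subrr normr0.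
split=> [e|->]; last exact: hd.
have := hd y t iy it hy tt; by rewrite -e ls_sub // ls_loop.
Qed.

Section Flat.
Variable U : topologicalType.
Implicit Types (f : U -> S) (A B V : set U) (n : U -> F).

(** A flat section of the local system pulled back along [f]. It is indexed by the parameter space,
    since [f] need not be injective: points with the same image may carry different values until
    they are glued. *)
Definition flat f A n : Prop := forall w : R -> U, is_path w ->
  (forall t, @I01 R t -> A (w t)) -> T (f \o w) (n (w 0)) = n (w 1).

Lemma flat_sub f A B n : B `<=` A -> flat f A n -> flat f B n.
Proof. by move=> BA h w cw wB; apply: h => // t /wB /BA. Qed.

Lemma flat_eq f A n n' : {in A, n =1 n'} -> flat f A n -> flat f A n'.
Proof.
move=> e h w cw wA; rewrite -!e ?inE; [exact: h | |].
  by apply/wA/I01_1.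
by apply/wA/I01_0.
Qed.

Lemma flat_local f A n : {within A, continuous f} ->
  (forall x, A x -> exists2 V, nbhs x V & flat f (A `&` V) n) -> flat f A n.
Proof.
move=> cf loc w cw wA; have cfw : is_path (f \o w) by apply: within_comp cf.
apply: (@flat_path (f \o w) (n \o w)) => // t it.
have [V hV fl] := loc _ (wA t it).
have [d d0 hd] : exists2 d, 0 < d & forall y, `|t - y| < d -> @I01 R y -> V (w y).
  by move/withinP: cw => /(_ t it V hV) /nbhs_ballP [d d0 hd]; exists d.
exists d => // a b ia ib ha hb.
rewrite -[sub (f \o w) a b]/(f \o sub w a b) /= -[in n (w a)](sub0 w a b) -[in n (w b)](sub1 w a b).
apply: fl; first exact: sub_path.
move=> s hs; have iab := I01_conv ia ib hs; split; first exact: wA.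
apply: hd => //; move/I01P: hs => /andP[s0 s1].
(* A point between [a] and [b] is no farther from [t] than the farther of the two. *)
have -> : t - (a + s * (b - a)) = (1 - s) * (t - a) + s * (t - b) by ring.
apply: (le_lt_trans (ler_normD _ _)); rewrite !normrM (ger0_norm s0) ger0_norm ?subr_ge0 //.
by clear -ha hb s0 s1; move: `|t - a| `|t - b| ha hb => x y hx hy; case: (leP s 2^-1) => h; nra.
Qed.

Lemma flat_glue f A V1 V2 n : {within A, continuous f} -> open V1 -> open V2 ->
  A `<=` V1 `|` V2 -> flat f (A `&` V1) n -> flat f (A `&` V2) n -> flat f A n.
Proof.
move=> cf hV1 hV2 cov f1 f2; apply: flat_local => // x Ax.
by case: (cov x Ax) => h; [exists V1 | exists V2] => //; exact: open_nbhs_nbhs.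
Qed.

(** Transport along the tracks of a homotopy preserves flatness, by [ls_square] applied to the strip
    swept out by a path. *)
Lemma flat_push A (H : U * R -> S) (n : U -> F) :
  {within A `*` @I01 R, continuous H} -> flat (fun z => H (z, 0)) A n ->
  flat (fun z => H (z, 1)) A (fun z => T (fun t => H (z, t)) (n z)).
Proof.
move=> cH fl w cw wA.
have cG : {within @square R, continuous (fun x : R * R => H (w x.2, x.1))}.
  apply: (@within_comp _ _ _ _ (A `*` @I01 R) (fun x : R * R => (w x.2, x.1)) H) => //.
    apply: within_pair; last by cont.
    by apply: (@within_comp _ _ _ _ (@I01 R) snd w) => //; [cont | move=> x []].
  by move=> x [x1 x2]; split=> //=; exact: wA.
have := ls_square (n (w 0)) cG; rewrite /=.
by have := fl w cw wA; rewrite /comp /= => -> <-.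
Qed.

Lemma flat_agree f A n n' a b (w : R -> U) : flat f A n -> flat f A n' ->
  is_path w -> (forall t, @I01 R t -> A (w t)) -> w 0 = a -> w 1 = b ->
  n a = n' a -> n b = n' b.
Proof. by move=> h h' cw wA <- <- e; rewrite -h // -h' // e. Qed.

Definition pconn A : Prop := forall a b, A a -> A b ->
  exists w : R -> U, [/\ is_path w, w 0 = a, w 1 = b & forall t, @I01 R t -> A (w t)].

Lemma flat_pconn f A n n' a b : pconn A -> A a -> A b -> flat f A n -> flat f A n' ->
  n a = n' a -> n b = n' b.
Proof.
by move=> pc Aa Ab h h' e; have [w [cw w0 w1 wA]] := pc a b Aa Ab; exact: (flat_agree h h' cw wA w0 w1 e).
Qed.

Definition contractible A (z0 : U) : Prop := exists H : U * R -> U,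
  {within A `*` @I01 R, continuous H} /\
  forall z, A z -> [/\ H (z, 0) = z0, H (z, 1) = z & forall t, @I01 R t -> A (H (z, t))].

Lemma contr_path (X : topologicalType) A (H : U * R -> X) z : {within A `*` @I01 R, continuous H} -> A z ->
  is_path (fun t => H (z, t)).
Proof.
move=> cH Az; apply: (@within_comp _ _ _ _ (A `*` @I01 R) (fun t : R => (z, t)) H) => //.
by cont.
Qed.

Lemma contr_pconn A z0 : contractible A z0 -> pconn A.
Proof.
move=> [H [cH hH]] a b Aa Ab; have [a0 a1 aI] := hH a Aa; have [b0 b1 bI] := hH b Ab.
have ca := contr_path cH Aa; have cb := contr_path cH Ab.
exists (pcat (@Defs.prev R U (fun t => H (a, t))) (fun t => H (b, t))); split.
- by apply: pcat_path => //; [exact: prev_path | rewrite prev1 a0 b0].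
- by rewrite pcat0 prev0.
- by rewrite pcat1.
- apply: pcat_range => t it; last exact: bI.
  by apply: aI; move/I01P: it => /andP[h1 h2]; apply/I01P; apply/andP; split; lra.
Qed.

(** At time 0 the contraction is constant, so a constant section is flat there, and [flat_push]
    carries it to time 1. The starting value is [e] transported back from z1 to z0. *)
Lemma contr_section f A z0 z1 e : contractible A z0 -> {within A, continuous f} -> A z1 ->
  exists2 n : U -> F, flat f A n & n z1 = e.
Proof.
move=> [H [cH hH]] cf Az1.
have cH' : {within A `*` @I01 R, continuous (f \o H)}.
  by apply: within_comp cf => // -[z t] [/= Az it]; have [_ _] := hH z Az; apply.
pose p z t := f (H (z, t)).
exists (fun z => T (p z) (T (@Defs.prev R S (p z1)) e)); last first.
  by rewrite ls_Kprev //; apply: (contr_path cH').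
have fl : flat (fun z => f (H (z, 0))) A (fun=> T (@Defs.prev R S (p z1)) e).
  move=> w cw wA; have wz t : @I01 R t -> H (w t, 0) = z0.
    by move=> it; have [-> _ _] := hH (w t) (wA t it).
  rewrite -[RHS](ls_cst (f z0)); apply: ls_ext => [|t it /=]; last by rewrite wz.
  by apply: within_ext (@cst_path R S (f z0)) => t it /=; rewrite wz.
have := flat_push cH' fl => h w cw wA; rewrite -[RHS](h w cw wA).
apply: ls_ext => [|t it /=]; first exact: within_comp cf.
by have [_ -> _] := hH (w t) (wA t it).
Qed.

Lemma flat_patch f A V1 V2 n1 n2 : {within A, continuous f} -> open V1 -> open V2 ->
  A `<=` V1 `|` V2 -> flat f (A `&` V1) n1 -> flat f (A `&` V2) n2 ->
  (forall z, A z -> V1 z -> V2 z -> n1 z = n2 z) ->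
  exists n, [/\ flat f A n, forall z, A z -> V1 z -> n z = n1 z &
                forall z, A z -> V2 z -> n z = n2 z].
Proof.
move=> cf hV1 hV2 cov f1 f2 e.
pose n z := if pselect (V1 z) then n1 z else n2 z.
have e1 z : A z -> V1 z -> n z = n1 z by rewrite /n; case: pselect.
have e2 z : A z -> V2 z -> n z = n2 z.
  by rewrite /n; case: pselect => // h1 Az h2; exact: e.
exists n; split=> //; apply: (@flat_glue f A V1 V2) => //.
  by apply: flat_eq f1 => z; rewrite inE => -[Az hz]; rewrite e1.
by apply: flat_eq f2 => z; rewrite inE => -[Az hz]; rewrite e2.
Qed.

End Flat.
End Transport.

(** * The model pair of pants *)

Section Pants.
Variable R : realType.
Notation P := (@pants R).
Implicit Types z : R * R.

(* The line [z.2 = 0] cuts the pants into two contractible halves, which touch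
   along three gaps: left of, between and right of the holes. *)
Definition half (b : bool) : set (R * R) := [set z | 0 < (-1) ^+ b * z.2].
Definition gap (k : 'I_3) : set (R * R) :=
  [set z | `|z.2| < 2^-1 /\ [:: z.1 < - 2; `|z.1| < 3 / 2; 2 < z.1]`_k].
Definition gap_center (k : 'I_3) : R := [:: - (7 / 2); 0; 7 / 2]`_k.

Lemma ord3P (i : 'I_3) : [\/ i = inord 0, i = inord 1 | i = inord 2].
Proof.
case: i => [[|[|[|//]]] h]; [apply: Or31 | apply: Or32 | apply: Or33];
  by apply: val_inj; rewrite /= inordK.
Qed.

Lemma half_open b : open (half b).
Proof.
rewrite /half; apply: (@open_comp _ _ (fun z : R * R => (-1) ^+ b * z.2) [set x | 0 < x]).
  by move=> z _; apply: cvgM; [exact: cvg_cst | exact: cvg_snd].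
exact: open_gt.
Qed.

Lemma gap_open k : open (gap k).
Proof.
have c1 : continuous (fun z : R * R => z.1) by move=> z; exact: cvg_fst.
have c2 : continuous (fun z : R * R => z.2) by move=> z; exact: cvg_snd.
have n1 : continuous (fun z : R * R => `|z.1|) by move=> z; apply: cvg_norm; exact: c1.
have n2 : continuous (fun z : R * R => `|z.2|) by move=> z; apply: cvg_norm; exact: c2.
apply: openI.
  by apply: (@open_comp _ _ (fun z : R * R => `|z.2|) [set x | x < 2^-1]) => //; exact: open_lt.
case: (ord3P k) => ->; rewrite inordK //=.
- by apply: (@open_comp _ _ (fun z : R * R => z.1) [set x | x < - 2]) => //; exact: open_lt.
- by apply: (@open_comp _ _ (fun z : R * R => `|z.1|) [set x | x < 3 / 2]) => //; exact: open_lt.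
- by apply: (@open_comp _ _ (fun z : R * R => z.1) [set x | 2 < x]) => //; exact: open_gt.
Qed.

Lemma star_contractible (A : set (R * R)) z0 :
  (forall z t, A z -> @I01 R t -> A (z0.1 + t * (z.1 - z0.1), z0.2 + t * (z.2 - z0.2))) ->
  contractible R A z0.
Proof.
move=> h; exists (fun w => (z0.1 + w.2 * (w.1.1 - z0.1), z0.2 + w.2 * (w.1.2 - z0.2))); split.
  by cont.
move=> z Az /=; rewrite !mul0r !addr0 !mul1r -surjective_pairing; split=> //.
  by rewrite ![_ + (_ - _)]addrC !subrK -surjective_pairing.
by move=> t it; exact: h.
Qed.

Lemma pants_cover z : P z -> z.2 != 0 \/ exists k, gap k z.
Proof.
move=> [h0 h1 h2]; case: (eqVneq z.2 0) => e; [right|by left].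
rewrite /gap /= e normr0; rewrite e expr0n /= !addr0 in h0 h1 h2.
move: z.1 h0 h1 h2 => x h0 h1 h2.
case: (ltP x (- 2)) => a; first by exists (inord 0); rewrite inordK //=; split=> //; lra.
case: (ltP 2 x) => b; first by exists (inord 2); rewrite inordK //=; split=> //; lra.
exists (inord 1); rewrite inordK //=; split; first by lra.
by rewrite ltr_norml; apply/andP; split; nra.
Qed.

(** The squared norm minus one is a combination, with non-negative coefficients, of the two end
    values and of the inner product minus one. An inner product of at least 1 thus keeps the segment
    out of the unit disc. *)
Lemma star_hole (u v u0 v0 t : R) : 0 <= t <= 1 -> 1 <= u ^+ 2 + v ^+ 2 ->
  1 <= u0 ^+ 2 + v0 ^+ 2 -> 1 <= u0 * u + v0 * v ->
  1 <= (u0 + t * (u - u0)) ^+ 2 + (v0 + t * (v - v0)) ^+ 2.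
Proof.
move=> /andP[t0 t1] h1 h2 h3.
have -> : (u0 + t * (u - u0)) ^+ 2 + (v0 + t * (v - v0)) ^+ 2 =
  1 + (1 - t) ^+ 2 * (u0 ^+ 2 + v0 ^+ 2 - 1) + 2 * (t * (1 - t)) * (u0 * u + v0 * v - 1)
  + t ^+ 2 * (u ^+ 2 + v ^+ 2 - 1) by ring.
have t2 : 0 <= t * (1 - t) by apply: mulr_ge0 => //; lra.
by rewrite -!addrA lerDl !addr_ge0 // mulr_ge0 ?sqr_ge0 ?mulr_ge0 //; lra.
Qed.

Lemma star_disc (u v u0 v0 t : R) : 0 <= t <= 1 -> u ^+ 2 + v ^+ 2 <= 16 ->
  u0 ^+ 2 + v0 ^+ 2 <= 16 ->
  (u0 + t * (u - u0)) ^+ 2 + (v0 + t * (v - v0)) ^+ 2 <= 16.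
Proof.
move=> /andP[t0 t1] h1 h2.
have -> : (u0 + t * (u - u0)) ^+ 2 + (v0 + t * (v - v0)) ^+ 2 =
  (1 - t) * (u0 ^+ 2 + v0 ^+ 2) + t * (u ^+ 2 + v ^+ 2)
  - (t * (1 - t)) * ((u - u0) ^+ 2 + (v - v0) ^+ 2) by ring.
have t2 : 0 <= (t * (1 - t)) * ((u - u0) ^+ 2 + (v - v0) ^+ 2).
  by rewrite mulr_ge0 ?addr_ge0 ?sqr_ge0 // mulr_ge0 //; lra.
move: (u ^+ 2 + v ^+ 2) (u0 ^+ 2 + v0 ^+ 2) (_ * (_ + _)) h1 h2 t2 => a b c h1 h2 t2; nra.
Qed.

(** [None] is the whole gap and [Some b] its part in one half; both are star-shaped, the second
    about a centre raised or lowered by 1/4. One statement serves the section on the gap and the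
    connectedness of its overlap with a half. *)
Lemma gap_star k (b : option bool) :
  contractible R (P `&` gap k `&` (if b is Some b then half b else setT))
    (gap_center k, if b is Some b then (-1) ^+ b / 4 else 0).
Proof.
apply: star_contractible => -[x y] t /= [[[h0 h1 h2] [hy hx]] hb] it.
have /I01P t01 := it; have /andP[t0 t1] := t01.
rewrite /= in h0 h1 h2 hy hx.
set y0 := if b is Some b then (-1) ^+ b / 4 else 0.
have [[y1 y2] y3] : (- (1/4) <= y0 /\ y0 <= 1/4) /\ 0 <= y0 * y.
  rewrite /y0; case: b hb {y0} => [[|]|] /=; rewrite /half /= ?expr1 ?expr0 => hb; do ?split; lra.
have hb' : (if b is Some b then half b else setT) (gap_center k + t * (x - gap_center k), y0 + t * (y - y0)).
  rewrite /y0 {y1 y2 y3 y0}; case: b hb => [[|]|//] /=; rewrite /half /= ?expr1 ?expr0 => hb; nra.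
split=> //; move: {hb hb' b} y0 y1 y2 y3 => y0 y1 y2 y3.
move: hy; rewrite ltr_norml => /andP[y4 y5].
have q : y ^+ 2 <= 4^-1 by clear -y4 y5; nra.
have q0 : y0 ^+ 2 <= 4^-1 by clear -y1 y2; nra.
have q1 : 0 <= y0 ^+ 2 by exact: sqr_ge0.
have q' : - 2^-1 < y0 + t * (y - y0) < 2^-1.
  by clear -y1 y2 y4 y5 t0 t1; apply/andP; split; nra.
have key a c : 1 <= (x + a) ^+ 2 + y ^+ 2 -> 1 <= (c + a) ^+ 2 -> 1 <= (c + a) * (x + a) ->
    1 <= (c + t * (x - c) + a) ^+ 2 + (y0 + t * (y - y0)) ^+ 2.
  move=> e1 e2 e3; have -> : c + t * (x - c) + a = (c + a) + t * ((x + a) - (c + a)) by ring.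
  by apply: star_hole => //; lra.
have disc c : c ^+ 2 <= 15 -> (c + t * (x - c)) ^+ 2 + (y0 + t * (y - y0)) ^+ 2 <= 16.
  by move=> hc; apply: star_disc => //; lra.
(* In a gap y^2 <= 1/4, so a point outside a hole has abscissa more than 4/5 away from its centre.
   Against the gap centre, at distance at least 3/2, the inner product needed for [star_hole] is at
   least 6/5. *)
have far u : 1 <= u ^+ 2 + y ^+ 2 -> 0 < u -> 4 / 5 < u.
  by clear -q => h u0; rewrite ltNge; apply/negP => hu; nra.
rewrite /gap /= ltr_norml q' /gap_center.
case: (ord3P k) hx => ->; rewrite inordK //= => hx; (split; last split=> //).
- have f1 : 4 / 5 < - (x + 2) by apply: far; [rewrite sqrrN | lra].
  split=> /=; [apply: disc; lra | apply: key => //; lra |].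
  by apply: (key (- 2)) => //; lra.
- by clear -hx t0 t1; case: (ltP t 1) => h; nra.
- move: hx; rewrite ltr_norml => /andP[x1 x2].
  have f1 : 4 / 5 < x + 2 by apply: far => //; lra.
  have f2 : 4 / 5 < - (x - 2) by apply: far; [rewrite sqrrN | lra].
  split=> /=; [apply: disc; lra | apply: key => //; lra |].
  by apply: (key (- 2)) => //; lra.
- move: hx; rewrite !ltr_norml => /andP[x1 x2].
  by clear -x1 x2 t0 t1; apply/andP; split; case: (ltP t 1) => h; nra.
- have f1 : 4 / 5 < x - 2 by apply: far => //; lra.
  split=> /=; [apply: disc; lra | apply: key => //; lra |].
  by apply: (key (- 2)) => //; lra.
- by clear -hx t0 t1; case: (ltP t 1) => h; nra.
Qed.

(** From the top or bottom point of the outer circle the track of (x, y) first follows the outer arc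
    up to abscissa x, then descends vertically to (x, y). On the vertical part |z.2| is at least
    |y|, so no hole is entered. Here u t is the minimum of 2 t and 1. *)
Lemma half_contractible b : contractible R (P `&` half b) (0, (-1) ^+ b * 4).
Proof.
pose u (t : R) := (2 * t + 1 - `|2 * t - 1|) / 2.
pose arc (x : R) := (-1) ^+ b * Num.sqrt (16 - x ^+ 2).
exists (fun w => (u w.2 * w.1.1, arc (u w.2 * w.1.1) + (2 * w.2 - u w.2) * (w.1.2 - arc (u w.2 * w.1.1)))).
split; first by rewrite /u /arc; cont.
move=> [x y] [[/= h0 h1 h2] hy]; rewrite /half /= in hy.
have ss : (-1) ^+ b * (-1) ^+ b = 1 :> R by rewrite -expr2 sqrr_sign.
have u0 : u 0 = 0 by rewrite /u mulr0 sub0r normrN normr1; lra.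
have u1 : u 1 = 1 by rewrite /u ger0_norm; lra.
split.
- rewrite u0 mul0r mulr0 subrr mul0r addr0 /arc expr0n /= subr0.
  by have -> : 16 = 4 ^+ 2 :> R; [lra | rewrite sqrtr_sqr ger0_norm].
- rewrite u1; congr pair; lra.
move=> t /I01P/andP[t0 t1].
pose c : R := (-1) ^+ b.
have [ut [hu hv]] : 0 <= u t <= 1 /\ (0 <= 2 * t - u t <= 1 /\ (u t = 1 \/ 2 * t - u t = 0)).
  rewrite /u; case: (leP 0 (2 * t - 1)) => h.
    by rewrite ger0_norm //; split; [lra | split; [lra | left; lra]].
  by rewrite ltr0_norm //; split; [lra | split; [lra | right; lra]].
have cc : c * c = 1 by exact: ss.
have arcE (w : R) : w ^+ 2 < 16 -> w ^+ 2 + arc w ^+ 2 = 16 /\ 0 < c * arc w.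
  move=> hw; split.
    by rewrite /arc exprMn sqrr_sign mul1r sqr_sqrtr; lra.
  by rewrite /arc mulrA ss mul1r sqrtr_gt0; lra.
have y20 : 0 < y ^+ 2.
  by rewrite lt0r sqr_ge0 andbT sqrf_eq0; apply: contraTneq hy => ->; rewrite mulr0 ltxx.
have x16 : x ^+ 2 < 16 by lra.
have {hy} : 0 < c * y by [].
case: hv => e hy.
  rewrite e in hu *; rewrite mul1r; have [a1 a2] := arcE x x16.
  move: (arc x) (2 * t - 1) a1 a2 hu => a v a1 a2 /andP[v0 v1].
  pose Y := c * a + v * (c * y - c * a).
  have YE : Y = c * (a + v * (y - a)) by rewrite /Y; ring.
  have e2 w : (c * w) ^+ 2 = w ^+ 2 by rewrite exprMn expr2 cc mul1r.
  have : (a + v * (y - a)) ^+ 2 = Y ^+ 2 by rewrite YE e2.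
  rewrite /half /= -/c -YE /Y -(e2 y) -(e2 a) in h0 h1 h2 a1 *.
  rewrite /pants /=; move: (c * a) (c * y) (a + v * (y - a)) a1 a2 hy h0 h1 h2 => A B y' a1 a2 hy h0 h1 h2 ->.
  have AB : B <= A by clear -a1 a2 h0 hy; nra.
  have l1 : B <= A + v * (B - A) by clear -AB v0 v1; nra.
  have l2 : A + v * (B - A) <= A by clear -AB v0 v1; nra.
  move: (A + _) l1 l2 => Y' l1 l2.
  have m1 : B ^+ 2 <= Y' ^+ 2 by clear -l1 hy; nra.
  have m2 : Y' ^+ 2 <= A ^+ 2 by clear -l1 l2 hy; nra.
  by split; [split|]; lra.
rewrite e mul0r addr0.
have w16 : (u t * x) ^+ 2 < 16.
  rewrite exprMn; move: (u t) ut => w /andP[w0 w1].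
  have : w ^+ 2 <= 1 by clear -w0 w1; nra.
  by have := sqr_ge0 x; move: (x ^+ 2) (w ^+ 2) x16 => X W; nra.
have [a1 a2] := arcE _ w16; split=> //.
rewrite /pants /=; move: {a2} (arc (u t * x)) (u t * x) a1 w16 => a w a1 w16.
have w4 : - 4 <= w <= 4 by clear -w16; apply/andP; split; nra.
by case/andP: w4 => w5 w6; split; lra.
Qed.

(** The pants slit along the two gaps other than [k]. Boundary circle i runs its first half in
    region i and its second half in region [ordS i], which makes the three regions a cyclic cover
    adapted to the boundary loops. *)
Definition region (k : 'I_3) : set (R * R) := half true `|` gap k `|` half false.
Definition gap_point (k : 'I_3) (b : bool) : R * R := (gap_center k, (-1) ^+ b / 4).

Lemma gap_pointP k b : (P `&` gap k `&` half b) (gap_point k b).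
Proof.
rewrite /gap_point /gap_center; split; last first.
  by rewrite /half /= mulrA -expr2 sqrr_sign; lra.
by case: (ord3P k) => ->; case: b; rewrite /pants /gap inordK //= ?expr1 ?expr0;
  (split; [by split; lra | split; rewrite ?ltr_norml]); try (apply/andP; split); lra.
Qed.

Lemma halfE z : z.2 != 0 <-> exists b, half b z.
Proof.
rewrite /half /=; split=> [h|[b]]; last by apply: contraTneq => ->; rewrite mulr0 ltxx.
case: (ltP 0 z.2) => h'; first by exists false; rewrite expr0 mul1r.
by exists true; rewrite expr1 mulN1r oppr_gt0 lt_neqAle h h'.
Qed.

Lemma half_region b k z : half b z -> region k z.
Proof. by case: b => h; [left; left | right]. Qed.

Lemma regionE k z : region k z <-> z.2 != 0 \/ gap k z.
Proof.
split=> [[[h|h]|h]|[/halfE[b hb]|h]]; [left|by right|left| |by left; right].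
- by apply/halfE; exists true.
- by apply/halfE; exists false.
- exact: half_region hb.
Qed.

Lemma region_open k : open (region k).
Proof. by apply: openU; [apply: openU|]; do ?[exact: half_open | exact: gap_open]. Qed.

Lemma bdry_path i : is_path (@bdry R i).
Proof. by case: (ord3P i) => ->; rewrite /bdry inordK //=; cont. Qed.

Lemma bdry_pants i t : P (bdry i t).
Proof.
rewrite /pants /=; have := cos2Dsin2 (2 * pi * t).
have := cos_geN1 (2 * pi * t); have := cos_le1 (2 * pi * t).
have := sin_geN1 (2 * pi * t); have := sin_le1 (2 * pi * t).
by case: (ord3P i) => ->; rewrite /bdry inordK //=;
  move: (cos _) (sin _) => c s h1 h2 h3 h4 h5; split; lra.
Qed.

Lemma bdry_region i t : @I01 R t ->
  (t <= 2^-1 -> region i (bdry i t)) /\ (2^-1 <= t -> region (ordS i) (bdry i t)).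
Proof.
move=> /I01P/andP[t0 t1].
have hp := pi_gt0 R; have cs := cos2Dsin2 (2 * pi * t).
have k0 (k : 'I_3) z : (z.2 = 0 -> gap k z) -> region k z.
  by move=> h; apply/regionE; case: (eqVneq z.2 0) => e; [right; exact: h | left].
have sgn (s : R) : 0 <= s -> s ^+ 2 = 1 -> s = 1.
  by move=> s0 /eqP; rewrite sqrf_eq1 => /orP[/eqP//|/eqP]; lra.
split=> ht; apply: k0 => e.
  have : 0 <= sin (2 * pi * t) by apply: sin_ge0_pi; apply/andP; split; nra.
  rewrite /gap /= e normr0.
  move: e cs; case: (ord3P i) => ->; rewrite /bdry !inordK //=;
    move: (cos _) (sin _) => c s e cs s0;
    (have c0 : c = 0 by lra); rewrite c0 expr0n add0r in cs; rewrite (sgn s) //;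
    (split; first by lra); rewrite ?ltr_norml; try lra.
have : 0 <= - sin (2 * pi * t).
  rewrite -sinN; have -> : - (2 * pi * t) = (2 * pi - 2 * pi * t) - 2 * pi by ring.
  have -> : 2 * pi = pi *+ 2 :> R by rewrite mulr_natl.
  rewrite -(sinD2pi (_ - _)) subrK; apply: sin_ge0_pi.
  by rewrite -mulr_natl; apply/andP; split; nra.
rewrite /gap /= e normr0.
move: e cs; case: (ord3P i) => ->; rewrite /bdry /= !inordK //=;
    move: (cos _) (sin _) => c s e cs s0;
    (have c0 : c = 0 by lra); rewrite c0 expr0n add0r -sqrrN in cs;
    (have {cs s0} s0 := sgn _ s0 cs);
    (split; first by lra); rewrite ?ltr_norml; try lra.
Qed.

Lemma bdry01 i : @bdry R i 1 = bdry i 0.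
Proof.
rewrite /bdry mulr1 mulr0 sin0 cos0 mulr_natl sin2pi cos2pi //.
Qed.

Lemma bdry_top i : half false (@bdry R i 2^-1).
Proof.
have -> : half false (@bdry R i 2^-1) = (0 < (@bdry R i 2^-1).2) by rewrite /half /= expr0 mul1r.
have e : 2 * pi / 2 = pi :> R by rewrite mulrAC divff ?mul1r // pnatr_eq0.
by case: (ord3P i) => ->; rewrite /bdry inordK //= e cospi; lra.
Qed.

Lemma tail_path i : is_path (@tail R i).
Proof. by rewrite /tail; cont. Qed.

Lemma tail0 i : @tail R i 0 = pants_base R.
Proof. by rewrite /tail subr0 !mul1r !mul0r !addr0. Qed.

Lemma tail1 i : @tail R i 1 = bdry i 0.
Proof. by rewrite /tail subrr !mul0r !mul1r !add0r -surjective_pairing. Qed.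

Lemma tail_half i t : @I01 R t -> (P `&` half true) (tail i t).
Proof.
move=> /I01P/andP[t0 t1]; rewrite /tail /pants /half /=.
by case: (ord3P i) => ->; rewrite /bdry !inordK //= (mulr0 (2 * pi)) sin0 cos0 expr1;
  (split; first split); nra.
Qed.

Lemma base_half : (P `&` half true) (pants_base R).
Proof. by rewrite -(tail0 (inord 0)); apply: tail_half; exact: I01_0. Qed.
End Pants.

(** * Local systems on a pair of pants *)

Section PantsSystem.
Variables (R : realType) (S : topologicalType) (F : Type) (T : (R -> S) -> F -> F).
Hypothesis hT : local_system T.
Variable f : R * R -> S.
Notation P := (@pants R).
Hypothesis cf : {within P, continuous f}.
Implicit Types (z : R * R) (e : F) (n : R * R -> F).

Lemma within_sub (A B : set (R * R)) : A `<=` B -> {within B, continuous f} -> {within A, continuous f}.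
Proof. exact: continuous_subspaceW. Qed.

Lemma pants_pathf w : is_path w -> (forall t, @I01 R t -> P (w t)) -> is_path (f \o w).
Proof. by move=> cw wP; apply: within_comp cf. Qed.

Lemma bdry_pathf i : is_path (f \o bdry i).
Proof. by apply: pants_pathf; [exact: bdry_path | move=> t _; exact: bdry_pants]. Qed.

Lemma tail_pathf i : is_path (f \o tail i).
Proof. by apply: pants_pathf; [exact: tail_path | move=> t /(tail_half i) []]. Qed.

Lemma half_pconn b : pconn R (P `&` half b).
Proof. exact: contr_pconn (half_contractible R b). Qed.

Lemma gap_half_pconn k b : pconn R (P `&` gap k `&` half b).
Proof. exact: contr_pconn (gap_star R k (Some b)). Qed.

Lemma half_agree b k k' n n' z1 z : flat T f (P `&` region k) n -> flat T f (P `&` region k') n' ->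
  (P `&` half b) z1 -> n z1 = n' z1 -> (P `&` half b) z -> n z = n' z.
Proof.
move=> h h' h1 e hz; have sub j : P `&` half b `<=` P `&` region j.
  by move=> y [y1 y2]; split=> //; exact: half_region y2.
apply: (@flat_pconn _ _ _ T _ f (P `&` half b) n n' z1 z) => //.
- exact: half_pconn.
- exact: flat_sub (sub k) h.
- exact: flat_sub (sub k') h'.
Qed.

(** A section on one half is continued through the gap to the other half. The pieces are
    contractible and consecutive ones meet in path-connected sets, so agreement at a [gap_point]
    spreads over each overlap. *)
Lemma region_section k b z1 e : (P `&` half b) z1 ->
  exists2 n, flat T f (P `&` region k) n & n z1 = e.
Proof.
move=> h1.
have cs (A : set (R * R)) : {within P `&` A, continuous f}.
  by apply: within_sub cf => z [].
have [n0 f0 e0] := contr_section hT e (half_contractible R b) (cs _) h1.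
have [gP1 gh1] := gap_pointP R k b; have [gP2 gh2] := gap_pointP R k (~~ b).
have cg : contractible R (P `&` gap k) (gap_center R k, 0).
  by have := gap_star R k None; rewrite setIT.
have [m fm em] := contr_section hT (n0 (gap_point R k b)) cg (cs _) gP1.
have [n2 f2 e2] := contr_section hT (m (gap_point R k (~~ b))) (half_contractible R (~~ b)) (cs _)
  (conj gP2.1 gh2).
have agree b' n' z : flat T f (P `&` half b') n' -> n' (gap_point R k b') = m (gap_point R k b') ->
    P z -> half b' z -> gap k z -> n' z = m z.
  move=> h' e' Pz hz gz; have [a1 a2] := gap_pointP R k b'.
  apply: (@flat_pconn _ _ _ T _ f (P `&` gap k `&` half b') n' m (gap_point R k b')) => //.
  - exact: gap_half_pconn.
  - by apply: flat_sub h' => y [[y1 _] y2].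
  - by apply: flat_sub fm => y [[y1 y2] _].
have [n1 [f1 e11 e12]] := @flat_patch _ _ _ T hT _ f (P `&` (half b `|` gap k)) (half b) (gap k) n0 m
  (cs _) (@half_open R b) (@gap_open R k) ltac:(by move=> z []) ltac:(by apply: flat_sub f0 => z [[z1' _] z2'])
  ltac:(by apply: flat_sub fm => z [[z1' _] z2']) ltac:(by move=> z [z1' _] z2' z3'; apply: (agree b)).
have bb z : half b z -> half (~~ b) z -> False.
  by rewrite /half /=; case: (b); rewrite /= ?expr1 ?expr0; lra.
have over z : (P `&` region k) z -> (half b `|` gap k) z -> half (~~ b) z -> n1 z = n2 z.
  move=> [Pz _] [z2'|z2'] z3'; first by case: (bb z).
  by rewrite e12; [symmetry; apply: (agree (~~ b)) | split=> //; right |].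
have [n [fn en1 en2]] := @flat_patch _ _ _ T hT _ f (P `&` region k) (half b `|` gap k) (half (~~ b)) n1 n2
  (cs _) (openU (@half_open R b) (@gap_open R k)) (@half_open R (~~ b))
  ltac:(by move=> z [_]; rewrite /region; case: (b) => -[[h|h]|h]; by [left; left|left; right|right])
  ltac:(by apply: flat_sub f1 => z [[z1' _] z2'])
  ltac:(by apply: flat_sub f2 => z [[z1' _] z2'])
  over.
case: h1 => p1 p2; have q1 : (P `&` region k) z1 by split=> //; exact: half_region p2.
have q2 : (half b `|` gap k) z1 by left.
by exists n => //; rewrite en1 // e11.
Qed.

Lemma tail_transport k i n : flat T f (P `&` region k) n ->
  T (f \o tail i) (n (pants_base R)) = n (bdry i 0).
Proof.
move=> h; rewrite -(tail0 R i) -tail1; apply: h; first exact: tail_path.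
by move=> t it; have [a b] := tail_half i it; split=> //; exact: half_region b.
Qed.

Lemma bdry_transport i n n' : flat T f (P `&` region i) n -> flat T f (P `&` region (ordS i)) n' ->
  n (bdry i 2^-1) = n' (bdry i 2^-1) -> T (f \o bdry i) (n (bdry i 0)) = n' (bdry i 0).
Proof.
move=> h h' e; have [i0 i1 ih] := And3 (@I01_0 R) (@I01_1 R) (@I01_half R).
have cb := @bdry_pathf i; have cb' := @bdry_path R i.
rewrite -[f \o _]sub01 -(@ls_sub _ _ _ T hT _ 0 2^-1 1) //.
have -> : T (sub (f \o bdry i) 0 2^-1) (n (bdry i 0)) = n (bdry i 2^-1).
  rewrite -{1}(sub0 (bdry i) 0 2^-1) -(sub1 (bdry i) 0 2^-1).
  apply: (h (sub (bdry i) 0 2^-1)); first exact: sub_path.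
  move=> t it; split; first exact: bdry_pants.
  have [b1 _] := bdry_region i (I01_conv i0 ih it); apply: b1.
  by move/I01P: it => /andP[t0 t1]; lra.
rewrite e -(bdry01 R i) -{1}(sub0 (bdry i) 2^-1 1) -(sub1 (bdry i) 2^-1 1).
apply: (h' (sub (bdry i) 2^-1 1)); first exact: sub_path.
move=> t it; split; first exact: bdry_pants.
have [_ b1] := bdry_region i (I01_conv ih i1 it); apply: b1.
by move/I01P: it => /andP[t0 t1]; lra.
Qed.

Definition lasso i (e : F) : F :=
  T (@Defs.prev R S (f \o tail i)) (T (f \o bdry i) (T (f \o tail i) e)).

(** Lasso i goes from the lower half to the upper half in region i and returns in region [ordS i];
    the two sections may be exchanged at the top, where they agree. *)
Lemma lasso_transport i n n' : flat T f (P `&` region i) n -> flat T f (P `&` region (ordS i)) n' ->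
  (forall z, (P `&` half false) z -> n z = n' z) -> lasso i (n (pants_base R)) = n' (pants_base R).
Proof.
move=> h h' e; rewrite /lasso (tail_transport i h) (bdry_transport h h'); last first.
  by apply: e; split; [exact: bdry_pants | exact: bdry_top].
by rewrite -(tail_transport i h') ls_prevK //; exact: tail_pathf.
Qed.

Lemma ordS3 : [/\ ordS (inord 0 : 'I_3) = inord 1, ordS (inord 1 : 'I_3) = inord 2 &
  ordS (inord 2 : 'I_3) = inord 0].
Proof. by split; apply: val_inj; rewrite /= !inordK. Qed.

(** With sections n0, n1, n2 on the three regions that agree on the upper half, the three lassos
    carry the base value of n0 to that of n1, then of n2, then back. *)
Lemma lasso_relation e : lasso (inord 2) (lasso (inord 1) (lasso (inord 0) e)) = e.
Proof.
have [s0 s1 s2] := ordS3.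
have top : (P `&` half false) (bdry (inord 0) 2^-1) by split; [exact: bdry_pants | exact: bdry_top].
have [n0 f0 e0] := region_section (inord 0) e (base_half R).
have [n1 f1 e1] := region_section (inord 1) (n0 (bdry (inord 0) 2^-1)) top.
have [n2 f2 e2] := region_section (inord 2) (n1 (bdry (inord 0) 2^-1)) top.
have a01 z : (P `&` half false) z -> n0 z = n1 z by apply: (half_agree f0 f1 top); rewrite e1.
have a12 z : (P `&` half false) z -> n1 z = n2 z by apply: (half_agree f1 f2 top); rewrite e2.
rewrite -{1}e0 (@lasso_transport _ _ n1) ?s0 // (@lasso_transport _ _ n2) ?s1 //.
by rewrite (@lasso_transport _ _ n0) ?s2 // => z hz; rewrite a01 ?a12.
Qed.

(** The sections on the three regions are chosen to agree at the base point, hence on the lower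
    half. Invariance under lassos 0 and 1 makes them agree on the upper half as well, so that they
    can be patched. *)
Lemma pants_section e :
  (forall i : 'I_3, i != inord 2 -> T (f \o bdry i) (T (f \o tail i) e) = T (f \o tail i) e) ->
  exists2 n, flat T f P n & n (pants_base R) = e.
Proof.
move=> fix01; have [s0 s1 s2] := ordS3.
have [n0 f0 e0] := region_section (inord 0) e (base_half R).
have [n1 f1 e1] := region_section (inord 1) e (base_half R).
have [n2 f2 e2] := region_section (inord 2) e (base_half R).
have up i n n' : i != inord 2 -> flat T f (P `&` region i) n ->
    flat T f (P `&` region (ordS i)) n' -> n (pants_base R) = e -> n' (pants_base R) = e ->
    forall b z, (P `&` half b) z -> n z = n' z.
  move=> ni h h' eb eb' [|] z hz.
    by apply: (half_agree h h' (base_half R)) hz; rewrite eb.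
  have top : (P `&` half false) (bdry i 2^-1) by split; [exact: bdry_pants | exact: bdry_top].
  apply: (half_agree h h' top) hz.
  have [n'' f'' e''] := region_section (ordS i) (n (bdry i 2^-1)) top.
  have := bdry_transport h f'' (esym e''); rewrite -(tail_transport i h) eb fix01 //.
  rewrite -{1}eb' (tail_transport i h') => e3.
  rewrite -e''; symmetry.
  apply: (flat_agree h' f'' (w := sub (bdry i) 1 2^-1)) e3.
  - by apply: sub_path; [exact: bdry_path | exact: I01_1 | exact: I01_half].
  - move=> t it; split; first exact: bdry_pants.
    have [_ b1] := bdry_region i (I01_conv (@I01_1 R) (@I01_half R) it); apply: b1.
    by move/I01P: it => /andP[t0 t1]; lra.
  - by rewrite sub0 bdry01.
  - by rewrite sub1.
have n02 : inord 0 != inord 2 :> 'I_3 by rewrite -val_eqE /= !inordK.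
have n01 : inord 0 != inord 1 :> 'I_3 by rewrite -val_eqE /= !inordK.
have n12 : inord 1 != inord 2 :> 'I_3 by rewrite -val_eqE /= !inordK.
have a01 := up _ n0 n1 n02 f0; rewrite s0 in a01; have {}a01 := a01 f1 e0 e1.
have a12 := up _ n1 n2 n12 f1; rewrite s1 in a12; have {}a12 := a12 f2 e1 e2.
have cs (A : set (R * R)) : {within P `&` A, continuous f}.
  by apply: within_sub cf => z [].
(* Distinct gaps are disjoint, so two regions meet inside the halves only. *)
have ov (i j : 'I_3) n n' z : i != j -> (forall b z, (P `&` half b) z -> n z = n' z) ->
    P z -> region i z -> region j z -> n z = n' z.
  move=> nij a Pz /regionE ri /regionE rj.
  have [b hb] : exists b, half b z; last exact: (a b).
  case: ri => [/halfE//|gi]; case: rj => [/halfE//|gj]; exfalso.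
  move: nij gi gj; rewrite /gap /= => nij [_ gi] [_ gj]; clear -nij gi gj; move: nij gi gj.
  by case: (ord3P i) => ->; case: (ord3P j) => ->; rewrite ?eqxx // !inordK //= => _;
    rewrite ?ltr_norml; do ?[move=> /andP[? ?]|move=> ?]; lra.
have [n3 [f3 e31 e32]] := @flat_patch _ _ _ T hT _ f (P `&` (region (inord 0) `|` region (inord 1)))
   (region (inord 0)) (region (inord 1)) n0 n1 (cs _) (@region_open _ _) (@region_open _ _)
  ltac:(by move=> z []) ltac:(by apply: flat_sub f0 => z [[z1' _] z2'])
  ltac:(by apply: flat_sub f1 => z [[z1' _] z2'])
  ltac:(by move=> z [z1' _] z2' z3'; apply: ov n01 a01 z1' z2' z3').
have a02 b z : (P `&` half b) z -> n0 z = n2 z by move=> hz; rewrite (a01 b) // (a12 b).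
have over z : P z -> (region (inord 0) `|` region (inord 1)) z -> region (inord 2) z -> n3 z = n2 z.
  move=> Pz [h|h] h2.
    by rewrite e31 //; [apply: ov n02 a02 Pz h h2 | split=> //; left].
  by rewrite e32 //; [apply: ov n12 a12 Pz h h2 | split=> //; right].
have [n [fn en1 en2]] := @flat_patch _ _ _ T hT _ f P (region (inord 0) `|` region (inord 1))
   (region (inord 2)) n3 n2 cf (openU (@region_open _ _) (@region_open _ _)) (@region_open _ _)
  ltac:(move=> z /pants_cover [h|[k h]]; [by left; left; apply/regionE; left|
    have {}h : region k z by apply/regionE; right]; case: (ord3P k) h => -> h;
     by [left; left|left; right|right])
  ltac:(by apply: flat_sub f3 => z [z1' z2'])
  ltac:(by apply: flat_sub f2 => z [z1' z2'])
  over.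
exists n => //; have [b1 b2] := base_half R.
by rewrite en2 //; exact: half_region b2.
Qed.
End PantsSystem.

(** * Boundary, compactness and local connectedness of the pants *)

Section PantsShape.
Variable R : realType.
Notation P := (@pants R).
Implicit Types z : R * R.

Lemma unit_circle (x y : R) : x ^+ 2 + y ^+ 2 = 1 ->
  exists t : R, [/\ 0 <= t, t < 1, cos (2 * pi * t) = x & sin (2 * pi * t) = y].
Proof.
move=> h; have hp := pi_gt0 R.
have x1 : -1 <= x <= 1 by have := sqr_ge0 y; move=> y2; apply/andP; split; nra.
have sa : sin (acos x) = `|y|.
  by rewrite sin_acos // -h addrC addKr sqrtr_sqr.
have [a0 a1] : 0 <= acos x /\ acos x <= pi by rewrite acos_ge0 ?acos_lepi.
have e (s : R) : 2 * pi * (s / (2 * pi)) = s by rewrite mulrC divfK // mulf_neq0 ?pnatr_eq0 ?gt_eqF.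
have p2 : 0 < 2 * pi :> R by lra.
case: (leP 0 y) => y0.
  exists (acos x / (2 * pi)); rewrite e acosK ?in_itv //= sa ger0_norm //; split=> //.
    by rewrite divr_ge0 // ltW.
  by rewrite ltr_pdivrMr // mul1r; lra.
have ag : 0 < acos x.
  rewrite lt_neqAle a0 andbT; apply/eqP => e0.
  by move: sa; rewrite -e0 sin0 => /esym/eqP; rewrite normr_eq0 => /eqP; lra.
exists ((2 * pi - acos x) / (2 * pi)); rewrite e; split.
- by rewrite divr_ge0 //; lra.
- by rewrite ltr_pdivrMr // mul1r; lra.
- by rewrite mulr_natl addrC cosD2pi cosN acosK ?in_itv.
- by rewrite mulr_natl addrC sinD2pi sinN sa ltr0_norm // opprK.
Qed.

Lemma pants_cases z : P z -> pants_interior z \/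
  exists i : 'I_3, exists t : R, [/\ 0 <= t, t < 1 & z = bdry i t].
Proof.
case: z => x y [/= h0 h1 h2].
have [e0|n0] := eqVneq (x ^+ 2 + y ^+ 2) 16.
  right; have /unit_circle [t [t0 t1 c s]] : (- y / 4) ^+ 2 + (x / 4) ^+ 2 = 1.
    by rewrite !exprMn sqrrN -mulrDl addrC e0; lra.
  by exists (inord 2), t; split=> //; rewrite /bdry inordK //= c s; congr pair; field.
have [e1|n1] := eqVneq ((x + 2) ^+ 2 + y ^+ 2) 1.
  right; have /unit_circle [t [t0 t1 c s]] : (- y) ^+ 2 + (- (x + 2)) ^+ 2 = 1.
    by rewrite !sqrrN addrC.
  by exists (inord 0), t; split=> //; rewrite /bdry inordK //= c s; congr pair; ring.
have [e2|n2] := eqVneq ((x - 2) ^+ 2 + y ^+ 2) 1.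
  right; have /unit_circle [t [t0 t1 c s]] : (- y) ^+ 2 + (- (x - 2)) ^+ 2 = 1.
    by rewrite !sqrrN addrC.
  by exists (inord 1), t; split=> //; rewrite /bdry inordK //= c s; congr pair; ring.
by left; split; rewrite lt_neqAle /= ?n0 ?h0 // eq_sym ?n1 ?n2.
Qed.

Lemma interior_pants z : pants_interior z -> P z.
Proof. by move=> [h0 h1 h2]; split; apply: ltW. Qed.

Lemma pants_compact : compact P.
Proof.
have c2 (a : R) : continuous (fun z : R * R => (z.1 + a) ^+ 2 + z.2 ^+ 2).
  move=> z; have c1 : (fun z : R * R => z.1 + a) @ z --> z.1 + a.
    by apply: cvgD; [exact: cvg_fst | exact: cvg_cst].
  have c3 : (fun z : R * R => z.2) @ z --> z.2 by exact: cvg_snd.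
  exact: cvgD (cvgM c1 c1) (cvgM c3 c3).
have B : compact (`[- 4 : R, 4]%classic `*` `[- 4 : R, 4]%classic).
  by apply: compact_setX; exact: segment_compact.
apply: subclosed_compact B _.
- have -> : P = (fun z : R * R => (z.1 + 0) ^+ 2 + z.2 ^+ 2) @^-1` [set x | x <= 16] `&`
     ((fun z : R * R => (z.1 + 2) ^+ 2 + z.2 ^+ 2) @^-1` [set x | 1 <= x] `&`
     (fun z : R * R => (z.1 + - 2) ^+ 2 + z.2 ^+ 2) @^-1` [set x | 1 <= x]).
    by rewrite eqEsubset; split=> z; rewrite /pants /= addr0 => -[h0]; [move=> h1 h2 | case].
  apply: closedI; last apply: closedI; apply: preimage_closed; do ?[by move=> z _; exact: c2];
    by [exact: closed_le | exact: closed_ge].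
- move=> [x y] [/= h0 _ _]; have := sqr_ge0 x; have := sqr_ge0 y => y2 x2.
  by split; rewrite /= in_itv /=; apply/andP; split; nra.
Qed.

(** A chord between points outside the unit disc dips at most to squared norm 1 - k. Stretching by 1
    + k repairs this, since (1 + k)^2 (1 - k) = 1 + k (1 - k - k^2) is at least 1 for k <= 1/2. *)
Lemma push_norm (a1 a2 b1 b2 t k : R) : 0 <= t <= 1 ->
  1 <= a1 ^+ 2 + a2 ^+ 2 -> 1 <= b1 ^+ 2 + b2 ^+ 2 ->
  k = t * (1 - t) * ((b1 - a1) ^+ 2 + (b2 - a2) ^+ 2) -> k <= 1 / 2 ->
  1 <= ((1 + k) * (a1 + t * (b1 - a1))) ^+ 2 + ((1 + k) * (a2 + t * (b2 - a2))) ^+ 2.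
Proof.
move=> /andP[t0 t1] ha hb kE k1.
have k0 : 0 <= k.
  by rewrite kE; apply: mulr_ge0; rewrite ?addr_ge0 ?sqr_ge0 //; apply: mulr_ge0 => //; lra.
have : 1 - k <= (a1 + t * (b1 - a1)) ^+ 2 + (a2 + t * (b2 - a2)) ^+ 2.
  have -> : (a1 + t * (b1 - a1)) ^+ 2 + (a2 + t * (b2 - a2)) ^+ 2 =
    (1 - t) * (a1 ^+ 2 + a2 ^+ 2) + t * (b1 ^+ 2 + b2 ^+ 2) - k by rewrite kE; ring.
  clear kE; move: (a1 ^+ 2 + a2 ^+ 2) (b1 ^+ 2 + b2 ^+ 2) ha hb => A B ha hb; nra.
rewrite !exprMn -mulrDr; move: (_ ^+ 2 + _ ^+ 2) => N hN.
apply: (@le_trans _ _ ((1 + k) ^+ 2 * (1 - k))); last first.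
  by apply: ler_wpM2l => //; exact: sqr_ge0.
by have : 0 <= k * (1 - k - k ^+ 2); [apply: mulr_ge0 => //; nra | lra].
Qed.

(* Near a hole the segment is pushed away from the centre of the hole. *)
Lemma pants_local z0 (W : set (R * R)) : P z0 -> nbhs z0 W ->
  nbhs z0 [set z | P z -> exists w : R -> R * R,
    [/\ is_path w, w 0 = z0, w 1 = z & forall t, @I01 R t -> P (w t) /\ W (w t)]].
Proof.
move=> P0 /nbhs_ballP [d0 /= d00 hd0].
pose d := Num.min (d0 / 5) (1 / 50).
have dp : 0 < d by rewrite lt_min; apply/andP; split; lra.
have [dd0 d1] : d <= d0 / 5 /\ d <= 1 / 50 by rewrite /d !ge_min lexx; split=> //; rewrite lexx orbT.
apply/nbhs_ballP; exists d => //= z hz Pz; clearbody d.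
case: z0 P0 hd0 hz => x0 y0 P0 hd0 [/= hx hy].
case: z Pz hx hy => x y Pz /= hx hy.
have {hx} [hx1 hx2] : x - x0 < d /\ x0 - x < d.
  by move: hx; rewrite /ball /= ltr_norml => /andP[? ?]; split; lra.
have {hy} [hy1 hy2] : y - y0 < d /\ y0 - y < d.
  by move: hy; rewrite /ball /= ltr_norml => /andP[? ?]; split; lra.
have inW u v : `|u - x0| < 5 * d -> `|v - y0| < 5 * d -> W (u, v).
  by move=> hu hv; apply: hd0; split; rewrite /ball /= distrC; lra.
have B0 u v : P (u, v) -> -4 <= u <= 4 /\ -4 <= v <= 4.
  move=> [/= h _ _]; have := sqr_ge0 u; have := sqr_ge0 v => v2 u2.
  by split; apply/andP; split; nra.
have [/andP[bx1 bx2] /andP[by1 by2]] := B0 _ _ P0.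
have lin (u v t : R) : 0 <= t <= 1 -> u - v < d -> v - u < d -> - d < t * (u - v) < d.
  by move=> /andP[t0 t1] h1 h2; apply/andP; split; nra.
(* Within squared distance 2 of the centre of a hole, the other hole and the outer circle are out of
   reach. At squared distance at least 2 from both centres, the straight segment avoids the
   holes. *)
have near c : c = 2 \/ c = - 2 -> (x0 - c) ^+ 2 + y0 ^+ 2 < 2 ->
    exists w : R -> R * R, [/\ is_path w, w 0 = (x0, y0), w 1 = (x, y) &
      forall t, @I01 R t -> P (w t) /\ W (w t)].
  move=> hc nc.
  pose k (t : R) := t * (1 - t) * ((x - x0) ^+ 2 + (y - y0) ^+ 2).
  exists (fun t => (c + (1 + k t) * ((x0 - c) + t * ((x - c) - (x0 - c))), (1 + k t) * (y0 + t * (y - y0)))).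
  split; first by rewrite /k; cont.
  - by rewrite /k !mul0r !addr0 !mul1r; congr pair; ring.
  - by rewrite /k subrr mulr0 !mul0r !addr0 !mul1r; congr pair; ring.
  move=> t /I01P t01; have /andP[t0 t1] := t01.
  have /andP[lx1 lx2] := lin x x0 t t01 hx1 hx2; have /andP[ly1 ly2] := lin y y0 t t01 hy1 hy2.
  have [k0 k1] : 0 <= k t /\ k t <= d / 50.
    have e1 : (x - x0) ^+ 2 <= d * (1 / 50) by clear -hx1 hx2 d1 dp; nra.
    have e2 : (y - y0) ^+ 2 <= d * (1 / 50) by clear -hy1 hy2 d1 dp; nra.
    have e3 : 0 <= t * (1 - t) <= 1 / 4 by clear -t0 t1; have := sqr_ge0 (t - 1 / 2); move=> h; apply/andP; split; nra.
    have e4 : 0 <= (x - x0) ^+ 2 + (y - y0) ^+ 2 by rewrite addr_ge0 ?sqr_ge0.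
    by clear -e1 e2 e3 e4 dp; rewrite /k; case/andP: e3; move: (t * (1 - t)) ((x - x0) ^+ 2) ((y - y0) ^+ 2) e1 e2 e4 => A B C; split; nra.
  have hole : c = 2 \/ c = - 2 -> 1 <= (c + (1 + k t) * (x0 - c + t * (x - c - (x0 - c))) - c) ^+ 2 +
      ((1 + k t) * (y0 + t * (y - y0))) ^+ 2.
    move=> {}hc; have -> : forall A : R, c + A - c = A by move=> A; ring.
    apply: push_norm => //.
    - by case: hc P0 => -> [/=]; rewrite ?opprK.
    - by case: hc Pz => -> [/=]; rewrite ?opprK.
    - by rewrite /k; ring.
    - lra.
  have {}hole := hole hc.
  have kX A : -2 <= A <= 2 -> - (d / 25) <= k t * A <= d / 25.
    by clear -k0 k1; case/andP; move: (k t) k0 k1 => K k0 k1 h1 h2; apply/andP; split; nra.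
  have [/andP[n1 n2] /andP[n3 n4]] : -(71/50) <= x0 - c <= 71/50 /\ -(71/50) <= y0 <= 71/50.
    by clear -nc; have := sqr_ge0 (x0 - c); have := sqr_ge0 y0; split; apply/andP; split; nra.
  have /andP[m1 m2] : - (d / 25) <= k t * (x0 - c + t * (x - x0)) <= d / 25.
    by apply: kX; clear -n1 n2 lx1 lx2 d1; apply/andP; split; lra.
  have /andP[m3 m4] : - (d / 25) <= k t * (y0 + t * (y - y0)) <= d / 25.
    by apply: kX; clear -n3 n4 ly1 ly2 d1; apply/andP; split; lra.
  have E1 : c + (1 + k t) * (x0 - c + t * (x - c - (x0 - c))) =
    x0 + t * (x - x0) + k t * (x0 - c + t * (x - x0)) by ring.
  have E2 : (1 + k t) * (y0 + t * (y - y0)) = y0 + t * (y - y0) + k t * (y0 + t * (y - y0)) by ring.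
  have P1 : - (2 * d) < c + (1 + k t) * (x0 - c + t * (x - c - (x0 - c))) - x0 < 2 * d.
    by rewrite E1; clear -lx1 lx2 m1 m2 dp; apply/andP; split; lra.
  have P2 : - (2 * d) < (1 + k t) * (y0 + t * (y - y0)) - y0 < 2 * d.
    by rewrite E2; clear -ly1 ly2 m3 m4 dp; apply/andP; split; lra.
  clear -hole P1 P2 inW dp d1 n1 n2 n3 n4 hc.
  move: (c + (1 + k t) * (x0 - c + t * (x - c - (x0 - c)))) ((1 + k t) * (y0 + t * (y - y0))) hole P1 P2 => p1 p2 hole /andP[q1 q2] /andP[q3 q4].
  split; last by apply: inW; rewrite ltr_norml; apply/andP; split; lra.
  clear inW; case: hc hole n1 n2 => -> hole n1 n2; split=> /=; try lra; try (by rewrite opprK in hole);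
   clear hole; nra.
case: (ltP ((x0 - 2) ^+ 2 + y0 ^+ 2) 2) => f2; first by apply: (near 2) => //; left.
case: (ltP ((x0 - -2) ^+ 2 + y0 ^+ 2) 2) => f1; first by apply: (near (- 2)) => //; right.
rewrite opprK in f1; clear near.
exists (fun t => (x0 + t * (x - x0), y0 + t * (y - y0))); split; first by cont.
- by rewrite !mul0r !addr0.
- by rewrite !mul1r; congr pair; ring.
move=> t /I01P t01; have /andP[t0 t1] := t01.
have /andP[lx1 lx2] := lin x x0 t t01 hx1 hx2; have /andP[ly1 ly2] := lin y y0 t t01 hy1 hy2.
split; last by apply: inW; rewrite addrC addKr ltr_norml; apply/andP; split; lra.
have far (c : R) : - 2 <= c <= 2 -> 2 <= (x0 + c) ^+ 2 + y0 ^+ 2 ->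
    1 <= (x0 + t * (x - x0) + c) ^+ 2 + (y0 + t * (y - y0)) ^+ 2.
  move=> /andP[c1 c2] h; have [u1 u2] : - 6 <= x0 + c /\ x0 + c <= 6 by split; lra.
  have -> : x0 + t * (x - x0) + c = (x0 + c) + t * (x - x0) by ring.
  have {lx1}lx1 : - (1 / 50) <= t * (x - x0) by lra.
  have {lx2}lx2 : t * (x - x0) <= 1 / 50 by lra.
  have {ly1}ly1 : - (1 / 50) <= t * (y - y0) by lra.
  have {ly2}ly2 : t * (y - y0) <= 1 / 50 by lra.
  clear -h u1 u2 lx1 lx2 ly1 ly2 by1 by2.
  move: (x0 + c) (t * (x - x0)) (t * (y - y0)) u1 u2 lx1 lx2 ly1 ly2 h => u p q u1 u2 lx1 lx2 ly1 ly2 h.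
  have a1 : - (6 / 50) <= u * p by clear -u1 u2 lx1 lx2; nra.
  have a2 : - (6 / 50) <= y0 * q by clear -by1 by2 ly1 ly2; nra.
  by have := sqr_ge0 p; have := sqr_ge0 q; move=> h1 h2; lra.
case: P0 Pz => [/= h0 _ _] [/= g0 _ _]; split=> /=.
- exact: star_disc.
- by apply: far => //; apply/andP; split; lra.
- by apply: (far (- 2)) => //; apply/andP; split; lra.
Qed.
End PantsShape.

(** * Flat sections over the surface *)

Section GlobalSection.
Variables (R : realType) (S : topologicalType) (g : nat).
Variables (gam : 'I_(3 * g - 3) -> R -> S) (m : marking R S g).
Hypotheses (hS : closed_surface R S) (hm : marks gam m).
Hypothesis gam_simple : forall j, simple_closed (gam j).
Hypothesis gam_disjoint : forall i j, i != j -> disjoint_curves (gam i) (gam j).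
Notation P := (@pants R).
Implicit Types (z : R * R) (v w : 'I_(2 * g - 2)).

Lemma pant_cont v : {within P, continuous (pant m v)}.
Proof. by case: hm => _ [h _ _] _ _; exact: h. Qed.

Lemma side_surj v (i : 'I_3) : exists j b, side m j b = (v, i).
Proof. by case: hm => -[h _ hK] _ _ _; exists (h (v, i)).1, (h (v, i)).2; exact: hK. Qed.

Lemma pant_bdry j b v i t : side m j b = (v, i) -> @I01 R t ->
  pant m v (bdry i t) = gam j (if b then 1 - t else t).
Proof.
case: hm => _ _ h _ e it; have [h1 h2] := h j t it.
by move: e h1 h2; case: b => e; rewrite e.
Qed.

Lemma pant_interior v z j t : pants_interior z -> @I01 R t -> pant m v z <> gam j t.
Proof.
case: hm => _ [_ _ e] _ _ hz it eq.
have : (\bigcup_v (pant m v @` @pants_interior R)) (pant m v z) by exists v => //; exists z.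
by rewrite e; apply; exists j => //; exists t.
Qed.

Lemma pant_cover x : exists v z, P z /\ pant m v z = x.
Proof.
case: hm => _ [_ _ e] _ _.
case: (pselect ((\bigcup_j Defs.support (gam j)) x)) => [[j _ [t it <-]]|].
  case E : (side m j false) => [v i]; exists v, (bdry i t); split; first exact: bdry_pants.
  exact: pant_bdry E it.
by move=> h; have {h} : (~` (\bigcup_j Defs.support (gam j))) x by []; rewrite -e => -[v _ [z hz <-]]; exists v, z; split=> //; exact: interior_pants.
Qed.

Variables (F : Type) (T : (R -> S) -> F -> F).
Hypothesis hT : local_system T.
Variable n : 'I_(2 * g - 2) -> R * R -> F.
Hypothesis hn : forall v, flat T (pant m v) P (n v).
Hypothesis seam : forall j, n (side m j false).1 (bdry (side m j false).2 0) =
                            n (side m j true).1 (bdry (side m j true).2 0).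

Let nj j t := n (side m j false).1 (bdry (side m j false).2 t).

(** Transport along the curve spreads the agreement assumed in [seam] at one point to the whole
    curve. Side [true] runs along it backwards, whence 1 - t. *)
Lemma seam_value j b v i t : side m j b = (v, i) -> @I01 R t ->
  n v (bdry i t) = nj j (if b then 1 - t else t).
Proof.
case: b => [e it|e it]; last by rewrite /nj e.
have [i0 i1] := (@I01_0 R, @I01_1 R).
have it' : @I01 R (1 - t) by move/I01P: it => /andP[? ?]; apply/I01P; apply/andP; split; lra.
have bp k a b : @I01 R a -> @I01 R b -> is_path (sub (@bdry R k) a b).
  by move=> ha hb; apply: sub_path => //; exact: bdry_path.
case E : (side m j false) => [v0 j0].
have h1 : T (pant m v \o sub (bdry i) 0 t) (n v (bdry i 0)) = n v (bdry i t).
  rewrite -{1}(sub0 (bdry i) 0 t) -(sub1 (bdry i) 0 t); apply: hn; first exact: bp.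
  by move=> s _; exact: bdry_pants.
have h2 : T (pant m v0 \o sub (bdry j0) 1 (1 - t)) (n v0 (bdry j0 1)) = n v0 (bdry j0 (1 - t)).
  rewrite -{1}(sub0 (bdry j0) 1 (1 - t)) -(sub1 (bdry j0) 1 (1 - t)); apply: hn; first exact: bp.
  by move=> s _; exact: bdry_pants.
rewrite /nj E /= -h1 -h2 bdry01; have := seam j; rewrite E e /= => <-.
apply: (ls_ext hT).
  by apply: (pants_pathf (@pant_cont v)); [exact: bp | move=> s _; exact: bdry_pants].
move=> s hs; rewrite /sub /=.
have hs1 := I01_conv i0 it hs; have hs2 := I01_conv i1 it' hs.
by rewrite (pant_bdry e hs1) (pant_bdry E hs2); congr gam; ring.
Qed.

(** Interior points are covered once, and interiors avoid the curves. On a curve the value is read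
    off by [seam_value] and depends only on the parameter, which the point determines up to the
    identification of 0 and 1. *)
Lemma section_glue v w z z' : P z -> P z' -> pant m v z = pant m w z' -> n v z = n w z'.
Proof.
have cl (t : R) : 0 <= t -> t < 1 -> @I01 R t by move=> h1 h2; apply/I01P; rewrite h1 ltW.
have onb b (t : R) : @I01 R t -> @I01 R (if b then 1 - t else t).
  by case: b => // /I01P/andP[? ?]; apply/I01P; apply/andP; split; lra.
move=> Pz Pz'; case: (pants_cases Pz) => [iz|[i [t [t0 t1 ->]]]];
  case: (pants_cases Pz') => [iz'|[i' [t' [t0' t1' ->]]]].
- by case: hm => _ [_ inj _] _ _ /inj [] // -> ->.
- have [j [b e]] := side_surj w i'; rewrite (pant_bdry e (cl _ t0' t1')).
  by move/(pant_interior iz (onb b _ (cl _ t0' t1'))).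
- have [j [b e]] := side_surj v i; rewrite (pant_bdry e (cl _ t0 t1)) => /esym.
  by move/(pant_interior iz' (onb b _ (cl _ t0 t1))).
have [j [b e]] := side_surj v i; have [j' [b' e']] := side_surj w i'.
have [it it'] := (cl _ t0 t1, cl _ t0' t1').
rewrite (pant_bdry e it) (pant_bdry e' it') (seam_value e it) (seam_value e' it').
move: (if b then _ else _) (if b' then _ else _) (onb b t it) (onb b' t' it') => a a' ia ia' eq.
have jj : j = j'.
  apply/eqP; apply: contrapT => /negP /gam_disjoint d.
  have : (Defs.support (gam j) `&` Defs.support (gam j')) (gam j a).
    by split; [exists a | exists a'].
  by rewrite d.
subst j'; have [_ c01 inj] := gam_simple j.
have nj01 : nj j 0 = nj j 1 by rewrite /nj bdry01.
(* Parameter 1 is replaced by 0, because simplicity of the curve gives injectivity on the half-open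
   interval only. *)
have red x : @I01 R x -> exists y, [/\ 0 <= y < 1, gam j x = gam j y & nj j x = nj j y].
  move=> /I01P/andP[x0 x1]; have [->|ne] := eqVneq x 1.
    by exists 0; rewrite lexx ltr01 c01 nj01.
  by exists x; rewrite x0 lt_neqAle ne x1.
have [y [hy gy ->]] := red a ia; have [y' [hy' gy' ->]] := red a' ia'.
by congr nj; apply: inj; rewrite // -gy -gy'.
Qed.

(** A disc is star-shaped about every point, so it carries a flat section with prescribed value;
    openness of the chart makes its inverse continuous and transfers the section to S. *)
Lemma chart_section x e : exists V m0, [/\ open V, V x, m0 x = e & flat T id V m0].
Proof.
have [_ _ _ ch] := hS; have [f [cf inj opf] [z0 hz0 fz0]] := ch x.
have star : contractible R (@unit_disc R) z0.
  apply: star_contractible => z t hz /I01P/andP[t0 t1]; move: hz hz0; rewrite /unit_disc /=.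
  case: z z0 {fz0} => [a b] [c d] /= h1 h2.
  have -> : (c + t * (a - c)) ^+ 2 + (d + t * (b - d)) ^+ 2 = (1 - t) * (c ^+ 2 + d ^+ 2) +
    t * (a ^+ 2 + b ^+ 2) - t * (1 - t) * ((a - c) ^+ 2 + (b - d) ^+ 2) by ring.
  have : 0 <= t * (1 - t) * ((a - c) ^+ 2 + (b - d) ^+ 2).
    by rewrite mulr_ge0 ?addr_ge0 ?sqr_ge0 // mulr_ge0 //; lra.
  move: (c ^+ 2 + d ^+ 2) (a ^+ 2 + b ^+ 2) (_ * (_ + _)) h1 h2 => A B C h1 h2 h3.
  by case: (leP t (1 / 2)) => h; nra.
have [n0 fl e0] := contr_section hT e star cf hz0.
pose V := f @` @unit_disc R.
have oV : open V by rewrite /V -[X in f @` X]setIT; apply: opf; exact: openT.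
pose h y := xget z0 [set z | unit_disc z /\ f z = y].
have hP y : V y -> unit_disc (h y) /\ f (h y) = y.
  by move=> [z hz <-]; rewrite /h; case: xgetP => [_ _ //|/(_ z)]; case.
have hf z : unit_disc z -> h (f z) = z.
  move=> hz; have [a b] : unit_disc (h (f z)) /\ f (h (f z)) = f z by apply: hP; exists z.
  exact: inj.
have Vx : V x by exists z0.
exists V, (n0 \o h); split=> //; first by rewrite /= -fz0 hf.
move=> w cw wV; have ch' : {within V, continuous h}.
  apply/withinP => y Vy W hW; have [dy fy] := hP y Vy.
  move: hW; rewrite nbhsE => -[W' [oW' W'y] sW].
  have : nbhs y (f @` (@unit_disc R `&` W')).
    by apply: open_nbhs_nbhs; split; [exact: opf | exists (h y)].
  by apply: filterS => y' [z [hz Wz] <-] _; rewrite hf //; exact: sW.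
have cu : is_path (h \o w) by apply: within_comp ch'.
have := fl (h \o w) cu (fun t it => (hP _ (wV t it)).1); rewrite /= => <-.
apply: (ls_ext hT) => // t it /=.
by have [_ ->] := hP _ (wV t it).
Qed.

Lemma global_section : exists N : S -> F, [/\ forall v z, P z -> N (pant m v z) = n v z &
  flat T id setT N].
Proof.
have [N hN] : exists N : S -> F, forall x v z, P z -> pant m v z = x -> N x = n v z.
  have ex x : exists e, forall v z, P z -> pant m v z = x -> e = n v z.
    have [v [z [Pz <-]]] := pant_cover x.
    by exists (n v z) => w z' Pz' e; apply: section_glue.
  by have [N hN] := choice ex; exists N.
exists N; split=> [v z Pz|]; first exact: hN.
apply: (flat_local hT); first by apply: continuous_subspaceT => x; exact: cvg_id.
move=> x _; have [V [m0 [oV Vx m0x fl]]] := chart_section x (N x).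
(* The points where the chart section agrees with [n v]. Local path-connectedness of the pants makes
   this a neighbourhood of every point over [x]. *)
pose G v := [set z | P z -> V (pant m v z) /\ n v z = m0 (pant m v z)].
have Gx v z : P z -> pant m v z = x -> nbhs z (G v).
  move=> Pz e.
  have hW : nbhs z [set y | P y -> V (pant m v y)].
    have /withinP := @pant_cont v; apply => //; rewrite e.
    by apply: open_nbhs_nbhs.
  apply: filterS (pants_local Pz hW) => y h Py; have [w [cw w0 w1 wW]] := h Py.
  have wV t : @I01 R t -> V (pant m v (w t)) by move=> it; have [a b] := wW t it; exact: b.
  have wP t : @I01 R t -> P (w t) by move=> it; have [a b] := wW t it.
  have i1 := @I01_1 R; split; first by rewrite -w1; exact: wV.
  have cpw : is_path (pant m v \o w) by apply: within_comp (@pant_cont v).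
  rewrite -w1 -(hn v cw wP) -(fl _ cpw wV) /= w0 e m0x; congr (T _ _).
  by rewrite (hN x v z).
(* The remaining points form a compact set whose image is closed and misses [x]. Removing these
   finitely many images leaves a neighbourhood of [x] on which [N] is the chart section. *)
pose C v := P `&` ~` interior (G v).
have cC v : closed (pant m v @` C v).
  have [hd _ _ _] := hS; apply: compact_closed => //; apply: continuous_compact.
    by apply: continuous_subspaceW (@pant_cont v) => z [].
  apply: (@subclosed_compact _ _ P) => [||z [] //]; last exact: pants_compact.
  apply: closedI; last by apply: open_closedC; exact: open_interior.
  by apply: compact_closed; [exact: norm_hausdorff | exact: pants_compact].
have nb : nbhs x [set y | forall v, ~ (pant m v @` C v) y].
  apply: filter_forall => v; apply: open_nbhs_nbhs; split; first exact: closed_openC.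
  by move=> [z [Pz nz] e]; apply: nz; exact: Gx.
exists (V `&` [set y | forall v, ~ (pant m v @` C v) y]).
  by apply: filterI => //; exact: open_nbhs_nbhs.
have eN : {in [set: S] `&` (V `&` [set y | forall v, ~ (pant m v @` C v) y]), m0 =1 N}.
  move=> y; rewrite inE => -[_ [Vy Cy]]; have [v [z [Pz e]]] := pant_cover y.
  rewrite (hN y v z) //; have : (interior (G v)) z.
    by apply: contrapT => nz; apply: (Cy v); exists z.
  by move/interior_subset => /(_ Pz) [_ ->]; rewrite e.
by apply: (flat_eq eN); apply: flat_sub fl => y [_ [Vy _]].
Qed.
End GlobalSection.

(** * The functor on paths extending a representation *)

Section HomotopyCalculus.
Variables (R : realType) (S : topologicalType).
Implicit Types (p q r : R -> S).

Lemma I01_flip t : @I01 R t -> @I01 R (1 - t).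
Proof. by move=> /I01P/andP[a b]; apply/I01P; apply/andP; split; lra. Qed.

Lemma I01_lo t : @I01 R t -> t <= 2^-1 -> @I01 R (2 * t).
Proof. by move=> /I01P/andP[a b] c; apply/I01P; apply/andP; split; lra. Qed.

Lemma I01_hi t : @I01 R t -> 2^-1 <= t -> @I01 R (2 * t - 1).
Proof. by move=> /I01P/andP[a b] c; apply/I01P; apply/andP; split; lra. Qed.

Lemma paste (X : topologicalType) (K : set X) (h : X -> R) (a : R) (u v : X -> S) :
  closed K -> continuous h ->
  {within K `&` [set x | h x <= a], continuous u} ->
  {within K `&` [set x | a <= h x], continuous v} ->
  (forall x, K x -> h x = a -> u x = v x) ->
  {within K, continuous (fun x => if h x <= a then u x else v x)}.
Proof.
move=> cK ch cu cv e.
have -> : K = (K `&` [set x | h x <= a]) `|` (K `&` [set x | a <= h x]).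
  rewrite -setIUr; rewrite eqEsubset; split=> x; last by case.
  by move=> Kx; split=> //; case: (leP (h x) a) => hx; [left | right; exact: ltW].
apply: withinU_continuous.
- by apply: closedI => //; apply: (@preimage_closed _ _ h [set x | x <= a]); [move=> x _; exact: ch | exact: closed_le].
- by apply: closedI => //; apply: (@preimage_closed _ _ h [set x | a <= x]); [move=> x _; exact: ch | exact: closed_ge].
- by apply: within_ext cu => x [_ /= ->].
- apply: within_ext cv => x [Kx /= hx]; case: ifP => // hx'.
  by rewrite e //; apply/le_anti; rewrite hx hx'.
Qed.

Lemma square_closed : closed (@square R).
Proof.
apply: compact_closed; first exact: norm_hausdorff.
by apply: compact_setX; exact: segment_compact.
Qed.

Lemma hom_sym p q : path_homotopic p q -> p 0 = q 0 -> p 1 = q 1 -> path_homotopic q p.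
Proof.
move=> [H [cH hH]] e0 e1; exists (fun z => H (1 - z.1, z.2)); split.
  apply: (@within_comp _ _ _ _ (@square R) (fun z : R * R => (1 - z.1, z.2)) H) => //; first by cont.
  by move=> z [a b]; split=> //; exact: I01_flip.
move=> t it; have it' : @I01 R (1 - t).
  exact: I01_flip.
have [a1 a2 _ _] := hH t it; have [_ _ a3 a4] := hH _ it'.
by rewrite /= subr0 subrr a1 a2 a3 a4 e0 e1.
Qed.

Lemma hom_ends p q : path_homotopic p q -> p 0 = q 0 /\ p 1 = q 1.
Proof.
move=> [H [_ hH]]; have [i0 i1] := (@I01_0 R, @I01_1 R).
have [_ a1 _ _] := hH 0 i0; have [_ a2 b1 b2] := hH 1 i1.
by rewrite -a1 -b1 -a2 -b2.
Qed.

Lemma hom_trans p q r : path_homotopic p q -> path_homotopic q r -> path_homotopic p r.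
Proof.
move=> hpq; have [e0 e1] := hom_ends hpq; case: hpq => H [cH hH] [K [cK hK]].
exists (fun z => if z.1 <= 2^-1 then H (2 * z.1, z.2) else K (2 * z.1 - 1, z.2)); split.
  apply: (@paste _ (@square R) fst 2^-1 (fun z : R * R => H (2 * z.1, z.2)) (fun z : R * R => K (2 * z.1 - 1, z.2))).
  - exact: square_closed.
  - by move=> z; exact: cvg_fst.
  - apply: (@within_comp _ _ _ _ (@square R) (fun z : R * R => (2 * z.1, z.2)) H) => //; first by cont.
    by move=> z [[a b] /= d]; split=> //; exact: I01_lo.
  - apply: (@within_comp _ _ _ _ (@square R) (fun z : R * R => (2 * z.1 - 1, z.2)) K) => //; first by cont.
    by move=> z [[a b] /= d]; split=> //; exact: I01_hi.
  - move=> [x y] [_ iy] /= ->; rewrite divff ?pnatr_eq0 // subrr.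
    by have [_ -> _ _] := hH y iy; have [-> _ _ _] := hK y iy.
move=> t it; have [a1 a2 _ _] := hH t it; have [b1 b2 _ _] := hK t it.
rewrite /= invr_ge0 ler0n mulr0 a1; split=> //.
- rewrite ifF; last by apply/negbTE; rewrite -ltNge; lra.
  by rewrite -b2; congr (K (_, _)); lra.
- case: ifP => h.
    by have [|_ _ ->] := hH (2 * t); rewrite //; exact: I01_lo.
  move/negbT: h; rewrite -ltNge => h; rewrite e0.
  by have [|_ _ ->] := hK (2 * t - 1); rewrite //; apply: I01_hi => //; exact: ltW.
- case: ifP => h.
    by have [|_ _ _ ->] := hH (2 * t); rewrite //; exact: I01_lo.
  move/negbT: h; rewrite -ltNge => h; rewrite e1.
  by have [|_ _ _ ->] := hK (2 * t - 1); rewrite //; apply: I01_hi => //; exact: ltW.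
Qed.

Lemma hom_cat p p' q q' : p 1 = q 0 -> path_homotopic p p' -> path_homotopic q q' ->
  path_homotopic (pcat p q) (pcat p' q').
Proof.
move=> e [H [cH hH]] [K [cK hK]].
exists (fun z => if z.2 <= 2^-1 then H (z.1, 2 * z.2) else K (z.1, 2 * z.2 - 1)); split.
  apply: (@paste _ (@square R) snd 2^-1 (fun z : R * R => H (z.1, 2 * z.2)) (fun z : R * R => K (z.1, 2 * z.2 - 1))).
  - exact: square_closed.
  - by move=> z; exact: cvg_snd.
  - apply: (@within_comp _ _ _ _ (@square R) (fun z : R * R => (z.1, 2 * z.2)) H) => //; first by cont.
    by move=> z [[a b] /= d]; split=> //; exact: I01_lo.
  - apply: (@within_comp _ _ _ _ (@square R) (fun z : R * R => (z.1, 2 * z.2 - 1)) K) => //; first by cont.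
    by move=> z [[a b] /= d]; split=> //; exact: I01_hi.
  - move=> [x y] [ix _] /= ->; rewrite divff ?pnatr_eq0 // subrr.
    by have [_ _ _ ->] := hH x ix; have [_ _ -> _] := hK x ix.
move=> t it; have [_ _ a1 a2] := hH t it; have [_ _ b1 b2] := hK t it.
rewrite /= invr_ge0 ler0n mulr0 a1 pcat0 pcat1; split=> //.
- rewrite /pcat; case: ifP => h.
    by have [|-> _ _ _] := hH (2 * t); rewrite //; exact: I01_lo.
  move/negbT: h; rewrite -ltNge => h.
  by have [|-> _ _ _] := hK (2 * t - 1); rewrite //; apply: I01_hi => //; exact: ltW.
- rewrite /pcat; case: ifP => h.
    by have [|_ -> _ _] := hH (2 * t); rewrite //; exact: I01_lo.
  move/negbT: h; rewrite -ltNge => h.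
  by have [|_ -> _ _] := hK (2 * t - 1); rewrite //; apply: I01_hi => //; exact: ltW.
- rewrite ifF; last by apply/negbTE; rewrite -ltNge; lra.
  by rewrite -b2; congr (K (_, _)); lra.
Qed.

Lemma hom_refl p : is_path p -> path_homotopic p p.
Proof. by move=> cp; apply: path_homotopic_refl. Qed.

Lemma hom_assoc p q r : is_path p -> is_path q -> is_path r -> p 1 = q 0 -> q 1 = r 0 ->
  path_homotopic (pcat (pcat p q) r) (pcat p (pcat q r)).
Proof.
move=> cp cq cr epq eqr.
(* The piecewise linear change of parameter sending [0, 1/2], [1/2, 3/4], [3/4, 1] to [0, 1/4],
   [1/4, 1/2], [1/2, 1]. *)
pose u : R -> R := pcat (fun t => t / 4) (pcat (fun t => 1 / 4 + t / 4) (fun t => 1 / 2 + t / 2)).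
have cu : is_path u by apply: pcat_path; [cont | apply: pcat_path; [cont | cont | lra] | rewrite pcat0; lra].
have ui t : @I01 R t -> @I01 R (u t).
  apply: pcat_range t => [t|]; last apply: pcat_range => t;
    by move=> /I01P/andP[a b]; apply/I01P; apply/andP; split; lra.
have cc : is_path (pcat (pcat p q) r) by apply: pcat_path => //; [exact: pcat_path | rewrite pcat1].
have e t : pcat p (pcat q r) t = pcat (pcat p q) r (u t).
  rewrite /u /pcat; case: (leP t 2^-1) => h1.
    by rewrite !ifT; [congr p; field | clear -h1; lra | clear -h1; lra].
  case: (leP (2 * t - 1) 2^-1) => h2.
    by rewrite ifT; [case: (leP _ 2^-1) => h3; [exfalso; clear -h1 h2 h3; lra | congr q; field] | clear -h1 h2; lra].
  by case: (leP _ 2^-1) => h3; [exfalso; clear -h1 h2 h3; lra | congr r; field].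
have -> : pcat p (pcat q r) = pcat (pcat p q) r \o u.
  by apply: functional_extensionality_dep.
apply: (@reparam_homotopic _ _ _ id u) => //.
- exact: within_id.
- by rewrite /u pcat0 mul0r.
- by rewrite /u !pcat1; lra.
Qed.

Lemma hom_prev p : is_path p -> path_homotopic (pcat p (@Defs.prev R S p)) (fun=> p 0).
Proof.
move=> cp; pose u : R -> R := pcat id (fun t => 1 - t).
have -> : pcat p (@Defs.prev R S p) = p \o u.
  by apply: functional_extensionality_dep => t; rewrite /u /pcat /Defs.prev /=; case: ifP.
apply: (@reparam_homotopic _ _ p u (fun=> 0)) => //.
- by apply: pcat_path; [exact: within_id | cont | rewrite subr0].
- by cont.
- by apply: pcat_range => t // /I01P/andP[a b]; apply/I01P; apply/andP; split; lra.
- by move=> t _; exact: I01_0.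
- by rewrite /u pcat0.
- by rewrite /u pcat1 subrr.
Qed.

Lemma prevK p : @Defs.prev R S (@Defs.prev R S p) = p.
Proof. by apply: functional_extensionality_dep => t; rewrite /Defs.prev subKr. Qed.

Lemma hom_prevl p : is_path p -> path_homotopic (pcat (@Defs.prev R S p) p) (fun=> p 1).
Proof.
by move=> cp; have := hom_prev (prev_path cp); rewrite prevK prev0.
Qed.

Lemma hom_unitl p x : is_path p -> p 0 = x -> path_homotopic (pcat (fun=> x) p) p.
Proof.
move=> cp <-; pose u : R -> R := pcat (fun=> 0) id.
have -> : pcat (fun=> p 0) p = p \o u.
  by apply: functional_extensionality_dep => t; rewrite /u /pcat /=; case: ifP.
apply: (@reparam_homotopic _ _ p u id) => //.
- by apply: pcat_path; [cont | exact: within_id |].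
- exact: within_id.
- by apply: pcat_range => t // _; exact: I01_0.
- by rewrite /u pcat0.
- by rewrite /u pcat1.
Qed.

Lemma hom_unitr p x : is_path p -> p 1 = x -> path_homotopic (pcat p (fun=> x)) p.
Proof.
move=> cp <-; pose u : R -> R := pcat id (fun=> 1).
have -> : pcat p (fun=> p 1) = p \o u.
  by apply: functional_extensionality_dep => t; rewrite /u /pcat /=; case: ifP.
apply: (@reparam_homotopic _ _ p u id) => //.
- by apply: pcat_path; [exact: within_id | cont |].
- exact: within_id.
- by apply: pcat_range => t // _; exact: I01_1.
- by rewrite /u pcat0.
- by rewrite /u pcat1.
Qed.

End HomotopyCalculus.

Section Functor.
Variables (R : realType) (S : topologicalType) (x0 : S).
Notation M := 'M[R[i]]_4.
Variable rho : (R -> S) -> M.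
Hypothesis hrho : representation x0 rho.
Implicit Types (p q r : R -> S) (x y : S).

Definition reachable y : Prop := exists p : R -> S, path_from_to x0 y p.

(** The anchor of the base point is constant, so that [ext_rho] agrees with [rho] on loops. *)
Definition anchor y : R -> S :=
  if pselect (y = x0) then fun=> x0 else xget (fun=> x0) [set p | path_from_to x0 y p].

(* The extension of [rho] to all paths: endpoints are joined to the base point
   by fixed paths. *)
Definition ext_rho p : M :=
  if pselect (reachable (p 0)) then
    rho (pcat (pcat (anchor (p 0)) p) (@Defs.prev R S (anchor (p 1))))
  else 1%:M.

Lemma anchorP y : reachable y -> path_from_to x0 y (anchor y).
Proof.
rewrite /anchor => hy; case: pselect => [e|?].
  by split=> //; exact: cst_path.
by case: xgetP => // h; case: hy => p hp; case: (h p).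
Qed.

Lemma reach_path p : is_path p -> reachable (p 0) -> reachable (p 1).
Proof.
move=> cp [q [cq q0 q1]]; exists (pcat q p); split; last by rewrite pcat1.
  exact: pcat_path.
by rewrite pcat0.
Qed.

Lemma rho_cst : rho (fun=> x0) = 1%:M.
Proof.
have [su hh hc] := hrho.
have l0 : loop_at x0 (fun _ : R => x0) by split=> //; exact: cst_path.
have := hc _ _ l0 l0; have u := SU31_unit (su _ l0).
have -> : pcat (fun=> x0) (fun=> x0) = (fun=> x0) :> (R -> S).
  by apply: functional_extensionality_dep => t; rewrite /pcat; case: ifP.
move=> e; have := congr1 (mulmx (invmx (rho (fun=> x0)))) e.
by rewrite mulmxA mulVmx // mul1mx => <-.
Qed.

Lemma anchored_loop p : is_path p -> reachable (p 0) ->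
  loop_at x0 (pcat (pcat (anchor (p 0)) p) (@Defs.prev R S (anchor (p 1)))).
Proof.
move=> cp h0; have [c0 a0 b0] := anchorP h0; have [c1 a1 b1] := anchorP (reach_path cp h0).
split; last by rewrite pcat1 prev1.
  by apply: pcat_path; [exact: pcat_path | exact: prev_path | rewrite pcat1 prev0].
by rewrite !pcat0.
Qed.

Lemma ext_SU31 p : is_path p -> SU31 (ext_rho p).
Proof.
rewrite /ext_rho; case: pselect => [h0|?] cp; last exact: SU31_1.
by have [su _ _] := hrho; apply/su/anchored_loop.
Qed.

Lemma ext_hom p q : is_path p -> is_path q -> path_homotopic p q -> ext_rho p = ext_rho q.
Proof.
move=> cp cq h; have [e0 e1] := hom_ends h; rewrite /ext_rho -e0 -e1.
case: pselect => // h0; have [_ hh _] := hrho.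
have [c0 a0 b0] := anchorP h0; have [c1 a1 b1] := anchorP (reach_path cp h0).
apply: hh; first exact: anchored_loop.
  by rewrite e0 e1 in h0 *; apply: anchored_loop.
apply: hom_cat; first by rewrite pcat1 prev0.
  by apply: hom_cat => //; exact: hom_refl.
by apply: hom_refl; exact: prev_path.
Qed.

Lemma ext_cat p q : is_path p -> is_path q -> p 1 = q 0 ->
  ext_rho (pcat p q) = ext_rho p *m ext_rho q.
Proof.
move=> cp cq e; rewrite /ext_rho pcat0 pcat1 -e.
case: pselect => [h0|n0]; last first.
  case: pselect => [h1|?]; last by rewrite mul1mx.
  case: n0; have [r [cr r0 r1]] := h1.
  exists (pcat r (@Defs.prev R S p)); split.
  - by apply: pcat_path => //; [exact: prev_path | rewrite prev0].
  - by rewrite pcat0.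
  - by rewrite pcat1 prev1.
have h1 := reach_path cp h0; case: pselect => // ?.
have h2 : reachable (q 1) by apply: reach_path => //; rewrite -e.
have [c0 a0 b0] := anchorP h0; have [c1 a1 b1] := anchorP h1; have [c2 a2 b2] := anchorP h2.
have [_ hh hc] := hrho.
have l1 := anchored_loop cp h0; have l2 : loop_at x0 (pcat (pcat (anchor (p 1)) q) (@Defs.prev R S (anchor (q 1)))).
  by rewrite e; apply: anchored_loop; rewrite -?e.
rewrite -hc //.
set k0 := anchor _ in c0 a0 b0 l1 *; set k1 := anchor _ in c1 a1 b1 l1 l2 *.
set k2 := anchor _ in c2 a2 b2 l2 *.
have c1' := prev_path c1; have c2' := prev_path c2.
have d1 : is_path (pcat k0 p) by exact: pcat_path.
have d2 : is_path (pcat k1 q) by apply: pcat_path => //; rewrite b1.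
have cpq := pcat_path cp cq e.
have l3 : loop_at x0 (pcat (pcat k0 (pcat p q)) (@Defs.prev R S k2)).
  split; last by rewrite pcat1 prev1.
    by do ?apply: pcat_path => //; rewrite ?pcat0 ?pcat1 ?prev0.
  by rewrite !pcat0.
apply: hh => //; first by case: l1 l2 => [x1 x2 x3] [y1 y2 y3]; split;
  [apply: pcat_path => //; rewrite x3 y2 | rewrite pcat0 | rewrite pcat1].
apply: (@hom_trans _ _ _ (pcat (pcat (pcat k0 p) q) (@Defs.prev R S k2))).
  by apply: hom_cat; rewrite ?pcat1 ?prev0 //; [apply: hom_sym; rewrite ?pcat0 ?pcat1 //; apply: hom_assoc | exact: hom_refl].
(* The excursion to the base point along the anchor of the middle point cancels; the rest of the
   proof is reassociation. *)
have e1 : path_homotopic (pcat (@Defs.prev R S k1) (pcat k1 q)) q.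
  apply: (@hom_trans _ _ _ (pcat (pcat (@Defs.prev R S k1) k1) q)).
    apply: hom_sym; rewrite ?pcat0 ?pcat1 //.
    by apply: hom_assoc => //; rewrite ?prev1 ?b1.
  apply: (@hom_trans _ _ _ (pcat (fun=> k1 1) q)).
    by apply: hom_cat; rewrite ?pcat1 ?b1 //; [rewrite -b1; exact: hom_prevl | exact: hom_refl].
  by apply: hom_unitl => //; rewrite b1.
have dz : is_path (pcat (pcat k1 q) (@Defs.prev R S k2)) by apply: pcat_path => //; rewrite pcat1 prev0.
apply: hom_sym; rewrite ?pcat0 ?pcat1 //.
apply: (@hom_trans _ _ _ (pcat (pcat k0 p) (pcat (@Defs.prev R S k1) (pcat (pcat k1 q) (@Defs.prev R S k2))))).
  by apply: hom_assoc => //; rewrite ?pcat1 ?pcat0 ?prev0 ?prev1.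
apply: (@hom_trans _ _ _ (pcat (pcat k0 p) (pcat q (@Defs.prev R S k2)))); last first.
  apply: hom_sym; rewrite ?pcat0 ?pcat1 //.
  by apply: hom_assoc => //; rewrite ?pcat1 ?prev0.
apply: hom_cat; [by rewrite pcat1 pcat0 prev0 | exact: hom_refl |].
apply: (@hom_trans _ _ _ (pcat (pcat (@Defs.prev R S k1) (pcat k1 q)) (@Defs.prev R S k2))).
  apply: hom_sym; rewrite ?pcat0 ?pcat1 //.
  by apply: hom_assoc => //; rewrite ?pcat1 ?pcat0 ?prev0 ?prev1.
by apply: hom_cat => //; [rewrite !pcat1 prev0 | apply: hom_refl].
Qed.

Lemma ext_cst x : ext_rho (fun=> x) = 1%:M.
Proof.
rewrite /ext_rho; case: pselect => // h0; have [_ hh _] := hrho.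
rewrite -rho_cst; have [c0 a0 b0] := anchorP h0.
apply: hh; first exact: (anchored_loop (@cst_path R S x)).
  by split=> //; exact: cst_path.
apply: (@hom_trans _ _ _ (pcat (anchor x) (@Defs.prev R S (anchor x)))).
  apply: hom_cat; rewrite ?pcat1 ?prev0 //; first exact: hom_unitr.
  by apply: hom_refl; exact: prev_path.
by rewrite -a0; exact: hom_prev.
Qed.

Lemma ext_loop p : loop_at x0 p -> ext_rho p = rho p.
Proof.
move=> [cp p0 p1]; have [_ hh _] := hrho.
have r0 : reachable (p 0) by rewrite p0; exists (fun=> x0); split=> //; exact: cst_path.
rewrite /ext_rho; case: pselect => // ?; apply: hh => //; first exact: anchored_loop.
have -> : anchor (p 0) = (fun=> x0) by rewrite /anchor p0; case: pselect.
have -> : anchor (p 1) = (fun=> x0) by rewrite /anchor p1; case: pselect.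
apply: (@hom_trans _ _ _ (pcat p (fun=> x0))); last exact: hom_unitr.
apply: hom_cat; rewrite ?pcat1 //; first exact: hom_unitl.
by apply: hom_refl; exact: cst_path.
Qed.

Lemma ext_prev p : is_path p -> ext_rho (@Defs.prev R S p) = invmx (ext_rho p).
Proof.
move=> cp; have cp' := prev_path cp; have u := SU31_unit (ext_SU31 cp).
have : ext_rho (pcat p (@Defs.prev R S p)) = 1%:M.
  rewrite -(ext_cst (p 0)); apply: ext_hom; last exact: hom_prev.
    by apply: pcat_path => //; rewrite prev0.
  exact: cst_path.
rewrite ext_cat // ?prev0 // => e.
by rewrite -[RHS]mulmx1 -e mulKmx.
Qed.

End Functor.

Section TwistedSystem.
Variables (R : realType) (S : topologicalType) (x0 : S).
Notation M := 'M[R[i]]_4.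
Variables (rho rho' : (R -> S) -> M).
Hypotheses (hrho : representation x0 rho) (hrho' : representation x0 rho').

(* The sections that are flat for this transport intertwine [rho] and [rho']. *)
Definition twist p (e : M) : M := invmx (ext_rho x0 rho' p) *m e *m ext_rho x0 rho p.

Lemma twist_system : local_system twist.
Proof.
split=> [p q e cp cq h|p q e cp cq h|x e].
- by rewrite /twist (ext_hom hrho cp cq h) (ext_hom hrho' cp cq h).
- rewrite /twist (ext_cat hrho cp cq h) (ext_cat hrho' cp cq h).
  rewrite invmx_mul ?mulmxA //; exact: (SU31_unit (ext_SU31 hrho' _)).
- by rewrite /twist (ext_cst hrho) (ext_cst hrho') invmx1 mul1mx mulmx1.
Qed.

Lemma twist_fix p e e' : loop_at x0 p -> rho' p *m e' = e *m rho p <-> twist p e = e'.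
Proof.
move=> lp; have [cp _ _] := lp; have u := SU31_unit (ext_SU31 hrho' cp).
rewrite /twist (ext_loop hrho lp) (ext_loop hrho' lp); rewrite (ext_loop hrho' lp) in u.
by rewrite -mulmxA; split=> [<-|<-]; rewrite ?mulKmx ?mulKVmx.
Qed.
End TwistedSystem.

(** * Transport along the boundary and crossing loops *)

Section Rigidity.
Variables (R : realType) (S : topologicalType) (g : nat).
Variables (gam : 'I_(3 * g - 3) -> R -> S) (m : marking R S g).
Hypotheses (hS : closed_surface R S) (hm : marks gam m).
Hypothesis gam_simple : forall j, simple_closed (gam j).
Hypothesis gam_disjoint : forall i j, i != j -> disjoint_curves (gam i) (gam j).
Implicit Types (v w : 'I_(2 * g - 2)) (e : 'I_(2 * g - 2) * 'I_3).

Lemma arm_path v : path_from_to (base m) (pant m v (pants_base R)) (arm m v).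
Proof. by case: hm. Qed.

Lemma bdry_piece_path e : is_path (pant m e.1 \o bdry e.2).
Proof. exact: (bdry_pathf (pant_cont hm (v := e.1))). Qed.

Lemma tail_piece_path e : is_path (pant m e.1 \o tail e.2).
Proof. exact: (tail_pathf (pant_cont hm (v := e.1))). Qed.

Lemma reach_from_to e : path_from_to (base m) (pant m e.1 (bdry e.2 0)) (reach m e).
Proof.
have [c a0 a1] := arm_path e.1; rewrite /reach; split.
- by apply: pcat_path => //; [exact: tail_piece_path | rewrite a1 /= tail0].
- by rewrite pcat0.
- by rewrite pcat1 /= tail1.
Qed.

Lemma boundary_loopP e : loop_at (base m) (boundary_loop m e).
Proof.
have [c a0 a1] := reach_from_to e; rewrite /boundary_loop; split; last first.
- by rewrite pcat1 prev1.
- by rewrite !pcat0.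
apply: pcat_path; [apply: pcat_path => //| exact: prev_path|].
  exact: bdry_piece_path.
by rewrite pcat1 prev0 a1 /= bdry01.
Qed.

Lemma side_point j : pant m (side m j false).1 (bdry (side m j false).2 0) =
  pant m (side m j true).1 (bdry (side m j true).2 0).
Proof.
case E : (side m j false) => [v i]; case E' : (side m j true) => [w i'] /=.
have [_ c01 _] := gam_simple j.
by rewrite (pant_bdry hm E (@I01_0 R)) (pant_bdry hm E' (@I01_0 R)) subr0.
Qed.

Lemma crossing_loopP j b : loop_at (base m) (crossing_loop m j b).
Proof.
have [c a0 a1] := reach_from_to (side m j b); have [c' a0' a1'] := reach_from_to (side m j (~~ b)).
rewrite /crossing_loop; split; last first.
- by rewrite pcat1 prev1.
- by rewrite pcat0.
apply: pcat_path => //; first exact: prev_path.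
by rewrite prev0 a1 a1'; case: b {c a0 a1 c' a0' a1'}; rewrite /= side_point.
Qed.

Section LocalSystem.
Variables (F : Type) (T : (R -> S) -> F -> F).
Hypothesis hT : local_system T.

Lemma transport_boundary e x : T (boundary_loop m e) x =
  T (@Defs.prev R S (reach m e)) (T (pant m e.1 \o bdry e.2) (T (reach m e) x)).
Proof.
have [c a0 a1] := reach_from_to e; have cb := bdry_piece_path (e := e).
rewrite /boundary_loop; move: (reach m e) c a0 a1 => r c a0 a1; rewrite !(ls_cat hT) //.
- exact: pcat_path.
- exact: prev_path.
- by rewrite pcat1 prev0 a1 /= bdry01.
Qed.

Lemma transport_reach e x : T (reach m e) x = T (pant m e.1 \o tail e.2) (T (arm m e.1) x).
Proof.
have [c a0 a1] := arm_path e.1.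
by rewrite /reach (ls_cat hT) //; [exact: tail_piece_path | rewrite a1 /= tail0].
Qed.

Lemma transport_crossing j b x : T (crossing_loop m j b) x =
  T (@Defs.prev R S (reach m (side m j (~~ b)))) (T (reach m (side m j b)) x).
Proof.
have [c a0 a1] := reach_from_to (side m j b); have [c' a0' a1'] := reach_from_to (side m j (~~ b)).
rewrite /crossing_loop (ls_cat hT) //; first exact: prev_path.
by rewrite prev0 a1 a1'; case: b {c a0 a1 c' a0' a1'}; rewrite /= side_point.
Qed.

(** Each boundary loop acts as a lasso of the model pants conjugated by the arm, so [lasso_relation]
    applies. *)
Lemma transport_relation v x :
  T (boundary_loop m (v, inord 2)) (T (boundary_loop m (v, inord 1))
    (T (boundary_loop m (v, inord 0)) x)) = x.
Proof.
have [c a0 a1] := arm_path v.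
have key i y : T (boundary_loop m (v, i)) y =
    T (@Defs.prev R S (arm m v)) (lasso T (pant m v) i (T (arm m v) y)).
  have [c' a0' a1'] := reach_from_to (v, i); have ct := tail_piece_path (e := (v, i)).
  rewrite transport_boundary /lasso (transport_reach (v, i)) /=.
  move: (T (pant m v \o bdry i) _) => z.
  have <- : T (reach m (v, i)) (T (@Defs.prev R S (arm m v)) (T (@Defs.prev R S (pant m v \o tail i)) z)) = z.
    by rewrite transport_reach /= (ls_Kprev hT) // (ls_Kprev hT).
  by rewrite (ls_prevK hT) // transport_reach /= (ls_Kprev hT) // (ls_prevK hT).
rewrite !key !(ls_Kprev hT) // (lasso_relation hT (pant_cont hm (v := v))).
exact: ls_prevK.
Qed.

(* Such a family extends to a flat section over the whole surface. *)
Lemma transport_rigidity (G : 'I_(2 * g - 2) -> F) :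
  (forall v (i : 'I_3), i != inord 2 -> T (boundary_loop m (v, i)) (G v) = G v) ->
  (forall j, T (crossing_loop m j false) (G (side m j false).1) = G (side m j true).1) ->
  (forall v p, loop_at (base m) p -> T p (G v) = G v) /\ (forall v w, G v = G w).
Proof.
move=> hb hc.
have sec v : exists n, flat T (pant m v) (@pants R) n /\ n (pants_base R) = T (arm m v) (G v).
  have [|n h1 h2] := @pants_section _ _ _ _ hT _ (pant_cont hm (v := v)) (T (arm m v) (G v)).
    move=> i hi; have [c a0 a1] := reach_from_to (v, i).
    rewrite -(transport_reach (v, i)) -{2}(hb v i hi) transport_boundary /=.
    by rewrite (ls_Kprev hT).
  by exists n.
have [n hn] := choice sec.
have nb v i : n v (bdry i 0) = T (reach m (v, i)) (G v).
  have [fl e] := hn v; rewrite transport_reach /= -e -(tail0 R i) -tail1.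
  symmetry; apply: fl; first exact: tail_path.
  by move=> t it; have [] := tail_half i it.
have [|N [hN fl]] := global_section hS hm gam_simple gam_disjoint hT (fun v => (hn v).1).
  move=> j; rewrite !nb -!surjective_pairing -[in RHS]hc transport_crossing /=.
  by have [c a0 a1] := reach_from_to (side m j true); rewrite (ls_Kprev hT).
have Nb v : N (base m) = G v.
  have [c a0 a1] := arm_path v; have [_ e] := hn v.
  have Pb := (base_half R).1.
  have := fl (arm m v) c (fun _ _ => I); rewrite a0 a1 hN // e => e'.
  by rewrite -[LHS](ls_prevK hT _ c) e' (ls_prevK hT).
split=> [v p [cp p0 p1]|v w]; last by rewrite -!Nb.
by rewrite -(Nb v); have := fl p cp (fun _ _ => I); rewrite p0 p1.
Qed.
End LocalSystem.

(** Connectedness of the graph of pants, read off from [transport_rigidity] for the constant local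
    system. *)
Lemma constant_on_pants (F : Type) (G : 'I_(2 * g - 2) -> F) :
  (forall j, G (side m j false).1 = G (side m j true).1) -> forall v w, G v = G w.
Proof.
move=> h; have hT : local_system (fun (_ : R -> S) (e : F) => e) by [].
by have [] := transport_rigidity hT (fun _ _ _ => erefl) h.
Qed.

(** The boundary loop is the curve conjugated by the path that reaches it, and this path can be
    cancelled in homotopy. With total loxodromy it makes the peripheral elements loxodromic. *)
Lemma boundary_not_null j : ~ null_homotopic (gam j) -> ~ null_homotopic (boundary_loop m (side m j false)).
Proof.
move=> ng hn; apply: ng; case E : (side m j false) hn => [v i] hn.
have [c a0 a1] := reach_from_to (v, i); have cb := bdry_piece_path (e := (v, i)).
have cl := boundary_loopP (v, i).
move: hn; rewrite /null_homotopic; have [_ -> _] := cl => hn.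
set r := reach m (v, i) in c a0 a1 *; set b := pant m v \o bdry i.
have c' := prev_path c.
have rb : r 1 = b 0 by rewrite a1.
have b01 : b 1 = b 0 by rewrite /b /= bdry01.
have crb : is_path (pcat r b) by exact: pcat_path.
have h1 : path_homotopic (pcat r b) r.
  apply: (@hom_trans _ _ _ (pcat (pcat r b) (pcat (@Defs.prev R S r) r))).
    apply: (@hom_trans _ _ _ (pcat (pcat r b) (fun=> r 1))).
      by apply: hom_sym; rewrite ?pcat0 ?pcat1 //; [apply: hom_unitr => //; rewrite pcat1 b01 rb | rewrite b01 rb].
    apply: hom_cat; [by rewrite pcat1 b01 rb | exact: hom_refl|].
    by apply: hom_sym; rewrite ?pcat0 ?pcat1 ?prev0 //; exact: hom_prevl.
  apply: (@hom_trans _ _ _ (pcat (pcat (pcat r b) (@Defs.prev R S r)) r)).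
    apply: hom_sym; rewrite ?pcat0 ?pcat1 //.
    by apply: hom_assoc; rewrite ?pcat1 ?prev0 ?prev1 ?b01 ?rb.
  apply: (@hom_trans _ _ _ (pcat (fun=> base m) r)); last exact: hom_unitl.
  by apply: hom_cat => //; [rewrite pcat1 prev1 | exact: hom_refl].
have h2 : path_homotopic b (fun=> b 0).
  apply: (@hom_trans _ _ _ (pcat (@Defs.prev R S r) (pcat r b))).
    apply: (@hom_trans _ _ _ (pcat (pcat (@Defs.prev R S r) r) b)).
      apply: (@hom_trans _ _ _ (pcat (fun=> r 1) b)).
        by apply: hom_sym; rewrite ?pcat0 ?pcat1 //; exact: hom_unitl.
      apply: hom_cat; [by [] | | exact: hom_refl].
      by apply: hom_sym; rewrite ?pcat0 ?pcat1 ?prev0 //; exact: hom_prevl.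
    by apply: hom_assoc => //; rewrite prev1.
  apply: (@hom_trans _ _ _ (pcat (@Defs.prev R S r) r)).
    by apply: hom_cat => //; [rewrite prev1 pcat0 | exact: hom_refl].
  by rewrite -rb; exact: hom_prevl.
have [cg _ _] := gam_simple j.
have gb t : @I01 R t -> gam j t = b t by move=> it; rewrite /b /= (pant_bdry hm E it).
rewrite gb; last exact: I01_0.
by apply: hom_trans h2; exact: path_homotopic_refl.
Qed.
End Rigidity.

(** * Relations between the peripheral elements *)

Section SurfaceGroup.
Variables (R : realType) (S : topologicalType) (g : nat).
Variables (gam : 'I_(3 * g - 3) -> R -> S) (m : marking R S g).
Hypothesis hm : marks gam m.
Hypothesis gam_simple : forall j, simple_closed (gam j).
Notation M := 'M[R[i]]_4.
Variable rho : (R -> S) -> M.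
Hypothesis hrho : representation (base m) rho.

Definition phi := ext_rho (base m) rho.

Lemma phi_unit p : is_path p -> phi p \in unitmx.
Proof. by move=> cp; exact: (SU31_unit (ext_SU31 hrho cp)). Qed.

Lemma rho_SU31 p : loop_at (base m) p -> SU31 (rho p).
Proof. by case: hrho => h _ _; apply: h. Qed.

Lemma rho_bdryE e : rho_bdry m rho e =
  phi (reach m e) *m phi (pant m e.1 \o bdry e.2) *m invmx (phi (reach m e)).
Proof.
have [c a0 a1] := reach_from_to hm e; have cb := bdry_piece_path hm (e := e).
rewrite /rho_bdry -(ext_loop hrho (boundary_loopP hm e)) /boundary_loop /phi.
move: (reach m e) c a0 a1 => r c a0 a1.
rewrite (ext_cat hrho) ?(ext_prev hrho) // ?(ext_cat hrho) //.
- exact: pcat_path.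
- exact: prev_path.
- by rewrite pcat1 prev0 a1 /= bdry01.
Qed.

Lemma rho_crossingE j b : rho (crossing_loop m j b) =
  phi (reach m (side m j b)) *m invmx (phi (reach m (side m j (~~ b)))).
Proof.
have [c a0 a1] := reach_from_to hm (side m j b); have [c' a0' a1'] := reach_from_to hm (side m j (~~ b)).
rewrite -(ext_loop hrho (crossing_loopP hm gam_simple j b)) /crossing_loop /phi.
rewrite (ext_cat hrho) ?(ext_prev hrho) //; first exact: prev_path.
by rewrite prev0 a1 a1'; case: b {c a0 a1 c' a0' a1'}; rewrite /= (side_point hm gam_simple).
Qed.

Lemma rho_crossing_true j : rho (crossing_loop m j true) = invmx (rho (crossing_loop m j false)).
Proof.
have [c _ _] := reach_from_to hm (side m j true); have [c' _ _] := reach_from_to hm (side m j false).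
by rewrite !rho_crossingE /= invmx_mul ?invmxK // ?unitmx_inv; exact: phi_unit.
Qed.

(** The crossing loop brings both boundary loops to the same approach path, where they run along one
    curve in opposite directions. *)
Lemma rho_opposite j : cj (rho (crossing_loop m j false)) (rho_bdry m rho (side m j true)) =
  invmx (rho_bdry m rho (side m j false)).
Proof.
have [c _ _] := reach_from_to hm (side m j true); have [c' _ _] := reach_from_to hm (side m j false).
have [u u'] := (phi_unit c, phi_unit c').
have ub := phi_unit (bdry_piece_path hm (e := side m j false)).
rewrite !rho_bdryE !rho_crossingE /=.
have -> : phi (pant m (side m j true).1 \o bdry (side m j true).2) =
    invmx (phi (pant m (side m j false).1 \o bdry (side m j false).2)).
  rewrite /phi -(ext_prev hrho); last exact: (bdry_piece_path hm (e := side m j false)).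
  have cb := bdry_piece_path hm (e := side m j true).
  have e t : @I01 R t -> (pant m (side m j true).1 \o bdry (side m j true).2) t =
      @Defs.prev R S (pant m (side m j false).1 \o bdry (side m j false).2) t.
    case E : (side m j false) => [v i]; case E' : (side m j true) => [w i'] it /=.
    rewrite /Defs.prev /= (pant_bdry hm E' it) (pant_bdry hm E) //; exact: I01_flip.
  apply: (ext_hom hrho) => //; last exact: path_homotopic_refl.
  by apply: prev_path; exact: (bdry_piece_path hm (e := side m j false)).
have hs p : is_path p -> SU31 (phi p) by exact: (ext_SU31 hrho).
have hu := hs _ c; have hu' := hs _ c'.
rewrite -/(cj _ (invmx _)) -/(cj _ (phi _)) cj_cj //; last by apply: SU31_mul => //; exact: SU31_inv.
by rewrite mulmxKV // cj_inv.
Qed.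

Lemma trivial_representation : representation (base m) (fun _ : R -> S => 1%:M : M).
Proof. by split=> // [p _|p q _ _]; [exact: SU31_1 | rewrite mulmx1]. Qed.

(** For the twisted system between rho and the trivial representation, transport is right
    multiplication by rho. [transport_relation] at the identity then says that the three peripheral
    elements have product one. *)
Lemma rho_third v : rho_bdry m rho (v, inord 2) =
  invmx (rho_bdry m rho (v, inord 1)) *m invmx (rho_bdry m rho (v, inord 0)).
Proof.
have := transport_relation hm (twist_system hrho trivial_representation) v 1%:M.
have l i := boundary_loopP hm (v, i).
have tr (p : R -> S) (e : M) : loop_at (base m) p ->
    twist (base m) rho (fun=> 1%:M) p e = e *m rho p.
  move=> lp; apply/(twist_fix hrho trivial_representation) => //.
  by rewrite mul1mx.
rewrite !tr // mul1mx -!/(rho_bdry _ _ _) => e.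
have u i : rho_bdry m rho (v, i) \in unitmx by exact: (SU31_unit (rho_SU31 (l i))).
by rewrite -invmx_mul // -[LHS](mulKmx (x := rho_bdry m rho (v, inord 0) *m rho_bdry m rho (v, inord 1))) ?unitmx_mul ?u // e mulmx1.
Qed.
End SurfaceGroup.

(** * Twists and coordinates *)

Section Scalars.
Variables (R : realType) (S : topologicalType) (g : nat).
Variables (gam : 'I_(3 * g - 3) -> R -> S) (m : marking R S g).
Hypotheses (g2 : (2 <= g)%N) (hS : closed_surface R S) (hm : marks gam m).
Hypothesis gam_simple : forall j, simple_closed (gam j).
Hypothesis gam_disjoint : forall i j, i != j -> disjoint_curves (gam i) (gam j).
Hypothesis hsimple : is_simple m.
Notation C := R[i].

Lemma pants_gt0 : (0 < 2 * g - 2)%N.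
Proof. by clear -g2; lia. Qed.

(* There is one curve less between distinct pairs of pants than there are pairs
   of pants, and the pants are connected through them, so by counting every
   cochain on these curves is a coboundary. *)
Lemma coboundary_surj (c : 'I_(3 * g - 3) -> 'Z_4) : exists k : 'I_(2 * g - 2) -> 'Z_4,
  forall j, ~~ is_handle m j -> k (side m j true).1 + c j = k (side m j false).1.
Proof.
pose E := {j : 'I_(3 * g - 3) | ~~ is_handle m j}.
pose v0 := Ordinal pants_gt0.
pose d (k : {ffun 'I_(2 * g - 2) -> 'Z_4}) : {ffun E -> 'Z_4} * 'Z_4 :=
  ([ffun j : E => k (side m (val j) false).1 - k (side m (val j) true).1], k v0).
have dinj : injective d.
  move=> k k' [/ffunP ed e0].
  have const : forall v w, k v - k' v = k w - k' w.
    apply: (constant_on_pants hS hm gam_simple gam_disjoint) => j.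
    case: (boolP (is_handle m j)) => [/eqP -> //|nh].
    have := ed (Sub j nh); rewrite !ffunE /= => e.
    move: e; move: (k _) (k _) (k' _) (k' _) => x y x' y' /eqP.
    by rewrite subr_eq => /eqP ->; ring.
  apply/ffunP => v; apply/eqP; rewrite -subr_eq0 (const v v0).
  by rewrite e0 subrr.
have cardE : #|{: {ffun E -> 'Z_4} * 'Z_4}| = #|{ffun 'I_(2 * g - 2) -> 'Z_4}|.
  rewrite card_prod !card_ffun !card_ord card_sig -expnSr; congr (_ ^ _)%N.
  have := cardsC [set j | is_handle m j]%SET; rewrite card_ord hsimple => e.
  have -> : #|[pred j | ~~ is_handle m j]| = #|~: [set j | is_handle m j]%SET|.
    by apply: eq_card => j; rewrite !inE.
  by clear -e g2; lia.
have [k hk] : exists k, d k = ([ffun j : E => c (val j)], 0).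
  have /codomP[k ->] : ([ffun j : E => c (val j)], 0) \in codom d; last by exists k.
  by apply: inj_card_onto => //; rewrite cardE.
exists k => j nh; case: hk => /ffunP /(_ (Sub j nh)); rewrite !ffunE /= => <- _.
by rewrite addrC subrK.
Qed.

Lemma fourth_root (c : C) : c ^+ 4 = 1 -> exists n : 'Z_4, c = 'i ^+ n.
Proof.
move=> h; have : (c ^+ 2 - 1) * (c ^+ 2 + 1) = 0.
  by have -> : (c ^+ 2 - 1) * (c ^+ 2 + 1) = c ^+ 4 - 1; [ring | rewrite h subrr].
have i2 := sqr_i R.
move/eqP; rewrite mulf_eq0 => /orP[|].
  rewrite subr_eq0 sqrf_eq1 => /orP[/eqP->|/eqP->]; first by exists 0; rewrite expr0.
  by exists (inZp 2); rewrite /= -i2.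
have -> : c ^+ 2 + 1 = (c - 'i) * (c + 'i) by rewrite -subr_sqr i2 opprK.
rewrite mulf_eq0 subr_eq0 addr_eq0 => /orP[/eqP->|/eqP->]; first by exists (inZp 1); rewrite expr1.
by exists (inZp 3); rewrite /= exprS i2 mulrN1.
Qed.

(** The additive statement [coboundary_surj], carried over to fourth roots of unity by powers of
    'i. *)
Lemma scalar_correction (c : 'I_(3 * g - 3) -> C) :
  (forall j, ~~ is_handle m j -> c j ^+ 4 = 1) ->
  exists s : 'I_(2 * g - 2) -> C, (forall v, s v != 0) /\
    forall j, ~~ is_handle m j -> s (side m j true).1 * c j = s (side m j false).1.
Proof.
move=> hc.
have [n hn] : exists n : 'I_(3 * g - 3) -> 'Z_4, forall j, ~~ is_handle m j -> c j = 'i ^+ n j.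
  have ex j : exists n : 'Z_4, ~~ is_handle m j -> c j = 'i ^+ n.
    case: (boolP (is_handle m j)) => h; first by exists 0.
    by have [n e] := fourth_root (hc j h); exists n.
  by have [n e] := choice ex; exists n.
have [k hk] := coboundary_surj n.
have i4 : ('i : C) ^+ 4 = 1 by rewrite (exprM _ 2 2) sqr_i sqrrN expr1n.
have i0 : ('i : C) != 0 by apply/eqP => e; move: i4; rewrite e expr0n /= => /eqP; rewrite eq_sym oner_eq0.
exists (fun v => 'i ^+ k v); split=> [v|j nh]; first exact: expf_neq0.
by rewrite hn // -(hk j nh) -exprD /= -[RHS](expr_mod _ i4) modn_mod expr_mod.
Qed.
End Scalars.

Section Pieces.
Variable R : realType.
Notation C := R[i].
Notation M := 'M[C]_4.
Implicit Types (A B Z g h : M) (p q : M * M).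

Lemma peripheral_cj g p i : SU31 g -> p.1 \in unitmx -> p.2 \in unitmx ->
  peripheral (cj g p.1, cj g p.2) i = cj g (peripheral p i).
Proof.
move=> hg u1 u2; rewrite /peripheral; case: (ord3P i) => ->; rewrite inordK //=.
by rewrite cj_mul // !cj_inv.
Qed.

Lemma cj_fix_comm Z A : SU31 Z -> cj Z A = A -> Z *m A = A *m Z.
Proof.
by move=> /SU31_unit u e; rewrite -[in RHS]e /cj mulmxKV.
Qed.

Lemma cj_fix_inv Z A : SU31 Z -> A \in unitmx -> cj Z (invmx A) = invmx A <-> cj Z A = A.
Proof.
move=> hZ uA; rewrite cj_inv //; split=> [e|->//].
by rewrite -(invmxK (cj Z A)) e invmxK.
Qed.

(** Any two of A, B, B^-1 A^-1 generate the group, so an element centralizing two of them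
    centralizes the third. *)
Lemma cj_fix_pair Z p (i k : 'I_3) : SU31 Z -> p.1 \in unitmx -> p.2 \in unitmx -> i != k ->
  cj Z (peripheral p i) = peripheral p i -> cj Z (peripheral p k) = peripheral p k ->
  cj Z p.1 = p.1 /\ cj Z p.2 = p.2.
Proof.
move=> hZ u1 u2.
have c3 : cj Z (invmx p.2 *m invmx p.1) = invmx p.2 *m invmx p.1 ->
    (cj Z p.1 = p.1 <-> cj Z p.2 = p.2).
  rewrite -invmx_mul // => /(cj_fix_inv hZ); rewrite unitmx_mul u1 u2 => /(_ isT).
  rewrite cj_mul // => e; split=> h; rewrite h in e.
    by have := congr1 (mulmx (invmx p.1)) e; rewrite !mulKmx.
  by have := congr1 (mulmx^~ (invmx p.2)) e; rewrite !mulmxK.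
rewrite /peripheral; case: (ord3P i) => ->; case: (ord3P k) => ->; rewrite ?eqxx // !inordK //= => _.
- by move=> h1 /c3 h; split=> //; apply/h.
- by move=> h2 /c3 h; split=> //; apply/h.
- by move=> /c3 h h1; split=> //; apply/h.
- by move=> /c3 h h2; split=> //; apply/h.
Qed.

Lemma SU31_scalar (c : C) : SU31 (c%:M : M) -> c ^+ 4 = 1.
Proof. by case=> h _; rewrite -det_scalar. Qed.

Lemma peripheral_centralizer p (i k : 'I_3) Z : nonsingular p.1 p.2 -> i != k -> SU31 Z ->
  cj Z (peripheral p i) = peripheral p i -> cj Z (peripheral p k) = peripheral p k ->
  exists c : C, c ^+ 4 = 1 /\ Z = c%:M.
Proof.
move=> ns ik hZ hi hk; have [[lA lB] _ _ _] := ns.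
have [hA _ _] := lA; have [hB _ _] := lB.
have [h1 h2] := cj_fix_pair hZ (SU31_unit hA) (SU31_unit hB) ik hi hk.
have [FA [l1 [l2 [l3 [nA dA]]]]] := loxodromic_eigenframe lA.
have [FB [m1 [m2 [m3 [nB dB]]]]] := loxodromic_eigenframe lB.
have bp := nonsingular_basis ns nA dA nB dB.
have [c e] := centralizer_scalar hA hB nA dA nB dB bp hZ (cj_fix_comm hZ h1) (cj_fix_comm hZ h2).
by exists c; split=> //; apply: SU31_scalar; rewrite -e.
Qed.

Lemma Emx0 : Emx (0 : C) (0 : R) = 1%:M.
Proof.
have ce : cexp (0 : C) = 1 by rewrite /cexp /= expR0 /cis cos0 sin0 mul1r.
have z : (0 +i* 0 : C) = 0 by [].
rewrite /Emx z rmorph0 subrr mul0r oppr0 !addr0 !ce -diag_const_mx.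
congr diag_mx; apply/rowP => j; rewrite !mxE.
by case: (ord4P j) => ->; rewrite inordK.
Qed.

Lemma angle0 : is_angle (0 : R).
Proof. by split; rewrite ?oppr_lt0 ?pi_gt0 ?pi_ge0. Qed.

Variables (lab : {poly C} -> C) (hlab : labelling lab).

Definition sep_good p q : set (sep_group R) :=
  [set G | [/\ diagonalizes lab (sA G) (sQ G), conj2 p (sA G, sB G) &
               conj2 q (sC G, invmx (sA G))]].

Definition handle_good p : set (handle_group R) :=
  [set G | [/\ diagonalizes lab (hA G) (hQ G), SU31 (hB G) &
               conj2 p (hA G, cj (hB G) (invmx (hA G)))]].

Lemma sep_good_conj p p' q q' : conj2 p p' -> conj2 q q' -> sep_good p q = sep_good p' q'.
Proof.
move=> hp hq; rewrite eqEsubset; split=> G [d h1 h2]; (split; first exact: d).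
- exact: conj2_trans (conj2_sym hp) h1.
- exact: conj2_trans (conj2_sym hq) h2.
- exact: conj2_trans hp h1.
- exact: conj2_trans hq h2.
Qed.

Lemma handle_good_conj p p' : conj2 p p' -> handle_good p = handle_good p'.
Proof.
move=> hp; rewrite eqEsubset; split=> G [d h1 h2]; (split; [exact: d | exact: h1 |]).
- exact: conj2_trans (conj2_sym hp) h2.
- exact: conj2_trans hp h2.
Qed.

Lemma sep_good_exists p q : loxodromic p.1 -> conj1 (invmx p.1) q.2 ->
  exists G, sep_good p q G.
Proof.
move=> l1 [h hh e]; have [Q dQ] := diagonalizes_exists hlab l1.
exists (SepGroup p.1 p.2 (cj (invmx h) q.1) Q); split=> //=.
  by exists 1%:M; [exact: SU31_1 | rewrite /= !cj1].
by exists (invmx h); [exact: SU31_inv | rewrite /= e cjK].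
Qed.

Lemma handle_good_exists p : loxodromic p.1 -> conj1 (invmx p.1) p.2 ->
  exists G, handle_good p G.
Proof.
move=> l1 [h hh e]; have [Q dQ] := diagonalizes_exists hlab l1.
by exists (HandleGroup p.1 h Q); split=> //=; exists 1%:M; [exact: SU31_1 | rewrite /= !cj1].
Qed.

Definition some_of (X : Type) (x : X) (P : set X) : X :=
  if pselect (exists y, P y) is left h then projT1 (cid h) else x.

Lemma some_ofP (X : Type) (x : X) (P : set X) : (exists y, P y) -> P (some_of x P).
Proof. by rewrite /some_of; case: pselect => // h _; case: cid. Qed.

(** On the conjugacy classes of the given pieces the prescribed group is returned, elsewhere a
    choice among the admissible groups. The set of admissible groups depends only on the conjugacy
    classes of the pieces, hence so does the choice. *)
Lemma reference_exists (J : Type) (P0 Q0 H0 : J -> M * M) (G0 : J -> sep_group R) (K0 : J -> handle_group R) :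
  (forall j, sep_good (P0 j) (Q0 j) (G0 j)) -> (forall j, handle_good (H0 j) (K0 j)) ->
  exists T : references R J, [/\ reference_system lab T,
    forall j, sep_ref T j (P0 j) (Q0 j) = G0 j & forall j, handle_ref T j (H0 j) = K0 j].
Proof.
move=> hG hK.
pose sr j p q := if pselect (conj2 p (P0 j) /\ conj2 q (Q0 j)) then G0 j
                 else some_of (G0 j) (sep_good p q).
pose hr j p := if pselect (conj2 p (H0 j)) then K0 j else some_of (K0 j) (handle_good p).
exists (References sr hr); split; first split=> /=.
- move=> j p p' q q' hp hq; rewrite /sr (sep_good_conj hp hq).
  have e1 : conj2 p (P0 j) = conj2 p' (P0 j).
    by apply/propext; split=> h; [exact: conj2_trans (conj2_sym hp) h | exact: conj2_trans hp h].
  have e2 : conj2 q (Q0 j) = conj2 q' (Q0 j).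
    by apply/propext; split=> h; [exact: conj2_trans (conj2_sym hq) h | exact: conj2_trans hq h].
  by rewrite e1 e2.
- move=> j p p' hp; rewrite /hr (handle_good_conj hp).
  have -> // : conj2 p (H0 j) = conj2 p' (H0 j).
  by apply/propext; split=> h; [exact: conj2_trans (conj2_sym hp) h | exact: conj2_trans hp h].
- move=> j p q l1 _ _ c1; rewrite /sr; case: pselect => [[hp hq]|?].
    by have := hG j; rewrite -(sep_good_conj hp hq).
  exact: some_ofP (sep_good_exists l1 c1).
- move=> j p l1 c1; rewrite /hr; case: pselect => [hp|?].
    by have := hK j; rewrite -(handle_good_conj hp).
  exact: some_ofP (handle_good_exists l1 c1).
- by move=> j; rewrite /= /sr; case: pselect => // -[]; split; exact: conj2_refl.
- by move=> j; rewrite /= /hr; case: pselect => // -[]; exact: conj2_refl.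
Qed.
End Pieces.

(** * Twist-bend parameters along one curve *)

Section Twists.
Variable R : realType.
Notation C := R[i].
Notation M := 'M[C]_4.
Implicit Types (A B D F X Z g h x w K : M).

Definition handle_twist (G : handle_group R) K A x : Prop :=
  exists2 h, SU31 h & hA G = cj h A /\ hB G *m K = cj h x.

Definition sep_twist (G : sep_group R) K A B D x : Prop :=
  exists2 h, SU31 h &
    [/\ sA G = cj h A, sB G = cj h B & cj K (sC G) = cj h (cj x D)].

Lemma cj_distr g x X : SU31 g -> SU31 x -> cj g (cj x X) = cj (cj g x) (cj g X).
Proof.
move=> hg hx; have hgx := SU31_cj hg hx; rewrite (cj_cj _ hg hx) (cj_cj _ hgx hg).
by rewrite [cj g x]/cj mulmxKV //; exact: SU31_unit.
Qed.

Lemma cj_cancel g h X Y : SU31 g -> SU31 h -> cj g X = cj h Y -> cj (invmx h *m g) X = Y.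
Proof. by move=> hg hh e; have hV := SU31_inv hh; rewrite -(cj_cj _ hV hg) e cjK. Qed.

(** The reference element b and the conjugated crossing element both carry the inverse of a to the
    second peripheral element. Their quotient K thus commutes with a and is diagonal by
    [diagonalizes_commutant]. *)
Lemma handle_twist_exists lab G A F x : diagonalizes lab (hA G) (hQ G) -> SU31 (hB G) ->
  conj2 (A, F) (hA G, cj (hB G) (invmx (hA G))) -> F = cj x (invmx A) -> SU31 A -> SU31 x ->
  separable_poly (char_poly A) ->
  exists kp : C * R, [/\ is_angle (complex.Im kp.1), is_angle kp.2 &
    handle_twist G (cj (hQ G) (Emx kp.1 kp.2)) A x].
Proof.
case: G => a b Q /= dG hb [h hh [/= eA eB]] eF hA hx sep.
have uA := SU31_unit hA.
have hy : SU31 (cj h x) by exact: SU31_cj.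
have ha : SU31 a by rewrite eA; exact: SU31_cj.
have hbV := SU31_inv hb; have hK : SU31 (invmx b *m cj h x) by exact: SU31_mul.
have fixK : cj (invmx b *m cj h x) a = a.
  apply/(cj_fix_inv hK (SU31_unit ha)); apply: cj_cancel => //.
  by rewrite eB eF (cj_distr _ hh hx) (cj_inv hh uA) eA.
have sep' : separable_poly (char_poly a) by rewrite eA char_poly_cj.
have [kp [a1 a2 eK]] := diagonalizes_commutant ha dG sep' hK (cj_fix_comm hK fixK).
exists kp; split; [exact: a1 | exact: a2 | exists h; [exact: hh | split; [exact: eA |]]].
by rewrite -eK /= mulKVmx //; exact: SU31_unit.
Qed.

(** If h and h' bring the two pieces to the reference group, then K = h x h'^-1 fixes a under
    conjugation, because x carries F to the inverse of A. *)
Lemma sep_twist_exists lab G A B D F x : diagonalizes lab (sA G) (sQ G) ->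
  conj2 (A, B) (sA G, sB G) -> conj2 (D, F) (sC G, invmx (sA G)) ->
  cj x F = invmx A -> SU31 A -> SU31 x -> separable_poly (char_poly A) ->
  exists kp : C * R, [/\ is_angle (complex.Im kp.1), is_angle kp.2 &
    sep_twist G (cj (sQ G) (Emx kp.1 kp.2)) A B D x].
Proof.
case: G => a b d Q /= dG [h hh [/= eA eB]] [h' hh' [/= eD eF]] exF hA hx sep.
have uA := SU31_unit hA; have hhx := SU31_mul hh hx; have hV := SU31_inv hh'.
have ha : SU31 a by rewrite eA; exact: SU31_cj.
pose K := h *m x *m invmx h'; have hK : SU31 K by exact: SU31_mul.
have cK X : cj K (cj h' X) = cj h (cj x X) by rewrite /K -(cj_cj _ hhx hV) (cjK _ hh') -(cj_cj _ hh hx).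
have fixK : cj K a = a.
  by apply/(cj_fix_inv hK (SU31_unit ha)); rewrite {1}eF cK exF (cj_inv hh uA) eA.
have sep' : separable_poly (char_poly a) by rewrite eA char_poly_cj.
have [kp [a1 a2 eK]] := diagonalizes_commutant ha dG sep' hK (cj_fix_comm hK fixK).
exists kp; split; [exact: a1 | exact: a2 | exists h; [exact: hh | split; [exact: eA | exact: eB |]]].
by rewrite -eK /= eD cK.
Qed.

Lemma handle_twist_cj G K A x g : SU31 g -> handle_twist G K A x ->
  handle_twist G K (cj g A) (cj g x).
Proof.
move=> hg [h hh [e1 e2]]; exists (h *m invmx g); first exact: SU31_mul (SU31_inv hg).
by have hV := SU31_inv hg; split; rewrite -(cj_cj _ hh hV) (cjK _ hg).
Qed.

Lemma sep_twist_cj G K A B D x g : SU31 g -> SU31 x -> sep_twist G K A B D x ->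
  sep_twist G K (cj g A) (cj g B) (cj g D) (cj g x).
Proof.
move=> hg hx [h hh [e1 e2 e3]]; exists (h *m invmx g); first exact: SU31_mul (SU31_inv hg).
have hV := SU31_inv hg; rewrite -(cj_distr _ hg hx).
by split; rewrite -(cj_cj _ hh hV) (cjK _ hg).
Qed.

Lemma scalar_factor g h (k : C) : SU31 h -> invmx h *m g = k%:M -> g = k *: h.
Proof.
by move=> /SU31_unit u e; rewrite -[LHS](mulKVmx u) e mul_mx_scalar.
Qed.

(** Both h' g and h carry A and F to the reference elements, so they differ by a scalar. Both sides
    of the curve belong to this one piece, and in the conjugations the scalar cancels. *)
Lemma handle_twist_determined G K A F x A' F' x' g : SU31 A -> SU31 g -> SU31 x -> SU31 x' ->
  (forall Z, SU31 Z -> cj Z A = A -> cj Z F = F -> exists k : C, k ^+ 4 = 1 /\ Z = k%:M) ->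
  A' = cj g A -> F' = cj g F -> F = cj x (invmx A) -> F' = cj x' (invmx A') ->
  handle_twist G K A x -> handle_twist G K A' x' -> x' *m g = g *m x.
Proof.
move=> hA hg hx hx' cent eA eF FE FE' [h hh [a1 a2]] [h' hh' [b1 b2]].
have uA := SU31_unit hA; have uA' : A' \in unitmx by rewrite eA; exact/SU31_unit/SU31_cj.
have hhg := SU31_mul hh' hg.
have cA : cj (h' *m g) A = cj h A by rewrite -(cj_cj _ hh' hg) -eA -b1.
have cF : cj (h' *m g) F = cj h F.
  rewrite -(cj_cj _ hh' hg) -eF FE FE' (cj_distr _ hh hx) (cj_distr _ hh' hx').
  by rewrite (cj_inv hh uA) (cj_inv hh' uA') -a1 -b1 -a2 -b2.
have hZ : SU31 (invmx h *m (h' *m g)) := SU31_mul (SU31_inv hh) hhg.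
have [k [k4 eZ]] := cent _ hZ (cj_cancel hhg hh cA) (cj_cancel hhg hh cF).
have e := scalar_factor hh eZ.
have k0 : k != 0 by apply/eqP => k0; move: k4; rewrite k0 expr0n /= => /eqP; rewrite eq_sym oner_eq0.
have : cj h' x' = cj h x by rewrite -a2 -b2.
rewrite /cj => e2; have uh := SU31_unit hh; have uh' := SU31_unit hh'; have ug := SU31_unit hg.
have e3 : h' *m (x' *m g) = h' *m (g *m x).
  have -> : h' *m (x' *m g) = (h' *m x' *m invmx h') *m (h' *m g) by rewrite !mulmxA mulmxKV.
  by rewrite e2 e -scalemxAr mulmxKV // mulmxA e -scalemxAl.
by rewrite -[LHS](mulKmx uh') e3 mulKmx.
Qed.

(** Each of the two pieces contributes its own scalar, k for <A, B> and l for <D, F>, and only their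
    quotient l / k remains. *)
Lemma sep_twist_determined G K A B D F x A' B' D' F' x' g w :
  SU31 A -> SU31 g -> SU31 w -> SU31 x -> SU31 x' ->
  (forall Z, SU31 Z -> cj Z A = A -> cj Z B = B -> exists k : C, k ^+ 4 = 1 /\ Z = k%:M) ->
  (forall Z, SU31 Z -> cj Z D = D -> cj Z F = F -> exists k : C, k ^+ 4 = 1 /\ Z = k%:M) ->
  A' = cj g A -> B' = cj g B -> D' = cj w D -> F' = cj w F ->
  cj x F = invmx A -> cj x' F' = invmx A' ->
  sep_twist G K A B D x -> sep_twist G K A' B' D' x' ->
  exists k : C, k ^+ 4 = 1 /\ x' *m w = k *: (g *m x).
Proof.
move=> hA hg hw hx hx' cent cent' eA eB eD eF xF xF' [h hh [a1 a2 a3]] [h' hh' [b1 b2 b3]].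
have uA := SU31_unit hA; have uA' : A' \in unitmx by rewrite eA; exact/SU31_unit/SU31_cj.
have hhg := SU31_mul hh' hg; have hhx := SU31_mul hh hx.
have hxw := SU31_mul hx' hw; have hhxw := SU31_mul hh' hxw.
have cA : cj (h' *m g) A = cj h A by rewrite -(cj_cj _ hh' hg) -eA -b1.
have cB : cj (h' *m g) B = cj h B by rewrite -(cj_cj _ hh' hg) -eB -b2.
have cD : cj (h' *m (x' *m w)) D = cj (h *m x) D 
  by rewrite -(cj_cj _ hh' hxw) -(cj_cj _ hx' hw) -(cj_cj _ hh hx) -eD -b3.
have cF : cj (h' *m (x' *m w)) F = cj (h *m x) F.
  rewrite -(cj_cj _ hh' hxw) -(cj_cj _ hx' hw) -(cj_cj _ hh hx) -eF xF xF'.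
  by rewrite (cj_inv hh uA) (cj_inv hh' uA') -a1 -b1.
have hZ : SU31 (invmx h *m (h' *m g)) := SU31_mul (SU31_inv hh) hhg.
have hY : SU31 (invmx (h *m x) *m (h' *m (x' *m w))) := SU31_mul (SU31_inv hhx) hhxw.
have [k [k4 eZ]] := cent _ hZ (cj_cancel hhg hh cA) (cj_cancel hhg hh cB).
have [l [l4 eY]] := cent' _ hY (cj_cancel hhxw hhx cD) (cj_cancel hhxw hhx cF).
have e := scalar_factor hh eZ; have e' := scalar_factor hhx eY.
have k0 : k != 0 by apply/eqP => k0; move: k4; rewrite k0 expr0n /= => /eqP; rewrite eq_sym oner_eq0.
exists (l / k); split; first by rewrite expr_div_n l4 k4 divr1.
have uh' := SU31_unit hh'; apply: (can_inj (mulKmx uh')).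
by rewrite e' -scalemxAr mulmxA e -scalemxAl scalerA divfK.
Qed.
End Twists.

(** * Coordinates of a tame representation *)

Section Representation.
Variables (R : realType) (S : topologicalType) (g : nat).
Variables (gam : 'I_(3 * g - 3) -> R -> S) (m : marking R S g).
Notation C := R[i].
Notation M := 'M[C]_4.
Variable lab : {poly C} -> C.
Hypotheses (g2 : (2 <= g)%N) (hS : closed_surface R S) (hC : curve_system gam)
  (hm : marks gam m) (hsimple : is_simple m) (hlab : labelling lab).
Implicit Types (rho : (R -> S) -> M) (v : 'I_(2 * g - 2)) (e : 'I_(2 * g - 2) * 'I_3).

Let gam_simple j : simple_closed (gam j).
Proof. by case: hC => h _ _ _; have [] := h j. Qed.

Let gam_disjoint i j : i != j -> disjoint_curves (gam i) (gam j).
Proof. by case: hC => _ h _ _; apply: h. Qed.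

Lemma tame_representation rho : tame m rho -> representation (base m) rho.
Proof. by case. Qed.

Lemma rho_bdry_SU31 rho e : tame m rho -> SU31 (rho_bdry m rho e).
Proof. by move=> /tame_representation h; apply: (rho_SU31 h); exact: (boundary_loopP hm). Qed.

Lemma rho_crossing_SU31 rho j b : tame m rho -> SU31 (rho (crossing_loop m j b)).
Proof. by move=> /tame_representation h; apply: (rho_SU31 h); exact: (crossing_loopP hm gam_simple). Qed.

Lemma peripheral_piece rho v i : tame m rho -> peripheral (piece m rho v) i = rho_bdry m rho (v, i).
Proof.
move=> ht; rewrite /peripheral; case: (ord3P i) => ->; rewrite inordK //=.
by rewrite (rho_third hm (tame_representation ht)).
Qed.

Lemma rho_side_true rho j : tame m rho -> rho_bdry m rho (side m j true) =
  cj (rho (crossing_loop m j true)) (invmx (rho_bdry m rho (side m j false))).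
Proof.
move=> ht; have hr := tame_representation ht.
rewrite (rho_crossing_true hm gam_simple hr) -(rho_opposite hm gam_simple hr) cjK //.
exact: rho_crossing_SU31.
Qed.

Lemma rho_bdry_lox rho e : tame m rho -> loxodromic (rho_bdry m rho e).
Proof.
move=> ht; have [_ _ _ tl _] := ht.
have lf j : loxodromic (rho_bdry m rho (side m j false)).
  apply: tl; first exact: (boundary_loopP hm).
  by apply: (boundary_not_null hm gam_simple); case: hC => h _ _ _; have [] := h j.
have [j [b <-]] : exists j b, side m j b = e by case: (e) => v i; exact: (side_surj hm).
case: b => //; rewrite rho_side_true //; apply: lox_cj; first exact: rho_crossing_SU31.
exact: lox_inv.
Qed.

Lemma sides_conj rho j : tame m rho ->
  conj1 (invmx (rho_bdry m rho (side m j false))) (rho_bdry m rho (side m j true)).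
Proof.
by move=> ht; exists (rho (crossing_loop m j true)); [exact: rho_crossing_SU31 | exact: rho_side_true].
Qed.

Lemma twist_handleE (T : references R 'I_(3 * g - 3)) rho kp j : is_handle m j ->
  let G := handle_ref T j (rho_bdry m rho (side m j false), rho_bdry m rho (side m j true)) in
  twist_bend m T rho j kp <-> [/\ is_angle (complex.Im kp.1), is_angle kp.2 &
    handle_twist G (cj (hQ G) (Emx kp.1 kp.2)) (rho_bdry m rho (side m j false))
      (rho (crossing_loop m j true))].
Proof.
by move=> hj; rewrite /twist_bend hj; split=> [[a [b d]]|[a b d]]; [split | split; [|split]].
Qed.

Lemma twist_sepE (T : references R 'I_(3 * g - 3)) rho kp j : ~~ is_handle m j ->
  let e := side m j false in let f := side m j true in
  let G := sep_ref T j (rho_bdry m rho e, rho_bdry m rho (next_side e))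
                       (rho_bdry m rho (prev_side f), rho_bdry m rho f) in
  twist_bend m T rho j kp <-> [/\ is_angle (complex.Im kp.1), is_angle kp.2 &
    sep_twist G (cj (sQ G) (Emx kp.1 kp.2)) (rho_bdry m rho e) (rho_bdry m rho (next_side e))
      (rho_bdry m rho (prev_side f)) (rho (crossing_loop m j false))].
Proof.
move=> /negbTE hj; rewrite /twist_bend hj.
by split=> [[a [b d]]|[a b d]]; [split | split; [|split]].
Qed.

Section Coordinates.
Variable rho : (R -> S) -> M.
Hypothesis ht : tame m rho.
Let hr := tame_representation ht.
Let bd := rho_bdry m rho.
Let cr j b := rho (crossing_loop m j b).
Let hbd e : SU31 (bd e). Proof. exact: rho_bdry_SU31. Qed.
Let hcr j b : SU31 (cr j b). Proof. exact: rho_crossing_SU31. Qed.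

Let P0 j := (bd (side m j false), bd (next_side (side m j false))).
Let Q0 j := (bd (prev_side (side m j true)), bd (side m j true)).
Let H0 j := (bd (side m j false), bd (side m j true)).

Let opposite j : cj (cr j false) (bd (side m j true)) = invmx (bd (side m j false)).
Proof. exact: (rho_opposite hm gam_simple hr). Qed.

(** The reference groups are read off from rho itself, so every twist-bend parameter is (0, 0) and
    repeated eigenvalues do no harm. *)
Lemma coord_exists : exists2 T, reference_system lab T & exists c, fn_coord_of lab m T rho c.
Proof.
have hQ j : exists Q, diagonalizes lab (bd (side m j false)) Q.
  by apply: (diagonalizes_exists hlab); exact: rho_bdry_lox.
have [Q dQ] := choice hQ.
pose G0 j := SepGroup (bd (side m j false)) (bd (next_side (side m j false)))
  (cj (cr j false) (bd (prev_side (side m j true)))) (Q j).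
pose K0 j := HandleGroup (bd (side m j false)) (cr j true) (Q j).
have [T [rT eG eK]] : exists T : references R 'I_(3 * g - 3), [/\ reference_system lab T,
    forall j, sep_ref T j (P0 j) (Q0 j) = G0 j & forall j, handle_ref T j (H0 j) = K0 j].
  apply: (reference_exists hlab) => j; split=> //=.
  - exact: conj2_refl.
  - by exists (cr j false) => //=; rewrite opposite.
  - by rewrite -rho_side_true //; exact: conj2_refl.
have [c hc] : exists c, forall v, piece_coord_of lab (piece m rho v) (c v).
  have ex v : exists c, piece_coord_of lab (piece m rho v) c.
    by apply: (piece_coord_exists hlab); case: ht => _ _ _ _; apply.
  by have [c hc] := choice ex; exists c.
exists T => //; exists (FNCoord c (fun=> (0, 0))); split=> //= j.
rewrite /twist_bend; split; first exact: angle0; split; first exact: angle0.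
have u1 : SU31 (1%:M : M) by exact: SU31_1.
have [hQj _ _] := dQ j.
case: ifP => _.
  exists 1%:M => //; have := eK j; rewrite /H0 /bd => ->.
  by rewrite /= Emx0 cj_1 // mulmx1 !cj1.
exists 1%:M => //; have := eG j; rewrite /P0 /Q0 /bd => ->.
by rewrite /= Emx0 cj_1 // !cj1.
Qed.

Variable T : references R 'I_(3 * g - 3).
Hypothesis hT : reference_system lab T.

Let sep_spec j : let G := sep_ref T j (P0 j) (Q0 j) in
  [/\ diagonalizes lab (sA G) (sQ G), conj2 (P0 j) (sA G, sB G) & conj2 (Q0 j) (sC G, invmx (sA G))].
Proof.
case: hT => _ _ h _; apply: h => //=; first exact: rho_bdry_lox.
exact: sides_conj.
Qed.

Let handle_spec j : let G := handle_ref T j (H0 j) in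
  [/\ diagonalizes lab (hA G) (hQ G), SU31 (hB G) &
     conj2 (H0 j) (hA G, cj (hB G) (invmx (hA G)))].
Proof.
case: hT => _ _ _ h; apply: h => //=; first exact: rho_bdry_lox.
exact: sides_conj.
Qed.

(** The reference system is arbitrary here, so the comparison matrix K is only known to commute with
    A; separability is what puts it in the form Q E(kappa, psi) Q^-1. *)
Lemma twist_exists j : separable_poly (char_poly (bd (side m j false))) ->
  exists kp, twist_bend m T rho j kp.
Proof.
move=> sep; have hA := hbd (side m j false).
case: (boolP (is_handle m j)) => hj.
  have [dG sB' cG] := handle_spec j.
  have [kp [a1 a2 tw]] := handle_twist_exists dG sB' cG (rho_side_true j ht) hA (hcr j true) sep.
  by exists kp; apply/(twist_handleE _ _ _ hj).
have [dG c1 c3] := sep_spec j.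
have [kp [a1 a2 tw]] := sep_twist_exists dG c1 c3 (opposite j) hA (hcr j false) sep.
by exists kp; apply/(twist_sepE _ _ _ hj).
Qed.

Variable c : fn_coord R g.
Hypothesis hc : fn_coord_of lab m T rho c.

Lemma coord_admissible : admissible c.
Proof.
move=> v; have [hp _] := hc; have [_ _ _ [FA [FB [[eA _] [eB _] <- _ _]]]] := hp v.
have [_ _ _ _ /(_ v) [[lA lB] nc _ _]] := ht.
by exists (piece m rho v).1, (piece m rho v).2, FA, FB; split.
Qed.

(** By [piece_conj2], pieces with these coordinates are conjugate one by one to those of rho, whose
    two sides are opposite along each curve; conjugacy to an inverse does not see the separate
    conjugators. *)
Lemma coord_compatible : compatible lab m c.
Proof.
move=> P hP [j k] /=.
have [hp _] := hc.
have per e : exists2 h, SU31 h & peripheral (P e.1) e.2 = cj h (bd e).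
  have [ns cP] := hP e.1; have [_ _ _ _ /(_ e.1) ns'] := ht.
  have [h hh [e1 e2]] := piece_conj2 ns' ns (hp e.1) cP.
  exists h; first exact: hh.
  rewrite (surjective_pairing (P e.1)) e1 e2.
  rewrite (@peripheral_cj _ h (piece m rho e.1) e.2 hh (SU31_unit (hbd _)) (SU31_unit (hbd _))).
  by rewrite peripheral_piece // -surjective_pairing.
have [h hh e1] := per (side m j false); have [h' hh' e2] := per (side m j true).
rewrite e1 e2; apply: mismatch_conj; first exact: SU31_cj.
have hV := SU31_inv hh; have hx := SU31_mul hh' (hcr j true).
exists (h' *m cr j true *m invmx h); first exact: SU31_mul.
rewrite /bd (rho_side_true j ht) -(cj_inv hh (SU31_unit (hbd _))).
by rewrite -(cj_cj _ hx hV) (cjK _ hh) -(cj_cj _ hh' (hcr j true)).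
Qed.
End Coordinates.
End Representation.

(** * Equal coordinates and conjugacy *)

Section Determination.
Variables (R : realType) (S : topologicalType) (g : nat).
Variables (gam : 'I_(3 * g - 3) -> R -> S) (m : marking R S g).
Notation C := R[i].
Notation M := 'M[C]_4.
Variable lab : {poly C} -> C.
Hypotheses (g2 : (2 <= g)%N) (hS : closed_surface R S) (hC : curve_system gam)
  (hm : marks gam m) (hsimple : is_simple m).
Variables (rho rho' : (R -> S) -> M).
Hypotheses (ht : tame m rho) (ht' : tame m rho').
Variables (T : references R 'I_(3 * g - 3)) (c : fn_coord R g).
Hypothesis hT : reference_system lab T.
Hypothesis hc : fn_coord_of lab m T rho c.

Let gam_simple j : simple_closed (gam j).
Proof. by case: hC => h _ _ _; have [] := h j. Qed.

Let gam_disjoint i j : i != j -> disjoint_curves (gam i) (gam j).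
Proof. by case: hC => _ h _ _; apply: h. Qed.

Let bd := rho_bdry m rho.
Let bd' := rho_bdry m rho'.
Let cr j b := rho (crossing_loop m j b).
Let cr' j b := rho' (crossing_loop m j b).
Let hbd e : SU31 (bd e). Proof. exact: (rho_bdry_SU31 hm). Qed.
Let hcr j b : SU31 (cr j b). Proof. exact: (rho_crossing_SU31 hC hm). Qed.
Let hcr' j b : SU31 (cr' j b). Proof. exact: (rho_crossing_SU31 hC hm). Qed.

Lemma coord_of_conjugate : conjugate_reps (base m) rho rho' -> fn_coord_of lab m T rho' c.
Proof.
move=> [h hh eh]; have [hp htw] := hc.
have eb e : bd' e = cj h (bd e) by apply: eh; exact: (boundary_loopP hm).
have ec j b : cr' j b = cj h (cr j b) by apply: eh; exact: (crossing_loopP hm gam_simple).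
split=> [v|j].
  have -> : piece m rho' v = (cj h (piece m rho v).1, cj h (piece m rho v).2).
    by rewrite /piece; congr pair; exact: eb.
  exact: piece_coord_cj.
have hV := SU31_inv hh; have [t1 t2 _ _] := hT.
have c2 e f : conj2 (bd e, bd f) (bd' e, bd' f) by exists h => //=; rewrite !eb.
have := htw j; case: (boolP (is_handle m j)) => hj.
  move=> /(twist_handleE _ _ _ hj) [a1 a2 tw]; apply/(twist_handleE _ _ _ hj).
  rewrite -(t2 j _ _ (c2 _ _)); split; [exact: a1 | exact: a2 |].
  by have := handle_twist_cj hh tw; rewrite -/(bd _) -/(cr _ _) -eb -ec.
move=> /(twist_sepE _ _ _ hj) [a1 a2 tw]; apply/(twist_sepE _ _ _ hj).
rewrite -(t1 j _ _ _ _ (c2 _ _) (c2 _ _)); split; [exact: a1 | exact: a2 |].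
by have := sep_twist_cj hh (hcr j false) tw; rewrite -!/(bd _) -/(cr _ _) -!eb -ec.
Qed.

Hypothesis hc' : fn_coord_of lab m T rho' c.

Lemma conjugate_of_coord : conjugate_reps (base m) rho rho'.
Proof.
have [hp htw] := hc; have [hp' htw'] := hc'.
have ns v : nonsingular (piece m rho v).1 (piece m rho v).2 by case: ht.
have [G hG] : exists G : 'I_(2 * g - 2) -> M, forall v, SU31 (G v) /\ forall i, bd' (v, i) = cj (G v) (bd (v, i)).
  have ex v : exists h, SU31 h /\ forall i, bd' (v, i) = cj h (bd (v, i)).
    have ns' : nonsingular (piece m rho' v).1 (piece m rho' v).2 by case: ht'.
    have [h hh [e1 e2]] := piece_conj2 (ns v) ns' (hp v) (hp' v).
    exists h; split=> [|i]; first exact: hh.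
    rewrite /bd' /bd -(peripheral_piece hm _ _ ht') -(peripheral_piece hm _ _ ht).
    rewrite (surjective_pairing (piece m rho' v)) e1 e2.
    exact: (@peripheral_cj _ h (piece m rho v) i hh (SU31_unit (hbd _)) (SU31_unit (hbd _))).
  by have [G hG] := choice ex; exists G.
have hGS v := (hG v).1; have eb e : bd' e = cj (G e.1) (bd e).
  by case: e => v i; have [_] := hG v; apply.
have ub e : bd e \in unitmx := SU31_unit (hbd e).
have hr := tame_representation ht; have hr' := tame_representation ht'.
have c2 e f : e.1 = f.1 -> conj2 (bd e, bd f) (bd' e, bd' f).
  by move=> ef; exists (G e.1) => //=; rewrite !eb ef.
have cent e f Z : e.1 = f.1 -> e.2 != f.2 -> SU31 Z -> cj Z (bd e) = bd e -> cj Z (bd f) = bd f ->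
    exists k : C, k ^+ 4 = 1 /\ Z = k%:M.
  case: e f => [v i] [w k] /= <- ik hZ.
  rewrite /bd -!(peripheral_piece hm) //; exact: peripheral_centralizer.
have [t1 t2 _ _] := hT.
have i3 (i : 'I_3) : i != ordS i /\ ord_pred i != i.
  by case: i => [[|[|[|//]]] hi]; split; rewrite -val_eqE.
(* Across a handle the conjugator matches exactly; across a curve between distinct pants it matches
   up to a fourth root of unity k. *)
have cross j : exists k : C, (~~ is_handle m j -> k ^+ 4 = 1) /\
    cr' j false *m G (side m j true).1 =
      (if is_handle m j then 1 else k) *: (G (side m j false).1 *m cr j false).
  have := htw j; have := htw' j.
  case: (boolP (is_handle m j)) => hj.
    have same := eqP hj; have dif : (side m j false).2 != (side m j true).2.
      apply/eqP => e2; have /bij_inj inj : bijective (fun e : 'I_(3 * g - 3) * bool => side m e.1 e.2).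
        by case: hm.
      have /inj // : side m (j, false).1 (j, false).2 = side m (j, true).1 (j, true).2.
      by rewrite /= (surjective_pairing (side m j false)) same e2 -surjective_pairing.
    move=> /(twist_handleE _ _ _ hj) [_ _ tw'] /(twist_handleE _ _ _ hj) [_ _ tw].
    (* Reference groups depend only on the conjugacy classes of the pieces, so both twists are
       measured against the same group. *)
    rewrite -(t2 j _ _ (c2 _ _ same)) in tw'.
    have eF : bd' (side m j true) = cj (G (side m j false).1) (bd (side m j true)) by rewrite same eb.
    have := handle_twist_determined (hbd _) (hGS _) (hcr j true) (hcr' j true)
      (fun Z => cent (side m j false) (side m j true) Z same dif) (eb _) eF (rho_side_true hC hm j ht) (rho_side_true hC hm j ht') tw tw'.
    rewrite /cr /cr' (rho_crossing_true hm gam_simple hr) (rho_crossing_true hm gam_simple hr').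
    rewrite -!/(cr _ _) -!/(cr' _ _) => e; exists 1; split=> //; rewrite scale1r -same.
    have [u u'] := (SU31_unit (hcr j false), SU31_unit (hcr' j false)).
    by rewrite -[G _ in LHS](mulmxKV u) -e !mulmxA mulmxV // mul1mx.
  move=> /(twist_sepE _ _ _ hj) [_ _ tw'] /(twist_sepE _ _ _ hj) [_ _ tw].
  rewrite -(t1 j _ _ _ _ (c2 _ _ _) (c2 _ _ _)) // in tw'.
  have [n1 _] := i3 (side m j false).2; have [_ n2] := i3 (side m j true).2.
  have eN : bd' (next_side (side m j false)) = cj (G (side m j false).1) (bd (next_side (side m j false))).
    exact: eb.
  have eP : bd' (prev_side (side m j true)) = cj (G (side m j true).1) (bd (prev_side (side m j true))).
    exact: eb.
  have [k [k4 ek]] := sep_twist_determined (hbd _) (hGS _) (hGS _) (hcr j false) (hcr' j false)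
    (fun Z => cent (side m j false) (next_side (side m j false)) Z erefl n1)
    (fun Z => cent (prev_side (side m j true)) (side m j true) Z erefl n2)
    (eb _) eN eP (eb _)
    (rho_opposite hm gam_simple hr j) (rho_opposite hm gam_simple hr' j) tw tw'.
  by exists k.
have [k hk] := choice cross.
have [s [s0 hs]] := scalar_correction g2 hS hm gam_simple gam_disjoint hsimple (fun j => (hk j).1).
(* After rescaling, the conjugators match across every curve and [transport_rigidity] applies.
   Conjugation does not see the scalar, so [G v0] itself is the final conjugator. *)
pose H v := s v *: G v.
have fixb v (i : 'I_3) : twist (base m) rho rho' (boundary_loop m (v, i)) (H v) = H v.
  apply/(twist_fix hr hr'); first exact: (boundary_loopP hm).
  have := eb (v, i); rewrite /bd' /bd /rho_bdry => ->; rewrite /H /= -scalemxAr -scalemxAl; congr (_ *: _).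
  by rewrite /cj mulmxKV //; exact: SU31_unit.
have fixc j : twist (base m) rho rho' (crossing_loop m j false) (H (side m j false).1) =
    H (side m j true).1.
  apply/(twist_fix hr hr'); first exact: (crossing_loopP hm gam_simple).
  have [_ e] := hk j; rewrite -/(cr' _ _) -/(cr _ _) /H -scalemxAr e -scalemxAl scalerA; congr (_ *: _).
  by case: (boolP (is_handle m j)) => [/eqP ->|/hs//]; rewrite mulr1.
have [fixp _] := transport_rigidity hS hm gam_simple gam_disjoint (twist_system hr hr')
  (fun v i _ => fixb v i) fixc.
pose v0 := Ordinal (pants_gt0 g2); exists (G v0) => // p lp.
have /(twist_fix hr hr' _ _ lp) := fixp v0 p lp.
rewrite /H -scalemxAr -scalemxAl => /(scalerI (s0 v0)) e.
have u := SU31_unit (hGS v0).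
by rewrite /cj -e mulmxK.
Qed.
End Determination.

Theorem theorem1p3 (R : realType) (S : topologicalType) (g : nat)
    (gam : 'I_(3 * g - 3) -> R -> S) (m : marking R S g)
    (lab : {poly R[i]} -> R[i]) (rho : (R -> S) -> 'M[R[i]]_4)
    (hg : (2 <= g)%N)
    (hS : closed_surface R S) (hO : orientable R S) (hG : has_genus R S g)
    (hC : curve_system gam) (hm : marks gam m) (hsimple : is_simple m)
    (hlab : labelling lab) (hrho : tame m rho) :
  [/\ (* rho has coordinates *)
      (exists2 T, reference_system lab T & exists c, fn_coord_of lab m T rho c)
      /\ (forall T j, reference_system lab T ->
            separable_poly (char_poly (rho_bdry m rho (side m j false))) ->
            exists kp, twist_bend m T rho j kp),
      (* the coordinates determine rho up to conjugation *)
      forall T c, reference_system lab T -> fn_coord_of lab m T rho c ->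
        forall rho', tame m rho' ->
          (fn_coord_of lab m T rho' c <-> conjugate_reps (base m) rho rho'),
      (* the cross-ratios lie on the variety, and the coordinates satisfy the
         compatibility conditions *)
      (forall T c, reference_system lab T -> fn_coord_of lab m T rho c ->
         admissible c /\ compatible lab m c)
      /\ (forall P P' : 'M[R[i]]_4, loxodromic P -> loxodromic P' ->
            (conj1 (invmx P) P' <-> forall k, mismatch P P' k = 0)) &
      (* 30 g - 30 real parameters *)
      [/\ (forall c c' : fn_coord R g, admissible c -> admissible c' ->
             same_kinds c c' ->
             (forall i, real_coord c i = real_coord c' i) -> c = c'),
          (exists (x : 'I_5 -> R) (e : R), 0 < e /\
             forall y : 'I_5 -> R, (forall k, `|y k - x k| < e) ->
             exists2 t, cross_ratio_variety t & forall k, xr_coord t k = y k) &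
          (#|real_index g| = 30 * g - 30 + #|constraint_index g|)%N]].
Proof.
split.
- split; first exact: (coord_exists hC hm hlab hrho).
  by move=> T j hT sep; exact: (twist_exists hC hm hrho hT).
- move=> T c hT hc rho' hrho'; split.
    exact: (conjugate_of_coord hg hS hC hm hsimple hrho hrho' hT hc).
  exact: (coord_of_conjugate hC hm hrho hT hc).
- split=> [T c hT hc|P P' lP lP']; last exact: mismatch_conjP.
  by split; [exact: (coord_admissible hrho hc) | exact: (coord_compatible hC hm hrho hc)].
- split; [exact: real_coord_inj | exact: variety_open | exact: card_real_index].
Qed.
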